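(* Let $k=\lfloor K/2\rfloor$ and $n=\lfloor N/2\rfloor$. Then the following classes form a basis of the rational cohomology of the real Grassmannian $\mathrm{Gr}_K(\mathbb{R}^N)$: $$H^*(\mathrm{Gr}_K(\mathbb{R}^N);\mathbb{Q})=\begin{cases}\mathbb{Q}\big\langle[\sigma_{D\lambda}],\,[\sigma_{L(D\lambda)}]:\lambda\subseteq k\times(n-k)\big\rangle & \text{if } N \text{ is even and } K \text{ is odd},\\[2pt] \mathbb{Q}\big\langle[\sigma_{D\lambda}]:\lambda\subseteq k\times(n-k)\big\rangle & \text{otherwise.}\end{cases}$$
   Context: $\mathrm{Gr}_K(\mathbb{R}^N)$ is the real Grassmannian of $K$-planes in $\mathbb{R}^N$. A Young diagram $\lambda\subseteq p\times q$ is a sequence $q\ge\lambda_1\ge\cdots\ge\lambda_p\ge 0$ (padded by zeros when regarded with more rows). For $\lambda\subseteq K\times (N-K)$ the Schubert variety $\sigma_\lambda\subseteq \mathrm{Gr}_K(\mathbb{R}^N)$ is $\sigma_\lambda=\{U:\dim(U\cap E_{N-K+j-\lambda_j})\ge j,\ j=1,\ldots,K\}$, with $E_i=\langle e_1,\ldots,e_i\rangle$; it has codimension $|\lambda|$ and is the closure of the Schubert cell $\Omega_\lambda$. The Schubert cells stratify the Grassmannian by contractible strata; the associated Vassiliev cochain complex has the cooriented cells of codimension $i$ as a basis in degree $i$ and computes $H^*(\mathrm{Gr}_K(\mathbb{R}^N);\mathbb{Z})$. $\sigma_\lambda$ is called a cycle if $\Omega_\lambda$ is a cocycle in this complex, and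 then $[\sigma_\lambda]$ denotes its cohomology class; the varieties appearing in the statement are cycles. The double $D\lambda\subseteq 2p\times 2q$ of $\lambda\subseteq p\times q$ is obtained by subdividing each box into $2\times2$ boxes: $D\lambda=(2\lambda_1,2\lambda_1,\ldots,2\lambda_p,2\lambda_p)$. For $\mu\subseteq p\times q$, $L\mu\subseteq(p+1)\times(q+1)$ is the partition $L\mu=(q+1,\mu_1+1,\mu_2+1,\ldots,\mu_p+1)$, i.e. the diagram containing the whole first row and first column, the complement of this L-shape being $\mu$; for Schubert varieties $\sigma_{L\mu}$ in $\mathrm{Gr}_K(\mathbb{R}^N)$ the target rectangle is $(p+1)\times(q+1)=K\times(N-K)$.
   Formalization: For N even and K odd, 2(n-k) exceeds N-K, so for some λ ⊆ k×(n-k) the diagrams Dλ and L(Dλ) do not fit in K×(N-K) and name no Schubert variety (e.g. N=4, K=3, λ=(1)); only those λ whose diagrams fit, i.e. λ ⊆ k×(n-k-1), are used in that case. *)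

(* Defs.v *)
From HB Require Import structures.
From mathcomp Require Import all_boot all_order all_algebra.
From mathcomp Require Import all_classical all_reals all_analysis.

Set Implicit Arguments.
Unset Strict Implicit.
Unset Printing Implicit Defensive.

Import Order.TTheory GRing.Theory Num.Theory.
Import numFieldTopology.Exports.

Local Open Scope classical_set_scope.
Local Open Scope ring_scope.

Definition std_simplex (R : realType) (n : nat) : set 'rV[R]_n.+1 :=
  [set x | (forall j, 0 <= x 0 j) /\ \sum_j x 0 j = 1].

Definition coface_row (R : realType) (n : nat) (i : 'I_n.+2)
    (x : 'rV[R]_n.+1) : 'rV[R]_n.+2 :=
  \row_j (if unlift i j is Some k then x 0 k else 0).

Lemma coface_rowP (R : realType) (n : nat) (i : 'I_n.+2) (x : 'rV[R]_n.+1) :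
  std_simplex x -> std_simplex (coface_row i x).
Proof.
move=> [x_ge0 x_sum1]; split=> [j|].
  by rewrite mxE; case: unliftP.
rewrite (bigD1_ord i) //= mxE unlift_none add0r -x_sum1.
by apply: eq_bigr => k _; rewrite mxE liftK.
Qed.

Definition coface (R : realType) (n : nat) (i : 'I_n.+2)
    (x : set_type (@std_simplex R n)) : set_type (@std_simplex R n.+1) :=
  exist _ (coface_row i (val x)) (mem_set (coface_rowP i (set_valP x))).

Lemma coface_row_continuous (R : realType) (n : nat) (i : 'I_n.+2) :
  continuous (@coface_row R n i).
Proof.
move=> x A [P Px PA].
pose Q (a : 'I_1) (k : 'I_n.+1) := P a (lift i k).
exists Q => [a k|y Qy]; first by have := Px a (lift i k); rewrite ord1 mxE liftK.
apply: PA => a j; rewrite ord1 mxE; case: unliftP => [k ->|->]; first exact: Qy.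
by have := Px 0 i; rewrite mxE unlift_none; exact: nbhs_singleton.
Qed.

Lemma coface_continuous (R : realType) (n : nat) (i : 'I_n.+2) :
  continuous (@coface R n i).
Proof.
apply: continuous_comp_initial => x.
apply: (@continuous_comp _ _ _ set_val (@coface_row R n i)).
  exact: initial_continuous.
exact: coface_row_continuous.
Qed.

Record singular (R : realType) (n : nat) (X : topologicalType) := Singular {
  singular_fun :> set_type (@std_simplex R n) -> X;
  singular_continuous : continuous singular_fun }.

Definition face (R : realType) (n : nat) (X : topologicalType) (i : 'I_n.+2)
    (s : singular R n.+1 X) : singular R n X :=
  Singular (fun x => continuous_comp (@coface_continuous R n i x)
                       (@singular_continuous _ _ _ s (coface i x))).

(* Cochains of the total complex, with one component in each degree: no cast
   between degrees is then ever needed. *)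
Definition cochain (R : realType) (X : topologicalType) (A : Type) : Type :=
  forall n : nat, singular R n X -> A.

Definition homogeneous (R : realType) (X : topologicalType) (A : pzRingType)
    (i : nat) (f : cochain R X A) : Prop :=
  forall n (s : singular R n X), n != i -> f n s = 0.

Definition cobound (R : realType) (X : topologicalType) (A : pzRingType)
    (f : cochain R X A) : cochain R X A :=
  fun n => match n with
  | 0 => fun _ => 0
  | m.+1 => fun s => \sum_(j < m.+2) (-1) ^+ j * f m (face j s)
  end.

Definition carried (R : realType) (n : nat) (X : topologicalType) (P : set X)
    (s : singular R n X) : Prop := forall x, P (s x).

(* Cochains on a pair (P, Q) of subspaces, Q `<=` P, are represented by cochains
   on the ambient space X vanishing on the simplices of Q; their values on the
   simplices not carried by P are irrelevant.  For Q = set0, no simplex being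
   carried by set0, one gets the absolute notions on P. *)
Definition rel_cocycle (R : realType) (X : topologicalType) (A : pzRingType)
    (P Q : set X) (f : cochain R X A) : Prop :=
  (forall n (s : singular R n X), carried Q s -> f n s = 0) /\
  (forall n (s : singular R n X), carried P s -> cobound f s = 0).

Definition rel_coboundary (R : realType) (X : topologicalType) (A : pzRingType)
    (P Q : set X) (f : cochain R X A) : Prop :=
  exists g : cochain R X A,
    (forall n (s : singular R n X), carried Q s -> g n s = 0) /\
    (forall n (s : singular R n X), carried P s -> f n s = cobound g s).

Definition rationalize (R : realType) (X : topologicalType)
    (f : cochain R X int) : cochain R X rat := fun n s => (f n s)%:~R.

(* The classes of the f i, i \in L, form a basis of the direct sum of the
   rational cohomology groups of X. *)
Definition rational_cohomology_basis (R : realType) (X : topologicalType)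
    (I : finType) (L : {set I}) (f : I -> cochain R X rat) : Prop :=
  [/\ forall i, i \in L -> rel_cocycle setT set0 (f i),
      forall g : cochain R X rat, rel_cocycle setT set0 g ->
        (exists m, forall n (s : singular R n X), (m <= n)%N -> g n s = 0) ->
        exists a : I -> rat,
          rel_coboundary setT set0
            (fun n s => g n s - \sum_(i in L) a i * f i n s)
    & forall a : I -> rat,
        rel_coboundary setT set0 (fun n s => \sum_(i in L) a i * f i n s) ->
        forall i, i \in L -> a i = 0].

Definition Gr (R : realType) (N K : nat) : Type :=
  {U : {vspace 'rV[R]_N} | \dim U == K}.

Definition rows (R : realType) (N K : nat) (M : 'M[R]_(K, N)) :
    K.-tuple 'rV[R]_N := [tuple row i M | i < K].

Definition frames (R : realType) (N K : nat) : set 'M[R]_(K, N) :=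
  [set M | free (rows M)].

Lemma dim_span_frame (R : realType) (N K : nat)
  (M : set_type (@frames R N K)) : \dim <<rows (val M)>> == K.
Proof.
have := set_valP M; rewrite /frames /= /free => /eqP ->.
by rewrite size_tuple card_ord.
Qed.

Definition span_frame (R : realType) (N K : nat)
    (M : set_type (@frames R N K)) : Gr R N K :=
  exist (fun U : {vspace 'rV[R]_N} => \dim U == K) _ (dim_span_frame M).

(* The quotient topology from the space of K-frames. *)
Definition gr_open (R : realType) (N K : nat) : set_system (Gr R N K) :=
  [set A | open (@span_frame R N K @^-1` A)].

Lemma gr_openT (R : realType) (N K : nat) : @gr_open R N K setT.
Proof. by rewrite /gr_open /= preimage_setT; exact: openT. Qed.

Lemma gr_openI (R : realType) (N K : nat) : setI_closed (@gr_open R N K).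
Proof. by move=> A B; rewrite /gr_open /= preimage_setI; exact: openI. Qed.

Lemma gr_open_bigU (R : realType) (N K : nat) (I : Type)
  (f : I -> set (Gr R N K)) :
  (forall i, gr_open (f i)) -> gr_open (\bigcup_i f i).
Proof.
move=> fo; rewrite /gr_open /= preimage_bigcup.
by apply: bigcup_open => i _; exact: fo.
Qed.

HB.instance Definition _ (R : realType) (N K : nat) := Choice.on (Gr R N K).
HB.instance Definition _ (R : realType) (N K : nat) :=
  isOpenTopological.Build (Gr R N K)
    (@gr_openT R N K) (@gr_openI R N K) (@gr_open_bigU R N K).

Definition young (p q : nat) : Type :=
  {l : p.-tuple 'I_q.+1 | sorted geq [seq val x | x <- l]}.

HB.instance Definition _ (p q : nat) := Finite.on (young p q).

Definition parts (p q : nat) (l : young p q) : seq nat :=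
  [seq val x | x <- val l].

Definition codim (p q : nat) (l : young p q) : nat := sumn (parts l).

Definition doubled (s : seq nat) : seq nat :=
  flatten [seq [:: x.*2; x.*2] | x <- s].

Definition hooked (q : nat) (s : seq nat) : seq nat :=
  q.+1 :: [seq x.+1 | x <- s].

(* Equality up to padding by zeros. *)
Definition same_diagram (s t : seq nat) : bool :=
  [forall j : 'I_(maxn (size s) (size t)), nth 0%N s j == nth 0%N t j].

Definition flag (R : realType) (N i : nat) : {vspace 'rV[R]_N} :=
  <<[seq delta_mx 0%R j | j : 'I_N <- enum 'I_N & (j < i)%N]>>%VS.

Definition jump (N K : nat) (l : young K (N - K)) (j : 'I_K) : nat :=
  N - K + j.+1 - nth 0%N (parts l) j.

(* The planes whose intersections with the flag jump in dimension exactly at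
   the indices [jump l j]; the Schubert variety of l is the closure of this
   cell. *)
Definition schubert_cell (R : realType) (N K : nat) (l : young K (N - K)) :
    set (Gr R N K) :=
  [set U | forall j : 'I_K,
     \dim (val U :&: flag R N (jump l j)) = j.+1 /\
     \dim (val U :&: flag R N (jump l j).-1) = j].

Definition stratum_lt (R : realType) (N K i : nat) : set (Gr R N K) :=
  [set U | exists2 l : young K (N - K), (codim l < i)%N & schubert_cell l U].

(* With F = stratum_lt, the Vassiliev complex is the first page
     H^i(F i.+1, F i; Z) -> H^i.+1(F i.+2, F i.+1; Z)
   of the spectral sequence of the filtration F.  By excision its i-th term is
   the direct sum, over the cells of codimension i, of the groups
   H^i(F i `|` cell, F i; Z), which are infinite cyclic by the Thom
   isomorphism.  A generator is a coorientation of the cell; the corresponding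
   element of the direct sum is the cooriented cell. *)
Definition cooriented_cell (R : realType) (N K : nat) (l : young K (N - K))
    (w : cochain R (Gr R N K) int) : Prop :=
  let i := codim l in
  let F := @stratum_lt R N K in
  [/\ homogeneous i w,
      rel_cocycle (F i.+1) (F i) w,
      forall m : young K (N - K), codim m = i -> m != l ->
        rel_coboundary (F i `|` schubert_cell m) (F i) w
    & forall v : cochain R (Gr R N K) int, homogeneous i v ->
        rel_cocycle (F i `|` schubert_cell l) (F i) v ->
        exists a : int, rel_coboundary (F i `|` schubert_cell l) (F i)
          (fun n s => v n s - a * w n s)].

(* The differential of the Vassiliev complex is the connecting homomorphism. *)
Definition vassiliev_cocycle (R : realType) (N K i : nat)
    (w : cochain R (Gr R N K) int) : Prop :=
  let F := @stratum_lt R N K in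
  rel_coboundary (F i.+2) (F i.+1) (cobound w).

(* f represents the class of the Schubert variety of l (in particular this
   variety is a cycle): the isomorphism from the cohomology of the Vassiliev
   complex matches the class of w in H^i(F i.+1, F i) with the unique class in
   H^i of the Grassmannian having the same image in H^i(F i.+1). *)
Definition schubert_class (R : realType) (N K : nat) (l : young K (N - K))
    (f : cochain R (Gr R N K) int) : Prop :=
  let i := codim l in
  [/\ homogeneous i f, rel_cocycle setT set0 f
    & exists w : cochain R (Gr R N K) int,
        [/\ cooriented_cell l w, vassiliev_cocycle i w
          & rel_coboundary (@stratum_lt R N K i.+1) set0
              (fun n s => f n s - w n s)]].

(* The Schubert classes of the diagrams in L are defined and, for any choice of
   coorientations, they form a basis of the rational cohomology. *)
Definition schubert_basis (R : realType) (N K : nat)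
    (L : {set young K (N - K)}) : Prop :=
  (forall l, l \in L ->
     exists f : cochain R (Gr R N K) int, schubert_class l f) /\
  (forall f : young K (N - K) -> cochain R (Gr R N K) int,
     (forall l, l \in L -> schubert_class l (f l)) ->
     rational_cohomology_basis L (fun l => rationalize (f l))).

(* Main.v *)
Require Import Defs.
From mathcomp Require Import all_boot all_order all_algebra.
From mathcomp Require Import all_classical all_reals all_analysis.
From mathcomp Require Import ring lra zify.

(* The Thom class of each Schubert cell l, supported in a chart around l, extends
   to a cochain W l on the Grassmannian which vanishes on the other cells of
   codimension at most that of l; one can moreover arrange that the coboundary
   of W l is a combination of the W m with integer coefficients c l m.  By
   excision along the filtration the finite complex of the W l with differential
   c then computes the cohomology of the Grassmannian.

   If c l m <> 0, then m is l with one box added, at a row j.  In the chart of m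
   the cell l splits into two halves exchanged by the reflection of one
   coordinate; comparing the signs by which it acts on the coorientations of l
   and m, one finds that the two halves contribute with opposite signs, and so
   c l m <> 0, if and only if j + (the j-th part of l) is odd.

   In terms of the set of pivots of a plane, a box moves a pivot from i to i - 1,
   and the parity condition depends on i only.  Over the rationals, moving the
   pivot at the first admissible i is an acyclic matching, whose unmatched
   diagrams are those where no box of odd type can be added or removed.  These
   are incident to no other diagram, and they are the diagrams D(lambda) and,
   for K odd and N even, L(D(lambda)). *)

Set Implicit Arguments.
Unset Strict Implicit.
Unset Printing Implicit Defensive.
Import Order.TTheory GRing.Theory Num.Theory.
Import numFieldNormedType.Exports.
Local Open Scope classical_set_scope.
Local Open Scope ring_scope.

(** * Formal simplices: cone operators and subdivision *)

(** No chain groups are formed: cochains are plain functions on simplices, and each chain operator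
    enters through its transpose. Exact sequences and the five lemma become explicit corrections of
    cochains that vanish on a subset. Integral classes have to yield rational ones. Instead of a
    universal coefficient theorem, the Thom classes are integral cochains that generate over every
    commutative ring; the comparison with the finite complex is run over [int] to build the [W l]
    and to compare coorientations, and over [rat] for the basis. The equation for the coboundary of
    [W l] is an identity of cochains. This carries the induction over cells, and it lets an
    incidence number be computed in one chart. Signs need no coherent choice of coorientations: the
    reflection in a coordinate acts on the whole Grassmannian and preserves every cell, so its
    effects on the Thom classes of two cells can be compared. As the statement quantifies over all
    representatives and coorientations, each Schubert class must also be shown to be determined up
    to sign. *)

Lemma alternating_faces_eq0 (A : pzRingType) n (G : 'I_n.+2 -> 'I_n.+1 -> A) :
  (forall (j j' : 'I_n.+2) (k k' : 'I_n.+1),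
     lift j k = j' -> lift j' k' = j -> G j k = G j' k') ->
  \sum_(j < n.+2) (-1) ^+ j * (\sum_(k < n.+1) (-1) ^+ k * G j k) = 0.
Proof.
move=> GE.
pose P (p : 'I_n.+2 * 'I_n.+1) := (p.2 < p.1)%N.
have -> : \sum_(j < n.+2) (-1) ^+ j * (\sum_(k < n.+1) (-1) ^+ k * G j k) =
    \sum_(p : 'I_n.+2 * 'I_n.+1) (-1) ^+ (p.1 + p.2) * G p.1 p.2.
  under eq_bigr do rewrite mulr_sumr.
  rewrite pair_bigA /=; apply: eq_bigr => p _.
  by rewrite mulrA -exprD.
rewrite (bigID P) /=.
(* [(j, k)] encodes deleting [j] and [lift j k] in this order; [h] exchanges the two, which changes
   the parity of [j + k]. *)
pose h (p : 'I_n.+2 * 'I_n.+1) : 'I_n.+2 * 'I_n.+1 :=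
  (lift p.1 p.2, odflt p.2 (unlift (lift p.1 p.2) p.1)).
have liftE (p : 'I_n.+2 * 'I_n.+1) : lift (h p).1 (h p).2 = p.1.
  rewrite /h /=; case: unliftP => [k <- //|e].
  by have := neq_lift p.1 p.2; rewrite -e eqxx.
have hK p : h (h p) = p.
  case: p => j k; have e1 : (h (h (j, k))).1 = j := liftE (j, k).
  have : lift (h (h (j, k))).1 (h (h (j, k))).2 = lift j k := liftE (h (j, k)).
  by rewrite e1 => /lift_inj e2; rewrite [LHS]surjective_pairing e1 e2.
have hP p : ~~ P (h p) = P p.
  case: p => j k; have /(congr1 val) := liftE (j, k); rewrite /P /= /bump.
  by set m := odflt _ _; lia.
rewrite [X in X + _](reindex_onto h h) /=; last by move=> p _; exact: hK.
rewrite (eq_bigl (fun p => ~~ P p)); last first.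
  by move=> p; rewrite hK eqxx andbT -[in RHS](hP p) negbK.
rewrite -big_split /= big1 // => -[j k] /= NP.
have hE : h (j, k) = (lift j k, (h (j, k)).2) by [].
rewrite -[G _ _](GE j _ k) //; last exact: (liftE (j, k)).
rewrite -mulrDl; have := congr1 val (liftE (j, k)).
move: NP; rewrite /P /= /bump; set m := odflt _ _ => jk e.
have {jk e}[-> ->] : (j <= k)%N /\ (m = j :> nat) by lia.
by rewrite /= add1n addSn (addnC k) exprS mulN1r addNr mul0r.
Qed.

Section ConeAlgebra.
Variables (A : comPzRingType).
Implicit Types E : Type.

(** The coboundary of a function of formal simplices, that is, of tuples of vertices. Operators on
    such functions are transposes of operators on chains. *)
Definition bdf E (m : nat) (phi : ('I_m.+1 -> E) -> A) (v : 'I_m.+2 -> E) : A :=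
  \sum_(j < m.+2) (-1) ^+ j * phi (v \o lift j).

Lemma bdf_bdf E m (phi : ('I_m.+1 -> E) -> A) v : bdf (bdf phi) v = 0.
Proof.
apply: (alternating_faces_eq0 (G := fun j k => phi ((v \o lift j) \o lift k))).
move=> j j' k k' e1 e2; congr (phi _); apply/funext => i /=; congr (v _).
apply/val_inj; move: e1 e2 => /(congr1 val) /= e1 /(congr1 val) /=.
rewrite -e1 /bump /=.
by repeat (case: leqP => /= ?); rewrite ?add0n ?add1n; lia.
Qed.

Lemma bdfB E m (phi psi : ('I_m.+1 -> E) -> A) v :
  bdf (fun u => phi u - psi u) v = bdf phi v - bdf psi v.
Proof. by rewrite /bdf -sumrB; apply: eq_bigr => j _; rewrite mulrBr. Qed.

Lemma eq_bdf E m (phi psi : ('I_m.+1 -> E) -> A) (v : 'I_m.+2 -> E) :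
  (forall j : 'I_m.+2, phi (v \o lift j) = psi (v \o lift j)) -> bdf phi v = bdf psi v.
Proof. by move=> e; apply: eq_bigr => j _; rewrite e. Qed.

Definition cone E (m : nat) (b : E) (v : 'I_m.+1 -> E) : 'I_m.+2 -> E :=
  fun i => if unlift ord0 i is Some k then v k else b.

Lemma cone0 E m (b : E) (v : 'I_m.+1 -> E) : cone b v ord0 = b.
Proof. by rewrite /cone unlift_none. Qed.

Lemma coneS E m (b : E) (v : 'I_m.+1 -> E) i : cone b v (lift ord0 i) = v i.
Proof. by rewrite /cone liftK. Qed.

Lemma comp_cone E E' (L : E -> E') m (b : E) (v : 'I_m.+1 -> E) :
  L \o cone b v = cone (L b) (L \o v).
Proof. by apply/funext => i; rewrite /= /cone; case: unliftP. Qed.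

Lemma cone_face0 E m (b : E) (v : 'I_m.+1 -> E) : cone b v \o lift ord0 = v.
Proof. by apply/funext => i; rewrite /= coneS. Qed.

Lemma cone_faceS E m (b : E) (v : 'I_m.+2 -> E) (j : 'I_m.+2) :
  cone b v \o lift (lift ord0 j) = cone b (v \o lift j).
Proof.
apply/funext => i /=; case: (unliftP ord0 i) => [k|] ->.
  rewrite coneS /= -(coneS b v); congr cone.
  by apply/val_inj; rewrite /= /bump; lia.
have -> : lift (lift ord0 j) ord0 = ord0 by apply/val_inj.
by rewrite !cone0.
Qed.

(** Dual of the boundary formula for cones: the base minus the cone over the boundary of the
    base. *)
Lemma bdf_cone E m (phi : ('I_m.+2 -> E) -> A) (b : E) (v : 'I_m.+2 -> E) :
  bdf phi (cone b v) = phi v - bdf (phi \o cone b) v.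
Proof.
rewrite /bdf big_ord_recl mul1r cone_face0; congr (_ + _).
rewrite -sumrN; apply: eq_bigr => j _.
by rewrite cone_faceS /= /bump /= add1n exprS mulN1r mulNr.
Qed.

Lemma bdf_cone0 E (phi : ('I_1 -> E) -> A) (b : E) (v : 'I_1 -> E) :
  bdf phi (cone b v) = phi v - phi (fun=> b).
Proof.
rewrite /bdf big_ord_recl mul1r cone_face0 big_ord1 /= expr1 mulN1r.
congr (_ - phi _); apply/funext => i /=.
by rewrite (ord1 i) (_ : lift _ _ = ord0) ?cone0 //; exact/val_inj.
Qed.

Section Homotopy.
Variables (E0 E : Type).
Variables (Phi1 Phi0 : forall m, (('I_m.+1 -> E) -> A) -> ('I_m.+1 -> E0) -> A).
Variable (b : forall m, ('I_m.+1 -> E0) -> E).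

(** Transpose of the acyclic carrier construction: the homotopy H is defined by coning, from the
    apex [b v], the chain Phi1 v - Phi0 v - H (d v). *)
Fixpoint conehom (m : nat) :
    (('I_m.+2 -> E) -> A) -> ('I_m.+1 -> E0) -> A :=
  match m with
  | 0 => fun phi v =>
      Phi1 (phi \o cone (b v)) v - Phi0 (phi \o cone (b v)) v
  | m'.+1 => fun phi v =>
      Phi1 (phi \o cone (b v)) v - Phi0 (phi \o cone (b v)) v
      - bdf (@conehom m' (phi \o cone (b v))) v
  end.

(** The last clause preserves the augmentation. It starts the induction, where the cone over a
    vertex has its apex as second face. *)
Definition chain_map
    (Phi : forall m, (('I_m.+1 -> E) -> A) -> ('I_m.+1 -> E0) -> A) :=
  [/\ forall m phi psi (v : 'I_m.+1 -> E0),
        Phi m (fun u => phi u - psi u) v = Phi m phi v - Phi m psi v,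
      forall m phi (v : 'I_m.+2 -> E0),
        Phi m.+1 (bdf phi) v = bdf (Phi m phi) v
    & forall a (v : 'I_1 -> E0), Phi 0%N (fun=> a) v = a].

Lemma chain_map_eq0 Phi : chain_map Phi ->
  forall m phi (v : 'I_m.+1 -> E0), (forall u, phi u = 0) -> Phi m phi v = 0.
Proof.
move=> [PhiB _ _] m phi v phi0; have := PhiB m phi phi v; rewrite subrr => <-.
by congr Phi; apply/funext => u; rewrite phi0 subrr.
Qed.

Hypotheses (Phi1P : chain_map Phi1) (Phi0P : chain_map Phi0).

Lemma conehomB m (phi psi : ('I_m.+2 -> E) -> A) v :
  conehom (fun u => phi u - psi u) v = conehom phi v - conehom psi v.
Proof.
have [B1 _ _] := Phi1P; have [B0 _ _] := Phi0P.
elim: m => [|m IH] in phi psi v *.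
  rewrite /= (B1 _ (phi \o cone (b v)) (psi \o cone (b v))).
  by rewrite (B0 _ (phi \o cone (b v)) (psi \o cone (b v))); ring.
rewrite [LHS]/= (B1 _ (phi \o cone (b v)) (psi \o cone (b v))).
rewrite (B0 _ (phi \o cone (b v)) (psi \o cone (b v))).
rewrite (eq_bdf (psi := fun u => conehom (phi \o cone (b v)) u
  - conehom (psi \o cone (b v)) u)); last by move=> j; rewrite -IH.
rewrite bdfB /=; ring.
Qed.

Lemma conehom_eq0 m (phi : ('I_m.+2 -> E) -> A) v :
  (forall u, phi u = 0) -> conehom phi v = 0.
Proof.
move=> phi0; have := conehomB phi phi v; rewrite subrr => <-; congr conehom.
by apply/funext => u; rewrite phi0 subrr.
Qed.

Lemma conehom0P (phi : ('I_1 -> E) -> A) v :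
  conehom (bdf phi) v = Phi1 phi v - Phi0 phi v.
Proof.
have [B1 _ e1] := Phi1P; have [B0 _ e0] := Phi0P => /=.
have -> : bdf phi \o cone (b v) = fun u => phi u - phi (fun=> b v).
  by apply/funext => u /=; rewrite bdf_cone0.
by rewrite B1 B0 e1 e0; ring.
Qed.

Lemma conehomP m (phi : ('I_m.+2 -> E) -> A) v :
  conehom (bdf phi) v = Phi1 phi v - Phi0 phi v - bdf (conehom phi) v.
Proof.
have [B1 d1 e1] := Phi1P; have [B0 d0 e0] := Phi0P.
(* [rest] is the boundary term of the induction hypothesis: zero at the start, and itself a
   coboundary later, so that its own coboundary vanishes in both cases. *)
have key m' (psi : ('I_m'.+2 -> E) -> A) (w : 'I_m'.+2 -> E0) rest :
    (forall u, conehom (bdf (psi \o cone (b w))) u =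
       Phi1 (psi \o cone (b w)) u - Phi0 (psi \o cone (b w)) u - rest u) ->
    bdf rest w = 0 ->
    conehom (bdf psi) w = Phi1 psi w - Phi0 psi w - bdf (conehom psi) w.
  move=> IH z; rewrite [LHS]/=.
  have -> : bdf psi \o cone (b w) = fun u => psi u - bdf (psi \o cone (b w)) u.
    by apply/funext => u /=; rewrite bdf_cone.
  rewrite B1 B0 d1 d0.
  rewrite (eq_bdf (phi := conehom _) (psi := fun u => conehom psi u
    - conehom (bdf (psi \o cone (b w))) u)); last by move=> j; exact: conehomB.
  rewrite bdfB [X in _ - (_ - X)](eq_bdf (psi := fun u =>
    Phi1 (psi \o cone (b w)) u - Phi0 (psi \o cone (b w)) u - rest u)) //.
  by rewrite !bdfB z; ring.
elim: m => [|m IH] in phi v *.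
  apply: (key _ _ _ (fun=> 0)) => [u|]; first by rewrite conehom0P subr0.
  by rewrite /bdf big1 // => j _; rewrite mulr0.
by apply: key => [u|]; [exact: IH | exact: bdf_bdf].
Qed.

End Homotopy.
Arguments conehom {E0 E} Phi1 Phi0 b {m}.

(** Cones and both chain maps stay among good simplices, hence so does the homotopy. This confines
    the prism operator to parameters in [0, 1]. *)
Lemma conehom_local E0 E
    (Phi1 Phi0 : forall m, (('I_m.+1 -> E) -> A) -> ('I_m.+1 -> E0) -> A)
    (b : forall m, ('I_m.+1 -> E0) -> E)
    (good0 : forall m, ('I_m.+1 -> E0) -> Prop)
    (good : forall m, ('I_m.+1 -> E) -> Prop) :
  (forall m (v : 'I_m.+2 -> E0) j, good0 _ v -> good0 _ (v \o lift j)) ->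
  (forall m phi psi (v : 'I_m.+1 -> E0), good0 _ v ->
     (forall u, good _ u -> phi u = psi u) -> Phi1 m phi v = Phi1 m psi v) ->
  (forall m phi psi (v : 'I_m.+1 -> E0), good0 _ v ->
     (forall u, good _ u -> phi u = psi u) -> Phi0 m phi v = Phi0 m psi v) ->
  (forall m k (v : 'I_m.+1 -> E0) (u : 'I_k.+1 -> E), good0 _ v -> good _ u ->
     good _ (cone (b _ v) u)) ->
  forall m phi psi (v : 'I_m.+1 -> E0), good0 _ v ->
     (forall u, good _ u -> phi u = psi u) ->
     conehom Phi1 Phi0 b phi v = conehom Phi1 Phi0 b psi v.
Proof.
move=> gf L1 L0 gc; elim=> [|m IH] phi psi v gv e /=.
  by congr (_ - _); [apply: L1|apply: L0] => // u gu /=; apply/e/gc.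
congr (_ - _ - _); [apply: L1|apply: L0|] => //; try by move=> u gu /=; apply/e/gc.
by apply: eq_bdf => j; apply: IH => [|u gu /=]; [exact: gf|apply/e/gc].
Qed.

Lemma conehom_natural E0 E0' E E' (L0 : E0 -> E0') (L : E -> E')
    (Phi1 Phi0 : forall m, (('I_m.+1 -> E) -> A) -> ('I_m.+1 -> E0) -> A)
    (b : forall m, ('I_m.+1 -> E0) -> E)
    (Phi1' Phi0' : forall m, (('I_m.+1 -> E') -> A) -> ('I_m.+1 -> E0') -> A)
    (b' : forall m, ('I_m.+1 -> E0') -> E') :
  (forall m (v : 'I_m.+1 -> E0), L (b _ v) = b' _ (L0 \o v)) ->
  (forall m phi (v : 'I_m.+1 -> E0),
     Phi1 m (fun u => phi (L \o u)) v = Phi1' m phi (L0 \o v)) ->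
  (forall m phi (v : 'I_m.+1 -> E0),
     Phi0 m (fun u => phi (L \o u)) v = Phi0' m phi (L0 \o v)) ->
  forall m phi (v : 'I_m.+1 -> E0),
    conehom Phi1 Phi0 b (fun u => phi (L \o u)) v =
    conehom Phi1' Phi0' b' phi (L0 \o v).
Proof.
move=> Lb P1 P0; elim=> [|m IH] phi v /=.
  have -> : (fun u => phi (L \o u)) \o cone (b _ v) =
      (fun u => (phi \o cone (b' _ (L0 \o v))) (L \o u)).
    by apply/funext => u /=; rewrite comp_cone Lb.
  by rewrite P1 P0.
have -> : (fun u => phi (L \o u)) \o cone (b _ v) =
    (fun u => (phi \o cone (b' _ (L0 \o v))) (L \o u)).
  by apply/funext => u /=; rewrite comp_cone Lb.
by rewrite P1 P0; congr (_ - _); apply: eq_bigr => j _; rewrite IH.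
Qed.

Section Subdivision.
Variables (E : Type) (b : forall m, ('I_m.+1 -> E) -> E).

(** Transpose of barycentric subdivision: the subdivided boundary is coned from [b v], later the
    barycentre. *)
Fixpoint sub (m : nat) : (('I_m.+1 -> E) -> A) -> ('I_m.+1 -> E) -> A :=
  match m with
  | 0 => fun phi v => phi v
  | m'.+1 => fun phi v => bdf (@sub m' (phi \o cone (b v))) v
  end.

Lemma sub_chain_map : chain_map (@sub).
Proof.
have subB m : forall phi psi (v : 'I_m.+1 -> E),
    sub (fun u => phi u - psi u) v = sub phi v - sub psi v.
  elim: m => [//|m IH] phi psi v /=; rewrite -bdfB.
  by apply: eq_bdf => j; rewrite -IH.
split=> //; elim=> [|m IH] phi v.
  transitivity (bdf (fun u => phi u - phi (fun=> b v)) v).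
    by apply: eq_bdf => j; rewrite /= bdf_cone0.
  rewrite bdfB [X in _ - X]/bdf big_ord_recl big_ord1 /= expr1 expr0; ring.
have subS m' (psi : ('I_m'.+2 -> E) -> A) (w : 'I_m'.+2 -> E) :
  sub psi w = bdf (sub (psi \o cone (b w))) w by [].
rewrite subS.
transitivity (bdf (fun u => sub phi u - sub (bdf (phi \o cone (b v))) u) v).
  apply: eq_bdf => j; rewrite -subB; congr (sub _ _); apply/funext => u.
  exact: bdf_cone.
rewrite bdfB [X in _ - X](eq_bdf (psi := bdf (sub (phi \o cone (b v))))).
  by rewrite bdf_bdf subr0.
by move=> j; rewrite IH.
Qed.

End Subdivision.

Lemma sub_natural E E' (L : E -> E') (b : forall m, ('I_m.+1 -> E) -> E)
    (b' : forall m, ('I_m.+1 -> E') -> E') :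
  (forall m (v : 'I_m.+1 -> E), L (b _ v) = b' _ (L \o v)) ->
  forall m phi (v : 'I_m.+1 -> E),
    sub b (fun u => phi (L \o u)) v = sub b' phi (L \o v).
Proof.
move=> Lb; elim=> [//|m IH] phi v /=.
have -> : (fun u => phi (L \o u)) \o cone (b _ v) =
    (fun u => (phi \o cone (b' _ (L \o v))) (L \o u)).
  by apply/funext => u /=; rewrite comp_cone Lb.
by apply: eq_bigr => j _; rewrite IH.
Qed.

End ConeAlgebra.

(** * Affine singular simplices *)

Lemma eq_continuous_at (S T : topologicalType) (f g : S -> T) x :
  f =1 g -> {for x, continuous f} -> {for x, continuous g}.
Proof. by move=> /funext ->. Qed.

Section Continuity.
Variables (R : realType) (T : topologicalType).

Lemma sum_continuous_at (I : Type) (r : seq I) (P : pred I) (F : I -> T -> R) x :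
  (forall i, P i -> {for x, continuous (F i)}) ->
  {for x, continuous (fun y => \sum_(i <- r | P i) F i y)}.
Proof. by move=> Fc; apply: (cvg_big (@add_continuous R)) => i /Fc. Qed.

Lemma prod_continuous_at (I : Type) (r : seq I) (P : pred I) (F : I -> T -> R) x :
  (forall i, P i -> {for x, continuous (F i)}) ->
  {for x, continuous (fun y => \prod_(i <- r | P i) F i y)}.
Proof. by move=> Fc; apply: (cvg_big (@mul_continuous R)) => i /Fc. Qed.

Lemma matrix_continuous_at m n (f : T -> 'M[R]_(m, n)) x :
  (forall i j, {for x, continuous (fun y => f y i j)}) ->
  {for x, continuous f}.
Proof.
move=> fc A [P Px PA]; apply: (filterS (P := [set y | forall i j, P i j (f y i j)])).
  by move=> y Py; exact: PA.
have : \forall y \near x, forall ij : 'I_m * 'I_n, P ij.1 ij.2 (f y ij.1 ij.2).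
  by apply: filter_forall => -[i j]; apply: fc; exact: Px.
by apply: filterS => y Py i j; exact: (Py (i, j)).
Qed.

End Continuity.

Section AffineSimplices.
Variable R : realType.
Notation "'Delta n" := (set_type (@std_simplex R n)) (at level 8, n at level 2).

Lemma affrow_subproof m n (v : 'I_m.+1 -> 'Delta n) (x : 'Delta m) :
  std_simplex (\sum_i val x 0 i *: val (v i)).
Proof.
have [x_ge0 x_sum] := set_valP x; split=> [j|].
  rewrite summxE; apply: sumr_ge0 => i _; rewrite mxE mulr_ge0 //.
  by have [+ _] := set_valP (v i); exact.
under eq_bigr do rewrite summxE.
rewrite exchange_big /= -[RHS]x_sum; apply: eq_bigr => i _.
under eq_bigr do rewrite mxE.
by rewrite -mulr_sumr; have [_ ->] := set_valP (v i); rewrite mulr1.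
Qed.

Definition affrow m n (v : 'I_m.+1 -> 'Delta n) (x : 'Delta m) : 'Delta n :=
  exist _ (\sum_i val x 0 i *: val (v i)) (mem_set (affrow_subproof v x)).

Lemma simplex_inj n (x y : 'Delta n) : (forall i, val x 0 i = val y 0 i) -> x = y.
Proof. by move=> e; apply/val_inj/rowP. Qed.

Lemma affrowE m n (v : 'I_m.+1 -> 'Delta n) x j :
  val (affrow v x) 0 j = \sum_i val x 0 i * val (v i) 0 j.
Proof. by rewrite /= summxE; apply: eq_bigr => i _; rewrite mxE. Qed.

Lemma simplex_coord_continuous n i : continuous (fun x : 'Delta n => val x 0 i).
Proof.
move=> x; have : {for x, continuous ((fun M : 'rV[R]_n.+1 => M 0 i) \o
    (@set_val _ (@std_simplex R n)))}; last exact.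
apply: continuous_comp.
  exact: initial_continuous.
exact: coord_continuous.
Qed.

Lemma affrow_continuous m n (v : 'I_m.+1 -> 'Delta n) : continuous (affrow v).
Proof.
apply: continuous_comp_initial => x; apply: matrix_continuous_at => i j.
rewrite [i]ord1; apply: eq_continuous_at.
  by move=> y; rewrite -[RHS]/(val (affrow v y) 0 j) affrowE.
by apply: sum_continuous_at => k _; apply: continuousM;
  [exact: simplex_coord_continuous|exact: cst_continuous].
Qed.

Lemma affrow_comp k m n (v : 'I_m.+1 -> 'Delta n) (u : 'I_k.+1 -> 'Delta m) x :
  affrow v (affrow u x) = affrow (affrow v \o u) x.
Proof.
apply: simplex_inj => j; rewrite !affrowE.
under eq_bigr do rewrite affrowE mulr_suml.
rewrite exchange_big /=; apply: eq_bigr => i _.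
rewrite [val (affrow _ _) _ _]affrowE mulr_sumr.
by apply: eq_bigr => l _; rewrite mulrA.
Qed.

Lemma vertex_subproof n (i : 'I_n.+1) : std_simplex (delta_mx 0 i : 'rV[R]_n.+1).
Proof.
split=> [j|]; first by rewrite mxE; case: (_ && _); rewrite ?ler01.
rewrite (bigD1 i) //= big1 ?addr0 ?mxE ?eqxx // => j ji.
by rewrite mxE eqxx (negPf ji).
Qed.

Definition vertex n (i : 'I_n.+1) : 'Delta n :=
  exist _ (delta_mx 0 i) (mem_set (vertex_subproof i)).

Lemma vertexE n (i j : 'I_n.+1) : val (vertex i) 0 j = (j == i)%:R.
Proof. by rewrite /= mxE. Qed.

Lemma affrow_vertex m n (v : 'I_m.+1 -> 'Delta n) i : affrow v (vertex i) = v i.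
Proof.
apply: simplex_inj => j; rewrite affrowE (bigD1 i) //= big1 => [|k ki].
  by rewrite mxE !eqxx mul1r addr0.
by rewrite mxE eqxx (negPf ki) mul0r.
Qed.

Lemma affrow_id n (x : 'Delta n) : affrow (@vertex n) x = x.
Proof.
apply: simplex_inj => j; rewrite affrowE (bigD1 j) //= big1 => [|k kj].
  by rewrite mxE !eqxx mulr1 addr0.
by rewrite vertexE eq_sym (negPf kj) mulr0.
Qed.

Lemma coface_affrow n j (x : 'Delta n) :
  coface j x = affrow (@vertex n.+1 \o lift j) x.
Proof.
apply: simplex_inj => i; rewrite affrowE /= mxE.
case: unliftP => [k ->|->].
  rewrite (bigD1 k) //= big1 => [|l lk]; first by rewrite mxE !eqxx mulr1 addr0.
  by rewrite mxE (inj_eq lift_inj) eq_sym (negPf lk) mulr0.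
by rewrite big1 // => l _; rewrite mxE (negPf (neq_lift _ _)) mulr0.
Qed.

Lemma affrow_coface m n (v : 'I_m.+2 -> 'Delta n) j x :
  affrow v (coface j x) = affrow (v \o lift j) x.
Proof.
rewrite coface_affrow affrow_comp; congr affrow; apply/funext => i /=.
exact: affrow_vertex.
Qed.

Section Aff.
Variable X : topologicalType.

Lemma singular_eq n (s t : singular R n X) : (forall x, s x = t x) -> s = t.
Proof.
case: s t => s sc [t tc] /= /funext e; move: tc; rewrite -e => tc.
by congr Singular; exact: Prop_irrelevance.
Qed.

Definition aff m n (s : singular R n X) (v : 'I_m.+1 -> 'Delta n) :
    singular R m X :=
  Singular (fun x => continuous_comp (@affrow_continuous m n v x)
                       (@singular_continuous _ _ _ s (affrow v x))).

Lemma aff_id n (s : singular R n X) : aff s (@vertex n) = s.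
Proof. by apply: singular_eq => x /=; rewrite affrow_id. Qed.

Lemma face_aff m n (s : singular R n X) (v : 'I_m.+2 -> 'Delta n) j :
  face j (aff s v) = aff s (v \o lift j).
Proof. by apply: singular_eq => x; rewrite /= affrow_coface. Qed.

Lemma aff_face m n (s : singular R n.+1 X) (v : 'I_m.+1 -> 'Delta n) j :
  aff (face j s) v = aff s (@coface R n j \o v).
Proof.
apply: singular_eq => x; rewrite /= coface_affrow affrow_comp.
by congr (s (affrow _ _)); apply/funext => i /=; rewrite coface_affrow.
Qed.

Lemma aff_aff k m n (s : singular R n X) (v : 'I_m.+1 -> 'Delta n)
    (u : 'I_k.+1 -> 'Delta m) :
  aff (aff s v) u = aff s (affrow v \o u).
Proof. by apply: singular_eq => x; rewrite /= affrow_comp. Qed.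

Lemma coface_vertex n j : @coface R n j \o @vertex n = @vertex n.+1 \o lift j.
Proof. by apply/funext => i /=; rewrite coface_affrow affrow_vertex. Qed.

Lemma carried_aff m n (P : set X) (s : singular R n X) (v : 'I_m.+1 -> 'Delta n) :
  carried P s -> carried P (aff s v).
Proof. by move=> Ps x; exact: Ps. Qed.

Lemma carried_face n (P : set X) (s : singular R n.+1 X) j :
  carried P s -> carried P (face j s).
Proof. by move=> Ps x; exact: Ps. Qed.

End Aff.
End AffineSimplices.

(** * Barycentric subdivision of cochains *)

Section RealizedHomotopy.
Variables (R : realType) (X Y : topologicalType) (A : comPzRingType).
Variable E : nat -> Type.
Variables (Phi1 Phi0 : forall n m,
  (('I_m.+1 -> E n) -> A) -> ('I_m.+1 -> E n) -> A).
Variable b : forall n m, ('I_m.+1 -> E n) -> E n.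
Variables (vtx : forall n, 'I_n.+1 -> E n).
Variables (cof : forall n, 'I_n.+2 -> E n -> E n.+1).
Variable rho : forall n, singular R n X ->
  forall m, ('I_m.+1 -> E n) -> singular R m Y.
Hypotheses (Phi1P : forall n, chain_map (@Phi1 n)) (Phi0P : forall n, chain_map (@Phi0 n)).
Hypothesis face_rho : forall n (s : singular R n X) m (v : 'I_m.+2 -> E n) j,
  face j (rho s v) = rho s (v \o lift j).
Hypothesis rho_face : forall n (s : singular R n.+1 X) m (v : 'I_m.+1 -> E n) j,
  rho (face j s) v = rho s (cof j \o v).
Hypothesis cof_vtx : forall n j, @cof n j \o @vtx n = @vtx n.+1 \o lift j.
Hypothesis cof_natural : forall n j m phi (v : 'I_m.+1 -> E n),
  conehom (@Phi1 n) (@Phi0 n) (@b n) (fun u => phi (@cof n j \o u)) v =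
  conehom (@Phi1 n.+1) (@Phi0 n.+1) (@b n.+1) phi (@cof n j \o v).

Lemma cobound_rho (f : cochain R Y A) n (s : singular R n X) m
    (v : 'I_m.+2 -> E n) :
  cobound f (rho s v) = bdf (fun u => f m (rho s u)) v.
Proof. by apply: eq_bigr => j _; rewrite face_rho. Qed.

(** A singular simplex is studied through the formal simplex of its vertices, and naturality under
    cofaces turns the formal homotopy into one of singular cochains. Only the homotopy term of
    [cobound f] at [s] has to vanish, which covers relative cocycles. Subdivisions and prisms are
    both instances. *)
Lemma realized_homotopy (f : cochain R Y A) n (s : singular R n X) :
  conehom (@Phi1 n) (@Phi0 n) (@b n)
    (fun v : 'I_n.+2 -> E n => cobound f (rho s v)) (@vtx n) = 0 ->
  @Phi1 n n (fun v => f n (rho s v)) (@vtx n) -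
    @Phi0 n n (fun v => f n (rho s v)) (@vtx n) =
  cobound (fun n (s : singular R n X) => conehom (@Phi1 n) (@Phi0 n) (@b n)
    (fun v : 'I_n.+2 -> E n => f n.+1 (rho s v)) (@vtx n)) s.
Proof.
case: n s => [|n] s; set phi := (X in conehom _ _ _ X) => z.
  rewrite [RHS]/= -[RHS]z.
  have -> : phi = bdf (fun u => f 0%N (rho s u)).
    by apply/funext => v; exact: cobound_rho.
  by rewrite conehom0P.
have e : phi = bdf (fun u => f n.+1 (rho s u)).
  by apply/funext => v; exact: cobound_rho.
move: z; rewrite e conehomP // => /eqP; rewrite subr_eq0 => /eqP ->.
apply: eq_bigr => j _; rewrite -cof_vtx -cof_natural.
by congr (_ * conehom _ _ _ _ _); apply/funext => u; rewrite rho_face.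
Qed.

End RealizedHomotopy.

Section SubdivisionOperators.
Variables (R : realType) (X : topologicalType) (A : comPzRingType).
Notation "'Delta n" := (set_type (@std_simplex R n)) (at level 8, n at level 2).

Lemma center_subproof m : std_simplex (const_mx m.+1%:R^-1 : 'rV[R]_m.+1).
Proof.
split=> [j|]; first by rewrite mxE invr_ge0 ler0n.
under eq_bigr do rewrite mxE.
by rewrite sumr_const card_ord -[LHS]mulr_natr mulVf // pnatr_eq0.
Qed.

Definition simplex_center m : 'Delta m :=
  exist _ (const_mx m.+1%:R^-1) (mem_set (center_subproof m)).

Definition bary n m (v : 'I_m.+1 -> 'Delta n) : 'Delta n := affrow v (simplex_center m).

Lemma affrow_bary k n m (w : 'I_n.+1 -> 'Delta k) (v : 'I_m.+1 -> 'Delta n) :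
  affrow w (bary v) = bary (affrow w \o v).
Proof. exact: affrow_comp. Qed.

Lemma coface_bary n m j (v : 'I_m.+1 -> 'Delta n) :
  coface j (bary v) = bary (coface j \o v).
Proof.
rewrite coface_affrow affrow_bary; congr bary; apply/funext => i /=.
by rewrite coface_affrow.
Qed.

Definition Sd (f : cochain R X A) : cochain R X A := fun n s =>
  sub (@bary n) (fun v => f n (aff s v)) (@vertex R n).

Let idm n m : (('I_m.+1 -> 'Delta n) -> A) -> ('I_m.+1 -> 'Delta n) -> A :=
  fun phi v => phi v.

Definition Td (f : cochain R X A) : cochain R X A := fun n s =>
  conehom (@idm n) (@sub A _ (@bary n)) (@bary n)
    (fun v : 'I_n.+2 -> 'Delta n => f n.+1 (aff s v)) (@vertex R n).

Lemma idm_chain_map n : chain_map (@idm n).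
Proof. by split. Qed.

(** The term [Td (cobound f)] of the full homotopy formula vanishes, because [Td] evaluates only on
    simplices [aff s v], which [P] carries together with [s]. *)
Lemma Sd_homotopy (P : set X) (f : cochain R X A) n (s : singular R n X) :
  (forall n (s : singular R n X), carried P s -> cobound f s = 0) ->
  carried P s -> f n s - Sd f s = cobound (Td f) s.
Proof.
move=> fP Ps; rewrite -{1}(aff_id s).
apply: (@realized_homotopy R X X A (fun n => 'Delta n) (@idm)
  (fun n => @sub A _ (@bary n)) (@bary) (@vertex R) (@coface R)
  (fun n s m v => aff s v)).
- exact: idm_chain_map.
- by move=> m; exact: sub_chain_map.
- by move=> *; exact: face_aff.
- by move=> *; exact: aff_face.
- exact: coface_vertex.
- move=> k j m phi v; apply: conehom_natural => // [m' u|m' psi u].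
    exact: coface_bary.
  by apply: sub_natural => m'' u'; exact: coface_bary.
- apply: conehom_eq0 => [||u]; [exact: idm_chain_map|exact: sub_chain_map|].
  by apply: (fP n.+1 (aff s u)); exact: carried_aff.
Qed.

Lemma Sd_aff (f : cochain R X A) m n (s : singular R n X) (v : 'I_m.+1 -> 'Delta n) :
  Sd f (aff s v) = sub (@bary n) (fun u => f m (aff s u)) v.
Proof.
rewrite /Sd; under [X in sub _ X]eq_fun do rewrite aff_aff.
rewrite (sub_natural (L := affrow v) (b' := @bary n) _ (fun u => f m (aff s u))).
  by congr sub; apply/funext => i /=; rewrite affrow_vertex.
by move=> *; exact: affrow_bary.
Qed.

(** Moves all iterates into one fixed ['Delta n], where the mesh can be measured. *)
Lemma iter_Sd_aff i (f : cochain R X A) m n (s : singular R n X)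
    (v : 'I_m.+1 -> 'Delta n) :
  iter i Sd f m (aff s v) =
  iter i (@sub A _ (@bary n) m) (fun u => f m (aff s u)) v.
Proof.
elim: i v => [//|i IH] v; rewrite [LHS]/= Sd_aff /=.
by congr sub; apply/funext => u; rewrite IH.
Qed.

Lemma Sd_eq0 (P : set X) (f : cochain R X A) :
  (forall n (s : singular R n X), carried P s -> f n s = 0) ->
  forall n (s : singular R n X), carried P s -> Sd f s = 0.
Proof.
move=> fP n s Ps; apply: (chain_map_eq0 (sub_chain_map A (@bary n))) => u.
by apply: fP; exact: carried_aff.
Qed.

Lemma Td_eq0 (P : set X) (f : cochain R X A) :
  (forall n (s : singular R n X), carried P s -> f n s = 0) ->
  forall n (s : singular R n X), carried P s -> Td f s = 0.
Proof.
move=> fP n s Ps.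
apply: conehom_eq0 => [||u]; [exact: idm_chain_map|exact: sub_chain_map|].
by apply: fP; exact: carried_aff.
Qed.

End SubdivisionOperators.

(** * Mesh of the subdivision *)

Section Mesh.
Variables (R : realType) (A : comPzRingType).
Notation "'Delta n" := (set_type (@std_simplex R n)) (at level 8, n at level 2).

Definition mesh n m (d : R) (v : 'I_m.+1 -> 'Delta n) :=
  forall i j k, `|val (v i) 0 k - val (v j) 0 k| <= d.

Lemma mesh1 n m (v : 'I_m.+1 -> 'Delta n) : mesh 1 v.
Proof.
have le01 i k : 0 <= val (v i) 0 k <= 1.
  have [ge0 sum1] := set_valP (v i); rewrite ge0 -sum1 (bigD1 k) //= lerDl.
  by rewrite sumr_ge0.
by move=> i j k; have := le01 i k; have := le01 j k; rewrite ler_norml; lra.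
Qed.

Lemma affrow_near n m (d : R) (v : 'I_m.+1 -> 'Delta n) (p : 'Delta n) x k :
  (forall i, `|val p 0 k - val (v i) 0 k| <= d) ->
  `|val p 0 k - val (affrow v x) 0 k| <= d.
Proof.
move=> vd; have [x_ge0 x_sum] := set_valP x.
rewrite affrowE -[val p 0 k]mul1r -x_sum mulr_suml -sumrB.
apply: le_trans (ler_norm_sum _ _ _) _; rewrite -[d]mul1r -x_sum mulr_suml.
by apply: ler_sum => i _; rewrite -mulrBr normrM ger0_norm // ler_wpM2l.
Qed.

Lemma bary_near n m (d : R) (v : 'I_m.+1 -> 'Delta n) l k :
  0 <= d -> mesh d v -> `|val (bary v) 0 k - val (v l) 0 k| <= m%:R / m.+1%:R * d.
Proof.
move=> d0 vd; rewrite affrowE /=; under eq_bigr do rewrite mxE.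
rewrite -mulr_sumr.
have -> : m.+1%:R^-1 * (\sum_i \val (v i) 0 k) - \val (v l) 0 k =
    m.+1%:R^-1 * \sum_i (\val (v i) 0 k - \val (v l) 0 k).
  rewrite sumrB sumr_const card_ord mulrBr -[X in _ - _ * X]mulr_natl mulrA.
  by rewrite mulVf ?mul1r // pnatr_eq0.
rewrite (bigD1 l) //= subrr add0r normrM ger0_norm ?invr_ge0 //.
rewrite -mulrA mulrCA ler_wpM2l ?invr_ge0 //.
apply: le_trans (ler_norm_sum _ _ _) _.
have -> : m%:R * d = \sum_(i < m.+1 | i != l) d.
  by rewrite sumr_const cardC1 card_ord mulr_natl.
by apply: ler_sum => i _; exact: vd.
Qed.

(** The hull clause is what the induction needs: pieces of a face lie in the hull of [v], hence
    close to the barycentre of [v]. The factor m / (m + 1) increases with m, so the bound obtained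
    for the faces is good enough for the cone. *)
Lemma sub_mesh n m (phi psi : ('I_m.+1 -> 'Delta n) -> A) (v : 'I_m.+1 -> 'Delta n) d :
  0 <= d -> mesh d v ->
  (forall u : 'I_m.+1 -> 'Delta n, mesh (m%:R / m.+1%:R * d) u ->
     (exists x, u = affrow v \o x) -> phi u = psi u) ->
  sub (@bary R n) phi v = sub (@bary R n) psi v.
Proof.
move=> d0; elim: m => [|m IH] in phi psi v *.
  move=> vd /= e; apply: e => [i j k|].
    by rewrite !ord1 subrr normr0 !mul0r.
  by exists (@vertex R 0); apply/funext => i /=; rewrite affrow_vertex.
move=> vd e /=; apply: eq_bdf => j; apply: IH => [i i' k|u um [x ux]].
  exact: vd.
have le_mesh : m%:R / m.+1%:R * d <= m.+1%:R / m.+2%:R * d.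
  rewrite ler_wpM2r // ler_pdivrMr ?ltr0n // mulrAC ler_pdivlMr ?ltr0n //.
  by rewrite -!natrM ler_nat; lia.
have near_u i k : `|val (bary v) 0 k - val (u i) 0 k| <= m.+1%:R / m.+2%:R * d.
  have -> : u i = affrow v (coface j (x i)) by rewrite affrow_coface ux.
  by apply: affrow_near => l; exact: bary_near.
apply: e => [i i' k|].
  case: (unliftP ord0 i) => [i1|] ->; case: (unliftP ord0 i') => [i2|] ->.
  - by rewrite !coneS; apply: le_trans (um _ _ _) le_mesh.
  - by rewrite coneS cone0 distrC.
  - by rewrite coneS cone0.
  - by rewrite subrr normr0 mulr_ge0 // divr_ge0.
exists (cone (simplex_center R m.+1) (@coface R m j \o x)).
by rewrite comp_cone ux; congr cone; apply/funext => i /=; rewrite affrow_coface.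
Qed.

Lemma iter_sub_mesh n m i (phi : ('I_m.+1 -> 'Delta n) -> A) d e :
  0 <= d -> (forall u, mesh e u -> phi u = 0) ->
  (m%:R / m.+1%:R) ^+ i * d <= e ->
  forall v : 'I_m.+1 -> 'Delta n, mesh d v -> iter i (@sub A _ (@bary R n) m) phi v = 0.
Proof.
move=> + phi0; elim: i => [|i IH] in d *.
  move=> d0; rewrite expr0 mul1r => de v vd; apply: phi0 => a b k.
  exact: le_trans (vd _ _ _) de.
move=> d0 le_e v vd.
rewrite /= (sub_mesh (psi := fun=> 0) d0 vd) => [|u um _].
  exact: (chain_map_eq0 (sub_chain_map A (@bary R n))).
apply: (IH (m%:R / m.+1%:R * d)) um; first by rewrite !mulr_ge0 ?invr_ge0.
by rewrite mulrA -exprSr.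
Qed.

End Mesh.

(** * Lebesgue numbers for covers by two open sets *)

Section SmallSimplices.
Variables (R : realType) (X : topologicalType) (A : comPzRingType).
Notation "'Delta n" := (set_type (@std_simplex R n)) (at level 8, n at level 2).
Variables U V : set X.
Hypotheses (Uo : open U) (Vo : open V).

Lemma compact_std_simplex n : compact (@std_simplex R n).
Proof.
have cube := @rV_compact R n.+1 (fun=> `[0, 1]%classic)
  (fun=> @segment_compact R 0 1).
apply: subclosed_compact cube _ => [|v [ge0 sum1] i]; last first.
  rewrite /= in_itv /= ge0 -sum1 (bigD1 i) //= lerDl.
  by rewrite sumr_ge0.
have -> : @std_simplex R n = (\bigcap_(j in setT) [set x | 0 <= x 0 j])
    `&` [set x | \sum_j x 0 j = 1].
  by apply/seteqP; split=> x [ge0 sum1]; split=> // j; [move=> _|]; exact: ge0.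
apply: closedI; first apply: closed_bigI => j _.
  apply: (@preimage_closed _ _ (fun x : 'rV[R]_n.+1 => x 0 j)) (@closed_ge _ 0).
  by move=> x _; exact: coord_continuous.
apply: (@preimage_closed _ _ (fun x : 'rV[R]_n.+1 => \sum_j x 0 j)) (@closed_eq _ 1).
by move=> x _; apply: sum_continuous_at => j _; exact: coord_continuous.
Qed.

(** Continuity gives at each point a radius that is valid for nearby points as well; compactness, in
    the form of near coverings, makes it uniform. A simplex of small mesh is then close to its first
    vertex. *)
Lemma lebesgue_number n (s : singular R n X) : carried (U `|` V) s ->
  exists2 e : R, 0 < e & forall m (v : 'I_m.+1 -> 'Delta n), mesh e v ->
    carried U (aff s v) \/ carried V (aff s v).
Proof.
move=> UVs.
pose Q (W : set X) (e : R) (x : 'rV[R]_n.+1) :=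
  forall y : 'Delta n, (forall k, `|x 0 k - val y 0 k| <= e) -> W (s y).
pose P (e : R) (x : 'rV[R]_n.+1) := Q U e x \/ Q V e x.
have : \forall e \near (0 : R)^'+, @std_simplex R n `<=` P e.
  have /compact_near_coveringP := @compact_std_simplex n; apply => x Kx.
  have key (W : set X) : open W -> W (s (exist _ x (mem_set Kx))) ->
      exists2 r : R, 0 < r & forall y : 'Delta n,
        (forall k, `|x 0 k - val y 0 k| < r) -> W (s y).
    move=> Wo Ws.
    have : nbhs (exist _ x (mem_set Kx) : 'Delta n) (s @^-1` W).
      by apply: singular_continuous; exact: open_nbhs_nbhs.
    move=> [_ [[B Bo <-] Bx BW]].
    have /nbhs_ballP[r r0 rB] : nbhs x B by exact: open_nbhs_nbhs.
    exists r => // y yr; apply: BW => /=; apply: rB; split=> // i j.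
    by rewrite [i]ord1; exact: yr.
  have key2 (W : set X) (r : R) : 0 < r -> (forall y : 'Delta n,
        (forall k, `|x 0 k - val y 0 k| < r) -> W (s y)) ->
      \forall x' \near x & e \near (0 : R)^'+, Q W e x'.
    move=> r0 rW; near=> x' e => y yx'; apply: rW => k.
    have xx' : `|x 0 k - x' 0 k| < r / 2.
      have [_] : ball x (r / 2) x' by near: x'; exact/nbhsx_ballx/divr_gt0.
      exact.
    have er : e < r / 2 by near: e; exact/nbhs_right_lt/divr_gt0.
    have := yx' k; rewrite (_ : x 0 k - _ = x 0 k - x' 0 k + (x' 0 k - val y 0 k)); last by ring.
    by move=> yxk; apply: le_lt_trans (ler_normD _ _) _;
      rewrite (splitr r) ltrD //; exact: le_lt_trans yxk er.
  case: (UVs (exist _ x (mem_set Kx))) => /key[//|r r0 /(key2 _ _ r0)];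
    apply: filterS => -[x' e] /= h; [by left|by right].
move=> nearP; near (0 : R)^'+ => e.
have eP : @std_simplex R n `<=` P e by near: e.
have e0 : 0 < e by near: e; exact: nbhs_right_gt.
exists e => // m v vm.
have hull x k : `|val (v ord0) 0 k - val (affrow v x) 0 k| <= e.
  by apply: affrow_near => i; exact: vm.
have [h|h] := eP _ (set_valP (v ord0)); [left|right] => x; exact/h/hull.
Unshelve. all: end_near. Qed.

End SmallSimplices.

(** * Relative cochains and excision *)

Section Cochains.
Variables (R : realType) (X : topologicalType) (A : comPzRingType).
Implicit Types (f g h : cochain R X A) (P Q : set X).

Lemma eq_cobound P f g : (forall n (s : singular R n X), carried P s -> f n s = g n s) ->
  forall n (s : singular R n X), carried P s -> cobound f s = cobound g s.
Proof.
move=> e [//|n] s Ps; apply: eq_bigr => j _.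
by rewrite e //; exact: carried_face.
Qed.

Lemma coboundB f g n (s : singular R n X) :
  cobound (fun n s => f n s - g n s) s = cobound f s - cobound g s.
Proof.
case: n s => [|n] s /=; first by rewrite subr0.
by rewrite -sumrB; apply: eq_bigr => j _; rewrite mulrBr.
Qed.

Lemma coboundD f g n (s : singular R n X) :
  cobound (fun n s => f n s + g n s) s = cobound f s + cobound g s.
Proof.
case: n s => [|n] s /=; first by rewrite addr0.
by rewrite -big_split; apply: eq_bigr => j _; rewrite mulrDr.
Qed.

Lemma coboundZ a f n (s : singular R n X) :
  cobound (fun n s => a * f n s) s = a * cobound f s.
Proof.
case: n s => [|n] s /=; first by rewrite mulr0.
by rewrite mulr_sumr; apply: eq_bigr => j _; rewrite mulrCA.
Qed.

Lemma cobound0 n (s : singular R n X) : cobound (fun n s => 0 : A) s = 0.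
Proof. by case: n s => [//|n] s; apply: big1 => j _; rewrite mulr0. Qed.

Lemma cobound_sum (I : Type) (r : seq I) (p : pred I) (F : I -> cochain R X A)
    n (s : singular R n X) :
  cobound (fun n s => \sum_(i <- r | p i) F i n s) s =
  \sum_(i <- r | p i) cobound (F i) s.
Proof.
case: n s => [|n] s /=; first by rewrite big1.
rewrite exchange_big /=; apply: eq_bigr => j _.
by rewrite mulr_sumr.
Qed.

Lemma cobound_cobound f n (s : singular R n X) : cobound (cobound f) s = 0.
Proof.
have cobE g m (t : singular R m.+1 X) (k : nat) (v : 'I_k.+2 -> _) :
    cobound g (aff t v) = bdf (fun u => g k (aff t u)) v.
  by apply: eq_bigr => j _; rewrite face_aff.
case: n s => [//|[|n]] s; first by apply: big1 => j _; rewrite mulr0.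
rewrite -(aff_id s) cobE -[RHS](bdf_bdf (fun u => f n (aff s u)) (@vertex R n.+2)).
by congr bdf; apply/funext => u; rewrite cobE.
Qed.

Definition zext P f : cochain R X A :=
  fun n s => if `[< carried P s >] then f n s else 0.

Lemma zextE P f n (s : singular R n X) : carried P s -> zext P f s = f n s.
Proof. by rewrite /zext => /asboolP ->. Qed.

Lemma zext_eq0 P f n (s : singular R n X) :
  (carried P s -> f n s = 0) -> zext P f s = 0.
Proof. by rewrite /zext; case: asboolP => // Ps ->. Qed.

Lemma cobound_zext P f n (s : singular R n X) : carried P s ->
  cobound (zext P f) s = cobound f s.
Proof. by apply: eq_cobound => m t; exact: zextE. Qed.

Definition hcomp i f : cochain R X A := fun n s => if n == i then f n s else 0.

Lemma cobound_hcomp i f n (s : singular R n X) :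
  cobound (hcomp i f) s = hcomp i.+1 (cobound f) s.
Proof.
case: n s => [|n] s; first by [].
rewrite /hcomp /= eqSS; case: (n == i) => //.
by apply: big1 => j _; rewrite mulr0.
Qed.

Lemma homogeneous_hcomp i f : homogeneous i (hcomp i f).
Proof. by move=> n s ni; rewrite /hcomp (negPf ni). Qed.

Lemma hcomp_id i f n (s : singular R n X) : homogeneous i f -> hcomp i f s = f n s.
Proof. by move=> fi; rewrite /hcomp; case: eqP => // /eqP ni; rewrite fi. Qed.

Lemma homogeneous_cobound i f : homogeneous i f -> homogeneous i.+1 (cobound f).
Proof.
move=> fi [//|n] s; rewrite eqSS => ni /=.
by apply: big1 => j _; rewrite fi // mulr0.
Qed.

Lemma rel_cocycleS P Q P' Q' f : P' `<=` P -> Q' `<=` Q ->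
  rel_cocycle P Q f -> rel_cocycle P' Q' f.
Proof. by move=> sP sQ [fQ fP]; split=> n s s_in; [apply: fQ => x; exact/sQ|apply: fP => x; exact/sP]. Qed.

Lemma rel_coboundaryS P Q P' Q' f : P' `<=` P -> Q' `<=` Q ->
  rel_coboundary P Q f -> rel_coboundary P' Q' f.
Proof.
move=> sP sQ [g [gQ gP]]; exists g; split=> n s s_in.
  by apply: gQ => x; exact/sQ.
by apply: gP => x; exact/sP.
Qed.

Lemma eq_rel_coboundary P Q f g :
  (forall n (s : singular R n X), carried P s -> f n s = g n s) ->
  rel_coboundary P Q f -> rel_coboundary P Q g.
Proof. by move=> e [h [hQ hP]]; exists h; split=> // n s Ps; rewrite -e // hP. Qed.

Lemma rel_coboundary0 P Q f :
  (forall n (s : singular R n X), carried P s -> f n s = 0) ->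
  rel_coboundary P Q f.
Proof. by move=> f0; exists (fun n s => 0); split=> // n s /f0 ->; rewrite cobound0. Qed.

Lemma rel_coboundaryD P Q f g : rel_coboundary P Q f -> rel_coboundary P Q g ->
  rel_coboundary P Q (fun n s => f n s + g n s).
Proof.
move=> [f' [f0 fE]] [g' [g0 gE]]; exists (fun n s => f' n s + g' n s).
by split=> n s sP; rewrite ?coboundD ?f0 ?g0 ?addr0 ?fE ?gE.
Qed.

Lemma rel_coboundaryZ P Q a f : rel_coboundary P Q f ->
  rel_coboundary P Q (fun n s => a * f n s).
Proof.
move=> [f' [f0 fE]]; exists (fun n s => a * f' n s).
by split=> n s sP; rewrite ?coboundZ ?f0 ?mulr0 ?fE.
Qed.

Lemma rel_coboundaryB P Q f g : rel_coboundary P Q f -> rel_coboundary P Q g ->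
  rel_coboundary P Q (fun n s => f n s - g n s).
Proof.
move=> fb /(rel_coboundaryZ (-1)) /(rel_coboundaryD fb).
by apply: eq_rel_coboundary => n s _; rewrite mulN1r.
Qed.

Lemma rel_cocycleB P Q f g : rel_cocycle P Q f -> rel_cocycle P Q g ->
  rel_cocycle P Q (fun n s => f n s - g n s).
Proof.
move=> [f0 fE] [g0 gE].
by split=> n s sP; rewrite ?coboundB ?f0 ?g0 ?fE ?gE ?subr0.
Qed.

Lemma rel_cocycleZ P Q a f : rel_cocycle P Q f ->
  rel_cocycle P Q (fun n s => a * f n s).
Proof. by move=> [f0 fE]; split=> n s sP; rewrite ?coboundZ ?f0 ?fE ?mulr0. Qed.

Lemma rel_coboundary_cobound P Q f :
  (forall n (s : singular R n X), carried Q s -> f n s = 0) ->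
  rel_coboundary P Q (cobound f).
Proof. by move=> fQ; exists f; split. Qed.

End Cochains.

Section Excision.
Variables (R : realType) (X : topologicalType) (A : comPzRingType).
Implicit Types (f g h : cochain R X A).
Notation "'Delta n" := (set_type (@std_simplex R n)) (at level 8, n at level 2).
Variables U V : set X.
Hypotheses (Uo : open U) (Vo : open V).

Section Small.
Variable f : cochain R X A.
Hypotheses (fUV : forall n (s : singular R n X), carried (U `|` V) s -> cobound f s = 0)
  (fU : forall n (s : singular R n X), carried U s -> f s = 0)
  (fV : forall n (s : singular R n X), carried V s -> f s = 0).

Lemma iter_Sd_small n (s : singular R n X) : carried (U `|` V) s ->
  forall m, exists N, forall i, (N <= i)%N ->
    forall v : 'I_m.+1 -> 'Delta n, iter i (@Sd R X A) f m (aff s v) = 0.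
Proof.
move=> UVs m; have [e e0 small] := lebesgue_number Uo Vo UVs.
have : (fun i => (m%:R / m.+1%:R) ^+ i : R) @ \oo --> 0.
  apply: cvg_expr; rewrite ger0_norm ?divr_ge0 //.
  by rewrite ltr_pdivrMr ?ltr0n // mul1r ltr_nat.
move=> /cvgr0_norm_le /(_ _ e0) [N _ Ne].
exists N => i Ni v; rewrite iter_Sd_aff.
apply: (@iter_sub_mesh _ _ _ _ _ _ 1 e) => // [u /small [Us|Vs]||].
- exact: fU.
- exact: fV.
- by rewrite mulr1; apply: le_trans (ler_norm _) _; exact: Ne.
- exact: mesh1.
Qed.

Lemma iter_Sd_cocycle i n (s : singular R n X) :
  carried (U `|` V) s -> cobound (iter i (@Sd R X A) f) s = 0.
Proof.
elim: i n s => [|i IH] n s UVs /=; first exact: fUV.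
set g := iter i _ f in IH *.
have e m (t : singular R m X) : carried (U `|` V) t ->
    Sd g t = g m t - cobound (Td g) t.
  by move=> UVt; rewrite -(Sd_homotopy IH UVt) subKr.
by rewrite (eq_cobound e UVs) coboundB IH // cobound_cobound subr0.
Qed.

Lemma small_telescope i n (s : singular R n X) : carried (U `|` V) s ->
  f s - iter i (@Sd R X A) f n s =
  \sum_(0 <= k < i) cobound (Td (iter k (@Sd R X A) f)) s.
Proof.
move=> UVs; elim: i => [|i IH]; first by rewrite big_geq // subrr.
rewrite big_nat_recr //= -IH -(Sd_homotopy (iter_Sd_cocycle i) UVs).
by rewrite addrA subrK.
Qed.

(** Telescoping: [f] minus an iterated subdivision is the coboundary of a partial sum of the [Td] of
    the earlier iterates. On a fixed simplex all far terms vanish, since small pieces lie in [U] or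
    in [V]; the number of terms depends on the simplex, which is harmless because cochains are
    arbitrary functions. *)
Lemma small_simplices : exists g : cochain R X A,
  [/\ forall n (s : singular R n X), carried U s -> g n s = 0,
      forall n (s : singular R n X), carried V s -> g n s = 0
    & forall n (s : singular R n X), carried (U `|` V) s -> f s = cobound g s].
Proof.
pose F i := iter i (@Sd R X A) f.
have FU W : (forall n (s : singular R n X), carried W s -> f s = 0) ->
    forall i n (s : singular R n X), carried W s -> Td (F i) s = 0.
  move=> fW i; apply: Td_eq0; elim: i => [//|i IH] /=; exact: Sd_eq0.
have bound n (s : singular R n X) : exists N, carried (U `|` V) s ->
    forall i, (N <= i)%N -> Td (F i) s = 0.
  have [UVs|nUVs] := pselect (carried (U `|` V) s); last by exists 0%N.
  have [N FN] := iter_Sd_small UVs n.+1; exists N => _ i Ni.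
  apply: conehom_eq0 => [||u]; [exact: idm_chain_map|exact: sub_chain_map|].
  exact: FN.
have [N NE] : exists N : forall n, singular R n X -> nat,
    forall n (s : singular R n X), carried (U `|` V) s ->
    forall i, (N n s <= i)%N -> Td (F i) s = 0.
  exists (fun n s => sval (cid (bound n s))) => n s.
  exact: svalP (cid (bound n s)).
pose g : cochain R X A := fun n s => \sum_(0 <= k < N n s) Td (F k) s.
have gE M n (s : singular R n X) : carried (U `|` V) s -> (N n s <= M)%N ->
    g n s = \sum_(0 <= k < M) Td (F k) s.
  move=> UVs NM; rewrite (big_cat_nat _ NM) //= [X in _ + X]big_nat [X in _ + X]big1 ?addr0 //.
  by move=> i /andP[Ni _]; exact: NE.
exists g; split=> [n s Us|n s Vs|n s UVs].
- by apply: big1 => i _; exact: FU Us.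
- by apply: big1 => i _; exact: FU Vs.
have [N0 FN0] := iter_Sd_small UVs n.
case: n s UVs FN0 => [|n] s UVs FN0.
  have := small_telescope N0 UVs.
  rewrite big1 // => /eqP; rewrite subr_eq0 => /eqP ->.
  by rewrite -(aff_id s); exact: FN0.
(* A common number of terms for [s] and all its faces. *)
pose M := (N0 + \sum_(j < n.+2) N n (face j s))%N.
have := small_telescope M UVs.
have -> : iter M (@Sd R X A) f n.+1 s = 0.
  by rewrite -(aff_id s) FN0 // leq_addr.
rewrite subr0 => ->; rewrite exchange_big /=; apply: eq_bigr => j _.
rewrite -mulr_sumr (gE M) //; first exact: carried_face.
by rewrite /M (bigD1 j) //= addnCA leq_addr.
Qed.

End Small.

(** The extension by zero has a coboundary that vanishes on the simplices of [U] and of [V]. By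
    [small_simplices] this coboundary is also that of a cochain vanishing there, which is the
    correction to subtract. *)
Lemma excision_extend f : rel_cocycle U (U `&` V) f ->
  exists f' : cochain R X A, rel_cocycle (U `|` V) V f' /\
    forall n (s : singular R n X), carried U s -> f' n s = f n s.
Proof.
move=> [fUV fU].
pose F : cochain R X A := zext U f.
have FU n (s : singular R n X) : carried U s -> F n s = f n s by exact: zextE.
have FV n (s : singular R n X) : carried V s -> F n s = 0.
  by move=> Vs; apply: zext_eq0 => Us; apply: fUV => x; split.
have [|||g [gU gV gE]] := @small_simplices (cobound F).
- by move=> n s _; exact: cobound_cobound.
- by move=> n s Us; rewrite cobound_zext // fU.
- by move=> n s Vs; rewrite (eq_cobound FV Vs) cobound0.
exists (fun n s => F n s - g n s); split; last first.
  by move=> n s Us; rewrite gU // subr0 FU.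
split=> n s sP; first by rewrite FV // gV // subr0.
by rewrite coboundB gE // subrr.
Qed.

Lemma excision_coboundary f : rel_cocycle (U `|` V) V f ->
  rel_coboundary U (U `&` V) f -> rel_coboundary (U `|` V) V f.
Proof.
move=> [fV fUV] [h [hUV hU]].
pose H : cochain R X A := zext U h.
have HV n (s : singular R n X) : carried V s -> H n s = 0.
  by move=> Vs; apply: zext_eq0 => Us; apply: hUV => x; split.
have [|||g [gU gV gE]] := @small_simplices (fun n s => f n s - cobound H s).
- by move=> n s UVs; rewrite coboundB fUV // cobound_cobound subr0.
- by move=> n s Us; rewrite cobound_zext // hU // subrr.
- by move=> n s Vs; rewrite fV // (eq_cobound HV Vs) cobound0 subrr.
exists (fun n s => H n s + g n s); split=> n s sP; first by rewrite HV // gV // addr0.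
by rewrite coboundD -gE // addrC subrK.
Qed.

End Excision.

Section TwoPieces.
Variables (R : realType) (X : topologicalType) (A : comPzRingType).
Variables U V Q : set X.
Hypotheses (Uo : open U) (Vo : open V) (Qo : open Q) (UV0 : U `&` V `<=` Q).

(** A primitive is first found on the union of [V] and [Q]. After subtracting its coboundary,
    excision applies to [U] and this union, because [U] and [V] meet only inside [Q]. *)
Lemma two_pieces_coboundary (f : cochain R X A) :
  rel_cocycle (U `|` V `|` Q) Q f ->
  rel_coboundary U (U `&` Q) f -> rel_coboundary V (V `&` Q) f ->
  rel_coboundary (U `|` V `|` Q) Q f.
Proof.
move=> fc fU fV.
have fc' : rel_cocycle (V `|` Q) Q f.
  by apply: rel_cocycleS fc => // x [|]; [left; right|right].
have [h [hQ hE]] := excision_coboundary Vo Qo fc' fV.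
pose H : cochain R X A := zext (V `|` Q) h.
have HQ n (s : singular R n X) : carried Q s -> H n s = 0.
  by move=> Qs; apply: zext_eq0 => _; exact: hQ.
have HE n (s : singular R n X) : carried (V `|` Q) s -> f n s = cobound H s.
  by move=> VQs; rewrite cobound_zext // hE.
have UVQ : U `&` (V `|` Q) `<=` Q by move=> x [Ux [Vx|//]]; exact: UV0.
have [[fQ fP] [k [kQ kE]]] := (fc, fU).
have c1 : rel_coboundary U (U `&` (V `|` Q)) (fun n s => f n s - cobound H s).
  exists (fun n s => k n s - H n s); split=> n s sP.
    have Qs : carried Q s by move=> x; exact/UVQ/sP.
    by rewrite HQ // kQ ?subr0 // => x; split; [have [] := sP x|exact: Qs].
  by rewrite coboundB kE.
have [|g [gQ gE]] := excision_coboundary Uo (openU Vo Qo) _ c1.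
  split=> n s sP; first by rewrite HE // subrr.
  by rewrite coboundB cobound_cobound subr0 fP // -setUA.
exists (fun n s => g n s + H n s); split=> n s sP.
  by rewrite HQ // addr0 gQ // => x; right; exact: sP.
by rewrite coboundD -gE ?subrK // setUA.
Qed.

End TwoPieces.

(** * Pullbacks and homotopy invariance *)

Section Pullback.
Variables (R : realType) (X Y : topologicalType).

Definition smap (r : X -> Y) (cr : continuous r) n (s : singular R n X) :
    singular R n Y :=
  Singular (fun x => continuous_comp (@singular_continuous _ _ _ s x) (cr (s x))).

Lemma face_smap (r : X -> Y) (cr : continuous r) n (s : singular R n.+1 X) j :
  face j (smap cr s) = smap cr (face j s).
Proof. exact: singular_eq. Qed.

Variable A : comPzRingType.

Definition pull (r : X -> Y) (cr : continuous r) (f : cochain R Y A) :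
  cochain R X A := fun n s => f n (smap cr s).

Lemma cobound_pull (r : X -> Y) (cr : continuous r) (f : cochain R Y A) n
    (s : singular R n X) :
  cobound (pull cr f) s = cobound f (smap cr s).
Proof.
by case: n s => [//|n] s; apply: eq_bigr => j _; rewrite face_smap.
Qed.

Lemma rel_cocycle_pull (r : X -> Y) (cr : continuous r) (P Q : set Y) (P' Q' : set X) f :
  P' `<=` r @^-1` P -> Q' `<=` r @^-1` Q ->
  rel_cocycle P Q f -> rel_cocycle P' Q' (pull cr f).
Proof.
move=> rP rQ [fQ fP]; split=> n s sP; rewrite ?cobound_pull.
  by apply: fQ => x; exact/rQ/sP.
by apply: fP => x; exact/rP/sP.
Qed.

Lemma rel_coboundary_pull (r : X -> Y) (cr : continuous r) (P Q : set Y) (P' Q' : set X) f :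
  P' `<=` r @^-1` P -> Q' `<=` r @^-1` Q ->
  rel_coboundary P Q f -> rel_coboundary P' Q' (pull cr f).
Proof.
move=> rP rQ [g [gQ gP]]; exists (pull cr g); split=> n s sP.
  by apply: gQ => x; exact/rQ/sP.
by rewrite cobound_pull -gP // => x; exact/rP/sP.
Qed.

End Pullback.

Section Homotopy.
Variables (R : realType) (X Y : topologicalType) (A : comPzRingType).
Notation "'Delta n" := (set_type (@std_simplex R n)) (at level 8, n at level 2).
Variable h : X -> R -> Y.
Hypothesis hc : continuous (fun p : X * R => h p.1 p.2).

Let E n : Type := ('Delta n * R)%type.

Lemma prism_continuous n (s : singular R n X) m (v : 'I_m.+1 -> E n) :
  continuous (fun x : 'Delta m =>
    h (s (affrow (fst \o v) x)) (\sum_i val x 0 i * (v i).2)).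
Proof.
move=> x.
have c1 : {for x, continuous (s \o affrow (fst \o v))}.
  apply: continuous_comp; first exact: affrow_continuous.
  exact: singular_continuous.
have c2 : {for x, continuous (fun x : 'Delta m => \sum_i val x 0 i * (v i).2)}.
  apply: sum_continuous_at => i _; apply: continuousM; last exact: cst_continuous.
  exact: simplex_coord_continuous.
have c3 : {for x, continuous (fun x : 'Delta m =>
    (s (affrow (fst \o v) x), \sum_i val x 0 i * (v i).2))}.
  exact: (cvg_pair c1 c2).
exact: (@continuous_comp _ _ _ _ (fun p : X * R => h p.1 p.2) x c3 (@hc _)).
Qed.

Definition prism n (s : singular R n X) m (v : 'I_m.+1 -> E n) : singular R m Y :=
  Singular (@prism_continuous n s m v).

Let level (t : R) n m (phi : ('I_m.+1 -> E n) -> A) (v : 'I_m.+1 -> E n) : A :=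
  phi (fun i => ((v i).1, t)).

(** Any apex in the prism that is natural under cofaces would do, the prism being convex. *)
Let base n m (v : 'I_m.+1 -> E n) : E n := ((v ord0).1, 0).

Let good n m (v : 'I_m.+1 -> E n) := forall i, 0 <= (v i).2 <= 1.

Let conehom_good n m (phi : ('I_m.+2 -> E n) -> A) v :
  (forall u, good u -> phi u = 0) ->
  conehom (@level 1 n) (@level 0 n) (@base n) phi v = 0.
Proof.
move=> phi0.
rewrite (@conehom_local A (E n) (E n) (@level 1 n) (@level 0 n) (@base n)
  (fun _ _ => True) (@good n) _ _ _ _ m phi (fun=> 0)) //.
- exact: conehom_eq0.
- by move=> k psi psi' u _; apply=> i /=; rewrite ler01 lexx.
- by move=> k psi psi' u _; apply=> i /=; rewrite ler01 lexx.
- move=> k l u w _ gw i; case: (unliftP ord0 i) => [i'|] ->; rewrite ?coneS ?cone0 //=.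
  by rewrite lexx ler01.
Qed.

Variables (P Q : set X) (P' Q' : set Y).
Hypotheses (hP : forall x t, P x -> 0 <= t <= 1 -> P' (h x t))
  (hQ : forall x t, Q x -> 0 <= t <= 1 -> Q' (h x t)).

Lemma carried_prism (S : set X) (S' : set Y) n (s : singular R n X) m (v : 'I_m.+1 -> E n) :
  (forall x t, S x -> 0 <= t <= 1 -> S' (h x t)) ->
  carried S s -> good v -> carried S' (prism s v).
Proof.
move=> hS Ss gv x; apply: hS => //.
have [x_ge0 x_sum] := set_valP x; apply/andP; split.
  by apply: sumr_ge0 => i _; rewrite mulr_ge0 //; have /andP[] := gv i.
rewrite -x_sum; apply: ler_sum => i _.
by rewrite -[X in _ <= X]mulr1 ler_wpM2l //; have /andP[] := gv i.
Qed.

Lemma homotopic_pull (r0 r1 : X -> Y) (c0 : continuous r0) (c1 : continuous r1)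
    (f : cochain R Y A) :
  h^~ 0 =1 r0 -> h^~ 1 =1 r1 -> rel_cocycle P' Q' f ->
  rel_coboundary P Q (fun n s => pull c1 f s - pull c0 f s :> A).
Proof.
move=> h0 h1 [fQ fP].
exists (fun n (s : singular R n X) =>
  conehom (@level 1 n) (@level 0 n) (@base n)
    (fun v : 'I_n.+2 -> E n => f n.+1 (prism s v)) (fun i => (@vertex R n i, 0))).
split=> n s sP.
  by apply: conehom_good => u gu; apply: fQ; exact: (carried_prism hQ sP gu).
have := @realized_homotopy R X Y A E (@level 1) (@level 0) (@base)
  (fun n i => (@vertex R n i, 0)) (fun n j p => (coface j p.1, p.2)) prism.
move=> <- //.
- have e t x : h (s (affrow (@vertex R n) x)) (\sum_i val x 0 i * t) = h (s x) t.
    have [_ sum1] := set_valP x; rewrite -mulr_suml sum1 mul1r.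
    by rewrite affrow_id.
  congr (_ - _); congr (f n _); apply: singular_eq => x.
    by rewrite -[LHS]h1 -[LHS]e.
  by rewrite -[LHS]h0 -[LHS]e.
- move=> n' s' m v j; apply: singular_eq => x /=.
  rewrite affrow_coface; congr (h _ _).
  rewrite (bigD1_ord j) //= mxE unlift_none mul0r add0r.
  by apply: eq_bigr => i _; rewrite mxE liftK.
- move=> n' s' m v j; apply: singular_eq => x /=; congr (h (s' _) _).
  rewrite coface_affrow affrow_comp; congr affrow; apply/funext => i /=.
  by rewrite coface_affrow.
- move=> n' j; apply/funext => i /=; congr (_, _).
  by rewrite coface_affrow affrow_vertex.
- by move=> n' j m phi v; exact: conehom_natural.
- by apply: conehom_good => u gu; apply: fP; exact: (carried_prism hP sP gu).
Qed.

End Homotopy.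

(** * Pairs whose cohomology is free on one class *)

Section Generators.
Variables (R : realType) (X : topologicalType).

(** No degree is fixed: the cohomology of the pair in all degrees together is free of rank one on
    the class of [w]. *)
Definition generates (A : comPzRingType) (P Q : set X) (w : cochain R X A) :=
  [/\ rel_cocycle P Q w,
      forall v, rel_cocycle P Q v ->
        exists a, rel_coboundary P Q (fun n s => v n s - a * w n s)
    & forall a, rel_coboundary P Q (fun n s => a * w n s) -> a = 0].

Lemma eq_generates (A : comPzRingType) (P Q : set X) (w w' : cochain R X A) :
  (forall n (s : singular R n X), carried Q s -> w' n s = 0) ->
  (forall n (s : singular R n X), carried P s -> w n s = w' n s) ->
  generates P Q w -> generates P Q w'.
Proof.
move=> w'Q e [[wQ wP] ex inj]; split.
- by split=> // n s Ps; rewrite -(eq_cobound e Ps) wP.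
- move=> v /ex [a va]; exists a; apply: eq_rel_coboundary va => n s Ps.
  by rewrite e.
- move=> a aw; apply: inj; apply: eq_rel_coboundary aw => n s Ps.
  by rewrite e.
Qed.

Lemma generates_excision (A : comPzRingType) (U V : set X) (w : cochain R X A) :
  open U -> open V -> rel_cocycle (U `|` V) V w -> generates U (U `&` V) w ->
  generates (U `|` V) V w.
Proof.
have sU : U `<=` U `|` V by move=> x; left.
have sV : U `&` V `<=` V by move=> x [].
move=> Uo Vo wc [_ ex inj]; split=> // [v vc|a aw].
  have [a va] := ex v (rel_cocycleS sU sV vc).
  exists a; apply: excision_coboundary => //.
  by apply: rel_cocycleB => //; exact: rel_cocycleZ.
exact/inj/(rel_coboundaryS sU sV aw).
Qed.

Lemma generates_retract (A : comPzRingType) (P Q P' Q' : set X) (w : cochain R X A)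
    (r : X -> X) (h : X -> R -> X) :
  continuous r -> continuous (fun p : X * R => h p.1 p.2) ->
  h^~ 0 =1 id -> h^~ 1 =1 r ->
  P' `<=` P -> Q' `<=` Q -> P `<=` r @^-1` P' -> Q `<=` r @^-1` Q' ->
  (forall x t, P x -> 0 <= t <= 1 -> P (h x t)) ->
  (forall x t, Q x -> 0 <= t <= 1 -> Q (h x t)) ->
  (forall x t, P' x -> 0 <= t <= 1 -> P' (h x t)) ->
  (forall x t, Q' x -> 0 <= t <= 1 -> Q' (h x t)) ->
  generates P Q w -> generates P' Q' w.
Proof.
move=> cr ch h0 h1 sP sQ rP rQ hP hQ hP' hQ' [wc ex inj].
have cid : continuous (@idfun X) by move=> x.
have pull_id f n (s : singular R n X) : pull cid f s = f n s :> A.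
  by congr (f n _); exact: singular_eq.
split; first exact: rel_cocycleS wc.
- move=> v vc; have [a va] := ex _ (rel_cocycle_pull cr rP rQ vc); exists a.
  have := homotopic_pull ch hP' hQ' cid cr h0 h1 vc.
  move=> /(rel_coboundaryB (rel_coboundaryS sP sQ va)).
  apply: eq_rel_coboundary => n s _; rewrite pull_id; ring.
- move=> a aw; apply: inj.
  have aw' := rel_coboundary_pull cr rP rQ aw.
  have := homotopic_pull ch hP hQ cid cr h0 h1 (rel_cocycleZ a wc).
  move=> /(rel_coboundaryB aw').
  by apply: eq_rel_coboundary => n s _; rewrite pull_id subKr.
Qed.

Definition castc (A : comPzRingType) (w : cochain R X int) : cochain R X A :=
  fun n s => (w n s)%:~R.

Lemma cobound_castc (A : comPzRingType) (w : cochain R X int) n (s : singular R n X) :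
  cobound (castc A w) s = (cobound w s)%:~R.
Proof.
case: n s => [//|n] s; rewrite /= rmorph_sum /=; apply: eq_bigr => j _.
by rewrite rmorphM /= rmorphXn /= rmorphN1.
Qed.

Lemma rel_cocycle_castc (A : comPzRingType) P Q (w : cochain R X int) :
  rel_cocycle P Q w -> rel_cocycle P Q (castc A w).
Proof.
by move=> [wQ wP]; split=> n s sP; rewrite ?cobound_castc /castc ?wQ ?wP.
Qed.

Lemma rel_coboundary_castc (A : comPzRingType) P Q (w : cochain R X int) :
  rel_coboundary P Q w -> rel_coboundary P Q (castc A w).
Proof.
move=> [g [gQ gP]]; exists (castc A g).
by split=> n s sP; rewrite ?cobound_castc /castc ?gQ ?gP.
Qed.

Definition zgenerates (P Q : set X) (w : cochain R X int) :=
  forall A : comPzRingType, generates P Q (castc A w).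

Lemma zgenerates_int P Q w : zgenerates P Q w -> generates P Q w.
Proof.
move=> /(_ int) gw; have [[wQ _] _ _] := gw.
by apply: eq_generates gw => n s sP; [have := wQ n s sP|]; rewrite /castc intz.
Qed.

End Generators.

(** * Suspension *)

Section RetractPull.
Variables (R : realType) (X : topologicalType).

Lemma generates_retract_pull (A : comPzRingType) (P Q P' Q' : set X) (w : cochain R X A)
    (r : X -> X) (cr : continuous r) (h : X -> R -> X) :
  continuous (fun p : X * R => h p.1 p.2) ->
  h^~ 0 =1 id -> h^~ 1 =1 r ->
  P' `<=` P -> Q' `<=` Q -> P `<=` r @^-1` P' -> Q `<=` r @^-1` Q' ->
  (forall x t, P x -> 0 <= t <= 1 -> P (h x t)) ->
  (forall x t, Q x -> 0 <= t <= 1 -> Q (h x t)) ->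
  (forall x t, P' x -> 0 <= t <= 1 -> P' (h x t)) ->
  (forall x t, Q' x -> 0 <= t <= 1 -> Q' (h x t)) ->
  generates P' Q' w -> generates P Q (pull cr w).
Proof.
move=> ch h0 h1 sP sQ rP rQ hP hQ hP' hQ' [wc ex inj].
have cid : continuous (@idfun X) by move=> x.
have pull_id f n (s : singular R n X) : pull cid f s = f n s :> A.
  by congr (f n _); exact: singular_eq.
split; first exact: rel_cocycle_pull wc.
- move=> v vc; have [a va] := ex _ (rel_cocycleS sP sQ vc); exists a.
  have := homotopic_pull ch hP hQ cid cr h0 h1 vc.
  move=> /(rel_coboundaryB (rel_coboundary_pull cr rP rQ va)).
  by apply: eq_rel_coboundary => n s _; rewrite pull_id /pull; ring.
- move=> a aw; apply: inj.
  have := homotopic_pull ch hP' hQ' cid cr h0 h1 (rel_cocycleZ a wc).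
  move=> /(rel_coboundaryB (rel_coboundaryS sP sQ aw)).
  by apply: eq_rel_coboundary => n s _; rewrite pull_id subKr.
Qed.

End RetractPull.

Section Suspension.
Variables (R : realType) (X : topologicalType) (U V Q : set X).
Hypotheses (Uo : open U) (Vo : open V) (Qo : open Q) (UV0 : U `&` V = set0).
Let Y := U `|` V `|` Q.

(** [tau] on [U] and zero on [V] and [Q] are glued by excision, since [U] meets the other two only
    where [tau] vanishes. In the applications [U] and [V] are the two sides of a hyperplane. *)
Lemma suspension_cochain i (tau : cochain R X int) :
  homogeneous i tau -> rel_cocycle setT Q tau ->
  exists sigma : cochain R X int,
    [/\ homogeneous i sigma, rel_cocycle Y Q sigma,
        forall n (s : singular R n X), carried U s -> sigma n s = tau n s
      & forall n (s : singular R n X), carried V s -> sigma n s = 0].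
Proof.
move=> taui tauc.
have [|f [[fB fUB] fU]] := @excision_extend R X int U (V `|` Q) Uo (openU Vo Qo) tau.
  apply: rel_cocycleS tauc => // x [Ux [Vx|//]].
  by have : (U `&` V) x by []; rewrite UV0.
exists (hcomp i f); split; first exact: homogeneous_hcomp.
- split=> n s sP.
    by rewrite /hcomp; case: ifP => // _; apply: fB => x; right; exact: sP.
  rewrite cobound_hcomp /hcomp; case: ifP => // _.
  by apply: fUB; rewrite setUA.
- by move=> n s Us; rewrite -(hcomp_id s taui) /hcomp fU.
- by move=> n s Vs; rewrite /hcomp fB ?if_same // => x; left; exact: Vs.
Qed.

Variables (A : comPzRingType) (tau sigma : cochain R X A).
Arguments tau : clear implicits.
Arguments sigma : clear implicits.
Hypotheses (sigmac : rel_cocycle Y Q sigma)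
  (sigmaU : forall n (s : singular R n X), carried U s -> sigma n s = tau n s)
  (sigmaV : forall n (s : singular R n X), carried V s -> sigma n s = 0)
  (taug : generates setT Q tau).

Let sU : U `<=` Y. Proof. by move=> x; left; left. Qed.
Let sV : V `<=` Y. Proof. by move=> x; left; right. Qed.
Let sQ : Q `<=` Y. Proof. by move=> x; right. Qed.

(** On [Y], [omega] is b tau + (a - b) sigma up to a coboundary, and [tau] is a cocycle on the whole
    space, so only the second term survives the connecting map. This jump of the coefficient across
    the hyperplane is what an incidence number will be. *)
Lemma suspension_decomposition (omega : cochain R X A) a b :
  rel_cocycle Y Q omega ->
  rel_coboundary U (U `&` Q) (fun n s => omega n s - a * tau n s) ->
  rel_coboundary V (V `&` Q) (fun n s => omega n s - b * tau n s) ->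
  rel_coboundary setT Y (fun n s =>
    cobound (zext Y omega) s - (a - b) * cobound (zext Y sigma) s).
Proof.
move=> omegac omegaU omegaV; have [tauc _ _] := taug.
have [||||k [kQ kE]] := @two_pieces_coboundary R X A U V Q Uo Vo Qo _
  (fun n s => omega n s - b * tau n s - (a - b) * sigma n s).
- by rewrite UV0.
- apply: rel_cocycleB; last exact: rel_cocycleZ.
  apply: rel_cocycleB => //; apply: rel_cocycleZ.
  by apply: rel_cocycleS tauc.
- apply: eq_rel_coboundary omegaU => n s Us; rewrite sigmaU //; ring.
- by apply: eq_rel_coboundary omegaV => n s Vs; rewrite sigmaV // mulr0 subr0.
exists (fun n s => zext Y omega s - b * tau n s - (a - b) * zext Y sigma s
   - cobound k s); split=> n s sP.
  by rewrite !zextE // -kE // subrr.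
rewrite coboundB cobound_cobound subr0 coboundB coboundZ coboundB coboundZ.
by have [_ ->] := tauc; rewrite // mulr0 subr0.
Qed.

Hypotheses (tauU : generates U (U `&` Q) tau) (tauV : generates V (V `&` Q) tau).

(** The exact sequence of a triple, by hand. A class relative to [Y] restricts to zero on [U], so
    relative to [Q] it is a zero multiple of [tau] and it has a primitive [h] that is a cocycle on
    [Y]. The coefficients of [h] on the two sides then give the multiple of the suspended class. *)
Lemma suspension_generates : generates setT Y (cobound (zext Y sigma)).
Proof.
have [tauc ex inj] := taug; have [_ exU injU] := tauU; have [_ exV injV] := tauV.
have sIU : U `&` Q `<=` Q by move=> x [].
have sIV : V `&` Q `<=` Q by move=> x [].
have [sQ0 sY0] := sigmac.
split.
- split=> n s sP; first by rewrite cobound_zext // sY0.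
  exact: cobound_cobound.
- move=> v vc; have [vY _] := vc.
  have [a [h [hQ hE]]] := ex v (rel_cocycleS (fun x => id) sQ vc).
  have a0 : a = 0.
    apply: injU; exists (fun n s => - h n s); split=> n s sP.
      by rewrite hQ ?oppr0 // => x; exact/sIU/sP.
    have := hE n s (fun _ => I); rewrite vY => [|x]; last exact/sU/sP.
    rewrite sub0r => /(congr1 -%R); rewrite opprK => ->.
    have -> : - cobound h s = cobound (fun n (s : singular R n X) => 0 - h n s) s.
      by rewrite coboundB cobound0 sub0r.
    by apply: (@eq_cobound _ _ _ setT) => // *; rewrite sub0r.
  have hE' n (s : singular R n X) : v n s = cobound h s.
    by rewrite -hE // a0 mul0r subr0.
  have hc : rel_cocycle Y Q h by split=> // n s Ys; rewrite -hE' vY.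
  have [ap hU] := exU h (rel_cocycleS sU sIU hc).
  have [am hV] := exV h (rel_cocycleS sV sIV hc).
  exists (ap - am).
  have c1 : rel_coboundary setT Y (cobound (fun n s => h n s - zext Y h s)).
    by apply: rel_coboundary_cobound => n s Ys; rewrite zextE // subrr.
  have := rel_coboundaryD c1 (suspension_decomposition hc hU hV).
  apply: eq_rel_coboundary => n s _; rewrite hE' coboundB; ring.
- move=> a [k [kY kE]].
  (* This cocycle is a multiple of [tau] up to a coboundary. It vanishes on [V], so the multiple is
     zero; on [U] it is [a * tau], so [a] is zero. *)
  have kc : rel_cocycle setT Q (fun n s => a * zext Y sigma s - k n s).
    split=> n s sP; last by rewrite coboundB coboundZ kE // subrr.
    have Ys : carried Y s by move=> x; exact/sQ/sP.
    by rewrite zextE // kY // sQ0 // mulr0 subr0.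
  have [b [h [hQ hE]]] := ex _ kc.
  have b0 : b = 0.
    apply: injV; exists (fun n s => 0 - h n s); split=> n s sP.
      by rewrite hQ ?subr0 // => x; exact/sIV/sP.
    have Ys : carried Y s by move=> x; exact/sV/sP.
    rewrite coboundB cobound0 -hE // zextE // sigmaV // kY //; ring.
  apply: injU; exists h; split=> n s sP.
    by rewrite hQ // => x; exact/sIU/sP.
  have Ys : carried Y s by move=> x; exact/sU/sP.
  rewrite -hE // zextE // sigmaU // kY // b0; ring.
Qed.

Section Symmetry.
Variables (rho : X -> X) (crho : continuous rho) (e : A).
Hypothesis rhoQ : Q `<=` rho @^-1` Q.
Hypothesis tau_rho :
  rel_coboundary setT Q (fun n s => pull crho tau s - e * tau n s).

Let zext_pull : Y `<=` rho @^-1` Y ->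
  rel_coboundary setT Y (fun n s => pull crho (cobound (zext Y sigma)) s -
    cobound (zext Y (pull crho sigma)) s).
Proof.
move=> rhoY; have := @rel_coboundary_cobound R X A setT Y (fun n s =>
  pull crho (zext Y sigma) s - zext Y (pull crho sigma) s).
move=> h; apply: eq_rel_coboundary (h _) => n s sP.
  by rewrite coboundB cobound_pull.
by rewrite /pull !zextE ?subrr // => x; exact/rhoY/sP.
Qed.

Lemma suspension_fix : U `<=` rho @^-1` U -> V `<=` rho @^-1` V ->
  rel_coboundary setT Y (fun n s => pull crho (cobound (zext Y sigma)) s -
    e * cobound (zext Y sigma) s).
Proof.
move=> rU rV.
have rY : Y `<=` rho @^-1` Y.
  by move=> x [[/rU|/rV]|/rhoQ]; [left; left|left; right|right].
have c0 : rel_cocycle Y Q (pull crho sigma) by exact: rel_cocycle_pull sigmac.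
have := rel_coboundaryD (zext_pull rY) (@suspension_decomposition _ e 0 c0 _ _).
rewrite subr0 => h; apply: eq_rel_coboundary (h _ _) => [n s _||].
- ring.
- have sIU : U `&` Q `<=` Q by move=> x [].
  apply: eq_rel_coboundary (rel_coboundaryS (fun _ _ => I) sIU tau_rho) => n s Us.
  by rewrite /pull sigmaU // => x; exact/rU/Us.
- apply: rel_coboundary0 => n s Vs; rewrite /pull sigmaV ?mul0r ?subr0 //.
  by move=> x; exact/rV/Vs.
Qed.

(** The pulled back [sigma] is zero on [U] and [e * tau] on [V] up to a coboundary, so the jump of
    the coefficient is 0 - e. *)
Lemma suspension_swap : U `<=` rho @^-1` V -> V `<=` rho @^-1` U ->
  rel_coboundary setT Y (fun n s => pull crho (cobound (zext Y sigma)) s -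
    - e * cobound (zext Y sigma) s).
Proof.
move=> rU rV.
have rY : Y `<=` rho @^-1` Y.
  by move=> x [[/rU|/rV]|/rhoQ]; [left; right|left; left|right].
have c0 : rel_cocycle Y Q (pull crho sigma) by exact: rel_cocycle_pull sigmac.
have := rel_coboundaryD (zext_pull rY) (@suspension_decomposition _ 0 e c0 _ _).
rewrite sub0r => h; apply: eq_rel_coboundary (h _ _) => [n s _||].
- ring.
- apply: rel_coboundary0 => n s Us; rewrite /pull sigmaV ?mul0r ?subr0 //.
  by move=> x; exact/rU/Us.
- have sIV : V `&` Q `<=` Q by move=> x [].
  apply: eq_rel_coboundary (rel_coboundaryS (fun _ _ => I) sIV tau_rho) => n s Vs.
  by rewrite /pull sigmaU // => x; exact/rV/Vs.
Qed.

End Symmetry.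
End Suspension.

(** * Thom classes of coordinate subspaces *)

Section ThomClasses.
Variables (R : realType) (p q : nat).
Local Notation M := 'M[R]_(p, q).
Local Notation I := ('I_p * 'I_q)%type.
Implicit Types (J F : {set I}) (x : M).

Definition offzero J : set M := [set x | exists2 i, i \in J & x i.1 i.2 != 0].

(** Conditions on a single matrix entry. All are convex, so boxes deform along straight lines; [Fix]
    serves for the pivot columns of a chart. *)
Inductive kind := Full | Pos | Neg | Fix of R.

Definition inkind (k : kind) : set R :=
  match k with
  | Full => setT
  | Pos => [set y | 0 < y]
  | Neg => [set y | y < 0]
  | Fix a => [set a]
  end.

(** Not the identity on the half-lines: it is enough that the values satisfy the condition and that
    the straight line from [y] to the value stays in it. *)
Definition retkind (k : kind) (y : R) : R :=
  match k with Full => y | Pos => `|y| + 1 | Neg => - (`|y| + 1) | Fix a => a end.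

Lemma retkindP k y : inkind k (retkind k y).
Proof. by case: k => //=; rewrite ?oppr_lt0 ltr_wpDl. Qed.

Lemma retkind_continuous k : continuous (retkind k).
Proof.
have c : continuous (fun y : R => `|y| + 1).
  by move=> y; apply: continuousD; [exact: norm_continuous|exact: cst_continuous].
case: k => [y|//|y|a] //=.
  apply: (@continuous_comp _ _ _ (fun y : R => `|y| + 1) -%R); first exact: c.
  exact: opp_continuous.
exact: cst_continuous.
Qed.

Lemma inkind_convex k y z t : inkind k y -> inkind k z -> 0 <= t <= 1 ->
  inkind k ((1 - t) * y + t * z).
Proof.
case: k => //= [y0 z0|y0 z0|a -> ->] t01; [nra|nra|ring].
Qed.

Definition box (k : I -> kind) : set M :=
  [set x | forall i, inkind (k i) (x i.1 i.2)].

Definition boxret (k : I -> kind) x : M := \matrix_(i, j) retkind (k (i, j)) (x i j).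

Definition boxhom (k : I -> kind) x (t : R) : M :=
  \matrix_(i, j) ((1 - t) * x i j + t * retkind (k (i, j)) (x i j)).

Lemma boxret_continuous k : continuous (boxret k).
Proof.
move=> x; apply: matrix_continuous_at => i j.
apply: (@eq_continuous_at _ _ (retkind (k (i, j)) \o (fun x : M => x i j))).
  by move=> y; rewrite mxE.
by apply: continuous_comp; [exact: coord_continuous|exact: retkind_continuous].
Qed.

Lemma boxhom_continuous k : continuous (fun z : M * R => boxhom k z.1 z.2).
Proof.
move=> z; apply: matrix_continuous_at => i j.
have c1 : {for z, continuous (fun z : M * R => z.1 i j)}.
  apply: (@continuous_comp _ _ _ fst (fun x : M => x i j)); first exact: cvg_fst.
  exact: coord_continuous.
have c2 : {for z, continuous (fun z : M * R => z.2)} by exact: cvg_snd.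
apply: (@eq_continuous_at _ _ (fun z : M * R => (1 - z.2) * z.1 i j +
    z.2 * retkind (k (i, j)) (z.1 i j))).
  by move=> y; rewrite mxE.
apply: continuousD; apply: continuousM => //.
  by apply: continuousB => //; exact: cst_continuous.
apply: (@continuous_comp _ _ _ (fun z : M * R => z.1 i j) (retkind (k (i, j)))) => //.
exact: retkind_continuous.
Qed.

Section Box.
Variables (k : I -> kind) (J : {set I}).
Hypothesis kJ : forall i, i \in J -> k i = Full.

Let h0 : (boxhom k)^~ 0 =1 id.
Proof. by move=> x; apply/matrixP => i j; rewrite mxE; ring. Qed.

Let h1 : (boxhom k)^~ 1 =1 boxret k.
Proof. by move=> x; apply/matrixP => i j; rewrite !mxE; ring. Qed.

Let retP x : box k (boxret k x).
Proof. by move=> -[i j]; rewrite mxE; exact: retkindP. Qed.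

Let ret_off : offzero J `<=` boxret k @^-1` offzero J.
Proof. by move=> x [[i j] ij xij]; exists (i, j) => //; rewrite mxE kJ. Qed.

Let hom_box x t : box k x -> 0 <= t <= 1 -> box k (boxhom k x t).
Proof.
move=> kx t01 [i j]; rewrite mxE.
by apply: inkind_convex => //; exact: retkindP.
Qed.

Let hom_off x t : offzero J x -> 0 <= t <= 1 -> offzero J (boxhom k x t).
Proof.
move=> [[i j] ij xij] t01; exists (i, j) => //.
by rewrite mxE kJ //= -mulrDl subrK mul1r.
Qed.

(** The deformation leaves the entries indexed by [J] unchanged, since [k] puts no condition there,
    and so it respects the relative part. *)
Lemma generates_box (A : comPzRingType) (w : cochain R M A) :
  generates setT (offzero J) w -> generates (box k) (box k `&` offzero J) w.
Proof.
apply: (generates_retract (@boxret_continuous k) (@boxhom_continuous k) h0 h1) => //.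
- by move=> x _; exact: retP.
- by move=> x xJ; split; [exact: retP|exact: ret_off].
- by move=> x t [kx xJ] t01; split; [exact: hom_box|exact: hom_off].
Qed.

Lemma generates_pull_box (A : comPzRingType) (w : cochain R M A) :
  generates (box k) (box k `&` offzero J) w ->
  generates setT (offzero J) (pull (@boxret_continuous k) w).
Proof.
apply: (generates_retract_pull (@boxret_continuous k) (@boxhom_continuous k) h0 h1) => //.
- by move=> x _; exact: retP.
- by move=> x xJ; split; [exact: retP|exact: ret_off].
- by move=> x t [kx xJ] t01; split; [exact: hom_box|exact: hom_off].
Qed.

End Box.

Lemma open_coord (i : I) (D : set R) : open D -> open [set x : M | D (x i.1 i.2)].
Proof.
move=> Do; apply: (@open_comp _ _ (fun x : M => x i.1 i.2)) => // x _.
exact: coord_continuous.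
Qed.

Lemma open_pos (i : I) : open [set x : M | 0 < x i.1 i.2].
Proof. apply: (@open_coord i [set y | 0 < y]); exact: open_gt. Qed.

Lemma open_neg (i : I) : open [set x : M | x i.1 i.2 < 0].
Proof. apply: (@open_coord i [set y | y < 0]); exact: open_lt. Qed.

Lemma open_offzero J : open (offzero J).
Proof.
have -> : offzero J = \bigcup_(i in [set i | i \in J]) [set x | x i.1 i.2 != 0].
  by apply/seteqP; split=> x [i]; exists i.
by apply: bigcup_open => i _; apply: (@open_coord i [set y | y != 0]); exact: open_neq.
Qed.

Definition flip F x : M := \matrix_(i, j) (if (i, j) \in F then - x i j else x i j).

Lemma flipE F x i : flip F x i.1 i.2 = if i \in F then - x i.1 i.2 else x i.1 i.2.
Proof. by rewrite mxE -surjective_pairing. Qed.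

Lemma flip_continuous F : continuous (flip F).
Proof.
move=> x; apply: matrix_continuous_at => i j.
apply: (@eq_continuous_at _ _ (fun y : M => if (i, j) \in F then - y i j else y i j)).
  by move=> y; rewrite mxE.
case: ((i, j) \in F); last exact: coord_continuous.
apply: (@continuous_comp _ _ _ (fun y : M => y i j) -%R); first exact: coord_continuous.
exact: opp_continuous.
Qed.

Lemma flip_off F J : offzero J `<=` flip F @^-1` offzero J.
Proof.
move=> x [i iJ xi]; exists i => //; rewrite flipE.
by case: (i \in F) => //; rewrite oppr_eq0.
Qed.

Section OneCoordinate.
Variables (J : {set I}) (i : I).
Hypothesis iJ : i \notin J.

Definition pos_part : set M := [set x | 0 < x i.1 i.2].
Definition neg_part : set M := [set x | x i.1 i.2 < 0].

Lemma pos_neg_part0 : pos_part `&` neg_part = set0.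
Proof. by apply/seteqP; split=> // x [/= h1 h2]; have := lt_trans h1 h2; rewrite ltxx. Qed.

Lemma offzeroU1 : offzero (i |: J) = pos_part `|` neg_part `|` offzero J.
Proof.
apply/seteqP; split=> x.
  move=> [i']; rewrite in_setU1 => /orP[/eqP -> xi|i'J xi]; last by right; exists i'.
  by left; case: (ltgtP (x i.1 i.2) 0) xi => // h _; [right|left].
move=> [[xi|xi]|[i' i'J xi]].
- by exists i; rewrite ?setU11 // gt_eqF.
- by exists i; rewrite ?setU11 // lt_eqF.
- by exists i' => //; rewrite setU1r.
Qed.

Lemma generates_pos (A : comPzRingType) (w : cochain R M A) :
  generates setT (offzero J) w -> generates pos_part (pos_part `&` offzero J) w.
Proof.
pose k i' := if i' == i then Pos else Full.
have -> : pos_part = box k; last first.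
  by apply: generates_box => i' i'J; rewrite /k; case: eqP iJ => // <-; rewrite i'J.
apply/seteqP; split=> x; first by move=> xi i'; rewrite /k; case: eqP => // ->.
by move=> /(_ i); rewrite /k eqxx.
Qed.

Lemma generates_neg (A : comPzRingType) (w : cochain R M A) :
  generates setT (offzero J) w -> generates neg_part (neg_part `&` offzero J) w.
Proof.
pose k i' := if i' == i then Neg else Full.
have -> : neg_part = box k; last first.
  by apply: generates_box => i' i'J; rewrite /k; case: eqP iJ => // <-; rewrite i'J.
apply/seteqP; split=> x; first by move=> xi i'; rewrite /k; case: eqP => // ->.
by move=> /(_ i); rewrite /k eqxx.
Qed.

End OneCoordinate.

Definition const_cochain (A : pzRingType) : cochain R M A := fun n s => (n == 0%N)%:R.

(** Contraction to constant simplices. On these the alternating sum of faces is the identity or zero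
    according to parity: the values [a n] of a cocycle vanish for odd [n], and [g] is a primitive in
    positive even degrees. *)
Lemma generates_const (A : comPzRingType) : generates setT (offzero finset.set0) (const_cochain A).
Proof.
have off0 : offzero finset.set0 = set0.
  by apply/seteqP; split=> // x [i]; rewrite inE.
have nocarried n (s : singular R n M) : ~ carried (offzero finset.set0) s.
  by rewrite off0 => /(_ (@vertex R n ord0)).
have alt n (c : A) : \sum_(j < n) (-1) ^+ j * c = (odd n)%:R * c.
  elim: n => [|n IH]; first by rewrite big_ord0 mul0r.
  rewrite big_ord_recr /= IH -mulrDl -signr_odd; congr (_ * _).
  by case: (odd n) => /=; rewrite ?expr0 ?expr1 ?addrN ?add0r.
have cst_c n : continuous (fun _ : set_type (@std_simplex R n) => 0 : M).
  by move=> x; exact: cst_continuous.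
pose c n : singular R n M := Singular (cst_c n).
split.
- split=> n s sP; first by have := nocarried _ _ sP.
  case: n s {sP} => [//|[|n]] s; last by apply: big1 => j _; rewrite mulr0.
  by rewrite /= alt mul0r.
- move=> v [_ vT].
  have cc : continuous (fun _ : M => 0 : M) by exact: cst_continuous.
  pose k (_ : I) := Fix 0.
  pose a n := v n (c n).
  have ca n (s : singular R n M) : pull cc v s = a n by congr (v n _); exact: singular_eq.
  have va n : (odd n.+2)%:R * a n = 0.
    rewrite -alt -[RHS](vT _ (c n.+1) (fun=> Logic.I)); apply: eq_bigr => j _.
    by congr (_ * v n _); exact: singular_eq.
  exists (a 0%N).
  pose g : cochain R M A := fun n s => if odd n then a n.+1 else 0.
  have c1 : rel_coboundary setT (offzero finset.set0)
      (fun n s => pull cc v s - a 0%N * const_cochain A s).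
    exists g; split=> n s sP; first by have := nocarried _ _ sP.
    rewrite ca; case: n s {sP} => [|n] s; first by rewrite mulr1 subrr.
    rewrite mulr0 subr0 /= alt /= /g negbK.
    case: (boolP (odd n)) => on; first by rewrite mul1r.
    by rewrite mul0r; have := va n.+1; rewrite /= on mul1r.
  have cid : continuous (@idfun M) by move=> x.
  have := @homotopic_pull R M M A (boxhom k) (@boxhom_continuous k) setT (offzero finset.set0)
    setT (offzero finset.set0) _ _ idfun (fun=> 0) cid cc v.
  move=> h; apply: eq_rel_coboundary (rel_coboundaryB c1 (h _ _ _ _ _)) => //.
  + move=> n s _; rewrite (_ : pull cid v s = v n s); last by congr (v n _); exact: singular_eq.
    ring.
  + by move=> x t; rewrite off0.
  + by move=> x; apply/matrixP => i j; rewrite mxE; ring.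
  + by move=> x; apply/matrixP => i j; rewrite !mxE /=; ring.
  + by split=> n s sP; [have := nocarried _ _ sP|exact: vT].
- move=> a [g [_ gE]]; have := gE 0%N (c 0%N).
  by rewrite /const_cochain eqxx mulr1; apply.
Qed.

Lemma thom_class J : exists w : cochain R M int,
  [/\ homogeneous #|J| w, zgenerates setT (offzero J) w
    & forall F, rel_coboundary setT (offzero J)
        (fun n s => pull (@flip_continuous F) w s - (-1) ^+ #|F :&: J| * w n s)].
Proof.
have [n] := ubnP #|J|; elim: n J => // n IH J Jn.
case: (set_0Vmem J) => [->|[i iJ]].
  exists (const_cochain int); split; rewrite ?cards0.
  - by move=> m s /negPf m0; rewrite /const_cochain m0.
  - move=> A; apply: eq_generates (generates_const A) => m s sP.
      by have [i] := sP (@vertex R m ord0); rewrite inE.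
    by rewrite /castc /const_cochain; case: eqP.
  - move=> F; rewrite finset.setI0 cards0; apply: rel_coboundary0 => m s _.
    by rewrite /pull mul1r subrr.
pose J0 := J :\ i; have iJ0 : i \notin J0 by rewrite !inE eqxx.
have JE : J = i |: J0 by rewrite finset.setD1K.
have cardJ : #|J| = #|J0|.+1 by rewrite JE cardsU1 iJ0.
have [|w [wh wg wflip]] := IH J0; first by rewrite -ltnS -cardJ.
have [wc _ _] := zgenerates_int wg.
have [sigma [sh sc sU sV]] := suspension_cochain (@open_pos i) (@open_neg i)
  (@open_offzero J0) (pos_neg_part0 i) wh wc.
rewrite JE offzeroU1; set Y := _ `|` _ in sc *.
exists (cobound (zext Y sigma)); split.
- rewrite cardsU1 iJ0; apply: homogeneous_cobound => m s ms.
  by apply: zext_eq0 => _; exact: sh.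
(* [sigma] is built over the integers and then cast, so that one integral cochain generates over all
   rings. *)
- move=> A; have wgA := wg A.
  have := @suspension_generates R M _ _ _ (@open_pos i) (@open_neg i) (@open_offzero J0)
    (pos_neg_part0 i) A (castc A w) (castc A sigma) (rel_cocycle_castc A sc) _ _ wgA
    (generates_pos iJ0 wgA) (generates_neg iJ0 wgA).
  have zE m (s : singular R m M) : zext Y (castc A sigma) s = castc A (zext Y sigma) s.
    by rewrite /castc /zext; case: ifP.
  have cE m (s : singular R m M) : cobound (zext Y (castc A sigma)) s =
      castc A (cobound (zext Y sigma)) s.
    rewrite -[RHS](cobound_castc A (zext Y sigma) s); apply: (@eq_cobound _ _ _ setT) => // k t _; exact: zE.
  move=> h; apply: eq_generates (h _ _) => m s sP.
  + rewrite -cE cobound_zext // cobound_castc.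
    by have [_ ->] := sc.
  + exact: cE.
  + by rewrite /castc sU.
  + by rewrite /castc sV.
- move=> F; case: (boolP (i \in F)) => iF.
  + have -> : #|F :&: (i |: J0)| = #|F :&: J0|.+1.
      have -> : F :&: (i |: J0) = i |: (F :&: J0).
        by apply/setP => x; rewrite !inE; case: (x =P i) => [->|] //=; rewrite iF.
      by rewrite cardsU1 inE (negPf iJ0) andbF.
    rewrite exprS mulN1r; apply: (suspension_swap (@open_pos i) (@open_neg i)
      (@open_offzero J0) (pos_neg_part0 i) sc sU sV (zgenerates_int wg) _ (wflip F)).
    * exact: flip_off.
    * by move=> x; rewrite /pos_part /neg_part /= flipE iF oppr_lt0.
    * by move=> x; rewrite /pos_part /neg_part /= flipE iF oppr_gt0.
  + have -> : #|F :&: (i |: J0)| = #|F :&: J0|.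
      congr #|pred_of_set _|; apply/setP => x; rewrite !inE.
      by case: (x =P i) => [->|] //=; rewrite (negPf iF).
    apply: (suspension_fix (@open_pos i) (@open_neg i)
      (@open_offzero J0) (pos_neg_part0 i) sc sU sV (zgenerates_int wg) _ (wflip F)).
    * exact: flip_off.
    * by move=> x; rewrite /pos_part /= flipE (negPf iF).
    * by move=> x; rewrite /neg_part /= flipE (negPf iF).
Qed.

End ThomClasses.

(** * Frames and echelon forms *)

Section Frames.
Variables (R : realType) (N K : nat).
Implicit Types (M : 'M[R]_(K, N)) (u : 'rV[R]_K) (v : 'rV[R]_N).

Lemma size_rows M : size (rows M) = K.
Proof. by rewrite size_tuple ?card_ord. Qed.

Lemma nth_rows M (i : 'I_K) : (rows M)`_i = row i M.
Proof. by rewrite -tnth_nth tnth_mktuple. Qed.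

Lemma mulmx_rows u M : u *m M = \sum_i u 0 i *: (rows M)`_i.
Proof. by rewrite mulmx_sum_row; apply: eq_bigr => i _; rewrite nth_rows. Qed.

Lemma mem_span_rows v M : (v \in <<rows M>>%VS) <-> exists u, v = u *m M.
Proof.
split=> [/coord_span e|[u ->]].
  exists (\row_i coord (rows M) i v); rewrite mulmx_rows {1}e.
  by apply: eq_bigr => i _; rewrite mxE.
rewrite mulmx_rows; apply: memv_suml => i _; apply: memvZ.
by apply: memv_span; rewrite mem_nth // size_rows.
Qed.

Lemma frames_inj M : frames M <-> forall u, u *m M = 0 -> u = 0.
Proof.
split=> [/freeP fM u|inj].
  rewrite mulmx_rows => /fM u0; apply/rowP => i; rewrite mxE; exact: u0.
apply/freeP => k k0 i.
have /inj/rowP/(_ i) : (\row_i k i) *m M = 0.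
  by rewrite mulmx_rows -[RHS]k0; apply: eq_bigr => j _; rewrite mxE.
by rewrite !mxE.
Qed.

Lemma mem_flag v i : (v \in flag R N i) <-> forall c : 'I_N, (i <= c)%N -> v 0 c = 0.
Proof.
split=> [|v0].
  move=> /(coord_span (X := in_tuple _)) -> c ic.
  rewrite summxE big1 // => j _; rewrite mxE.
  have : (in_tuple [seq delta_mx 0 j | j : 'I_N <- enum 'I_N & (j < i)%N])`_j \in
     [seq (delta_mx 0 j : 'rV[R]_N) | j : 'I_N <- enum 'I_N & (j < i)%N].
    exact: mem_nth.
  move=> /mapP[k]; rewrite mem_filter => /andP[ki _] ->.
  rewrite mxE eqxx /= (_ : (c == k) = false) ?mulr0 //.
  by apply: contraTF ki => /eqP <-; rewrite -leqNgt.
rewrite [v]matrix_sum_delta big_ord1; apply: memv_suml => c _.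
case: (ltnP c i) => ci; last by rewrite v0 // scale0r mem0v.
apply/memvZ/memv_span/mapP; exists c => //.
by rewrite mem_filter ci mem_enum.
Qed.

Lemma flagS i j : (i <= j)%N -> (flag R N i <= flag R N j)%VS.
Proof.
move=> ij; apply/subvP => v /mem_flag v0; apply/mem_flag => c jc.
exact/v0/(leq_trans ij).
Qed.

Lemma mem_take_rows u M j : (forall k : 'I_K, (j <= k)%N -> u 0 k = 0) ->
  u *m M \in <<take j (rows M)>>%VS.
Proof.
move=> u0; rewrite mulmx_rows; apply: memv_suml => k _.
case: (ltnP k j) => kj; last by rewrite u0 // scale0r mem0v.
apply/memvZ/memv_span; rewrite -(nth_take 0 kj); apply: mem_nth.
by rewrite size_take size_rows; case: ifP.
Qed.

Lemma dim_take_rows M j : frames M -> (j <= K)%N -> \dim <<take j (rows M)>> = j.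
Proof.
move=> fM jK; have : free (take j (rows M)).
  by apply: (@catl_free _ _ (drop j (rows M))); rewrite cat_take_drop.
rewrite /free => /eqP ->; rewrite size_take size_rows.
by case: ltngtP jK => // ->.
Qed.

Section Plane.
Variables (U : Gr R N K) (M : 'M[R]_(K, N)).
Hypothesis UM : val U = <<rows M>>%VS.

Lemma frames_of_span : frames M.
Proof.
by rewrite /frames /= /free -UM (eqP (valP U)) size_rows.
Qed.

Lemma cap_flag_le i j : (forall u, u *m M \in flag R N i ->
    forall k : 'I_K, (j <= k)%N -> u 0 k = 0) ->
  (val U :&: flag R N i <= <<take j (rows M)>>)%VS.
Proof.
move=> h; apply/subvP => v; rewrite memv_cap UM => /andP[/mem_span_rows [u ->] uf].
by apply: mem_take_rows => k; exact: (h u uf).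
Qed.

Lemma dim_cap_flag_le i j : (j <= K)%N -> (forall u, u *m M \in flag R N i ->
    forall k : 'I_K, (j <= k)%N -> u 0 k = 0) ->
  (\dim (val U :&: flag R N i) <= j)%N.
Proof.
move=> jK /cap_flag_le /dimvS; rewrite dim_take_rows //; exact: frames_of_span.
Qed.

Lemma dim_cap_flag_ge i j : (j <= K)%N ->
  (forall k : 'I_K, (k < j)%N -> row k M \in flag R N i) ->
  (j <= \dim (val U :&: flag R N i))%N.
Proof.
move=> jK h; rewrite -{1}(dim_take_rows frames_of_span jK); apply: dimvS.
rewrite subv_cap; apply/andP; split.
  by rewrite UM; apply: sub_span => x; exact: mem_take.
apply/span_subvP => x /(nthP 0) [k]; rewrite size_take size_rows.
have -> : (if (j < K)%N then j else K) = j by case: ltngtP jK => // ->.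
move=> kj <-; have kK := leq_trans kj jK.
by rewrite nth_take // -[k]/(val (Ordinal kK)) nth_rows; exact: h.
Qed.

End Plane.

Section Pivots.
Variable J : 'I_K -> 'I_N.
Hypothesis Jinc : forall i j : 'I_K, (i < j)%N -> (J i < J j)%N.

Let Jle (i j : 'I_K) : (i <= j)%N -> (J i <= J j)%N.
Proof. by rewrite leq_eqVlt => /orP[/eqP/val_inj ->//|/Jinc/ltnW]. Qed.

Definition pivoted M := forall j : 'I_K, M j (J j) != 0 /\
  forall c : 'I_N, (J j < c)%N -> M j c = 0.

(** Descending induction on [k]: in column [J k] the earlier rows vanish, and the coefficients of
    the later rows are already known to be zero. *)
Lemma pivoted_mul_flag M u i : pivoted M -> u *m M \in flag R N i ->
  forall k : 'I_K, (i <= J k)%N -> u 0 k = 0.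
Proof.
move=> pM /mem_flag uf k; have [m] := ubnP (K - k); elim: m k => // m IH k km iJ.
have := uf _ iJ; rewrite mxE (bigD1 k) //= big1 => [|k' k'k].
  by rewrite addr0 => /eqP; rewrite mulf_eq0 (negPf (pM k).1) orbF => /eqP.
case: (ltngtP k' k) => [lt|gt|/val_inj e]; last by rewrite e eqxx in k'k.
  by rewrite (pM k').2 ?mulr0 //; exact: Jinc.
rewrite IH ?mul0r //; last exact: leq_trans iJ (ltnW (Jinc gt)).
by have := ltn_ord k'; lia.
Qed.

Lemma pivoted_frames M : pivoted M -> frames M.
Proof.
move=> pM; apply/frames_inj => u uM; apply/rowP => k; rewrite mxE.
by apply: (@pivoted_mul_flag M u 0) => //; rewrite uM mem0v.
Qed.

Lemma pivoted_dim (U : Gr R N K) M i j : val U = <<rows M>>%VS -> pivoted M ->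
  (j <= K)%N ->
  (forall k : 'I_K, (k < j)%N -> (J k < i)%N) ->
  (forall k : 'I_K, (j <= k)%N -> (i <= J k)%N) ->
  \dim (val U :&: flag R N i) = j.
Proof.
move=> UM pM jK lo hi; apply/eqP; rewrite eqn_leq; apply/andP; split.
  apply: (dim_cap_flag_le UM jK) => u uf k jk.
  exact: (pivoted_mul_flag pM uf (hi _ jk)).
apply: (dim_cap_flag_ge UM jK) => k kj; apply/mem_flag => c ic.
by rewrite mxE (pM k).2 //; exact: leq_trans (lo _ kj) ic.
Qed.

Definition incell (U : Gr R N K) := forall j : 'I_K,
  \dim (val U :&: flag R N (J j).+1) = j.+1 /\ \dim (val U :&: flag R N (J j)) = j.

Lemma pivoted_cell (U : Gr R N K) M : val U = <<rows M>>%VS -> pivoted M -> incell U.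
Proof.
move=> UM pM j; split; apply: (pivoted_dim UM pM) => [|k|k]; rewrite ?ltnS.
- exact: ltn_ord.
- exact: Jle.
- exact: Jinc.
- exact/ltnW/ltn_ord.
- exact: Jinc.
- exact: Jle.
Qed.

Lemma cell_pivoted (U : Gr R N K) : incell U ->
  exists M, val U = <<rows M>>%VS /\ pivoted M.
Proof.
move=> cU.
have ex (j : 'I_K) : exists v, [/\ v \in val U, v \in flag R N (J j).+1 & v \notin flag R N (J j)].
  have [d1 d0] := cU j; apply: contrapT => no.
  have : (val U :&: flag R N (J j).+1 <= val U :&: flag R N (J j))%VS.
    apply/subvP => v; rewrite memv_cap => /andP[vU v1]; rewrite memv_cap vU /=.
    by apply/negPn/negP => v0; apply: no; exists v.
  by move/dimvS; rewrite d1 d0 ltnn.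
pose w j := sval (cid (ex j)); have wP j := svalP (cid (ex j)).
pose M := \matrix_(j, c) w j 0 c.
have rowM j : row j M = w j by apply/rowP => c; rewrite !mxE.
have pM : pivoted M.
  move=> j; have [_ /mem_flag w1 w0] := wP j; split; last first.
    by move=> c Jc; rewrite mxE; exact: w1.
  rewrite mxE; apply: contra w0 => /eqP w0; apply/mem_flag => c.
  by rewrite leq_eqVlt => /orP[/eqP/val_inj <- //|/w1].
exists M; split=> //; apply/eqP; rewrite eq_sym eqEdim (eqP (valP U)).
have /eqP -> := pivoted_frames pM; rewrite size_rows leqnn andbT.
apply/span_subvP => v /(nthP 0) [k]; rewrite size_rows => kK <-.
by rewrite -[k]/(val (Ordinal kK)) nth_rows rowM; have [] := wP (Ordinal kK).
Qed.

Definition normalized M := forall j k, M j (J k) = (j == k)%:R.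

Lemma normalized_mul M u k : normalized M -> (u *m M) 0 (J k) = u 0 k.
Proof.
move=> nM; rewrite mxE (bigD1 k) //= nM eqxx mulr1 big1 ?addr0 // => i ik.
by rewrite nM (negPf ik) mulr0.
Qed.

Lemma normalized_frames M : normalized M -> frames M.
Proof.
move=> nM; apply/frames_inj => u uM; apply/rowP => k.
by rewrite -(normalized_mul u k nM) uM !mxE.
Qed.

Lemma normalized_mul_flag M u i : normalized M -> u *m M \in flag R N i ->
  forall k : 'I_K, (i <= J k)%N -> u 0 k = 0.
Proof. by move=> nM /mem_flag uf k iJ; rewrite -(normalized_mul u k nM) uf. Qed.

Lemma normalized_inj (U : Gr R N K) M M' :
  val U = <<rows M>>%VS -> val U = <<rows M'>>%VS ->
  normalized M -> normalized M' -> M = M'.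
Proof.
move=> UM UM' nM nM'; apply/row_matrixP => j.
have : row j M \in <<rows M'>>%VS.
  rewrite -UM' UM; apply/mem_span_rows; exists (delta_mx 0 j); exact: rowE.
move=> /mem_span_rows [u e]; rewrite e.
have -> : u = delta_mx 0 j.
  apply/rowP => k; rewrite -(normalized_mul u k nM') -e !mxE nM eqxx.
  by rewrite eq_sym.
by rewrite -rowE.
Qed.

Lemma pivoted_normalize (U : Gr R N K) M : val U = <<rows M>>%VS ->
  colsub J M \in unitmx ->
  let M' := invmx (colsub J M) *m M in val U = <<rows M'>>%VS /\ normalized M'.
Proof.
move=> UM uM M'; split.
  rewrite UM; apply/eqP; rewrite eqEsubv; apply/andP; split; apply/subvP => v;
    move=> /mem_span_rows [u ->]; apply/mem_span_rows.
    by exists (u *m colsub J M); rewrite mulmxA -(mulmxA u) mulmxV // mulmx1.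
  by exists (u *m invmx (colsub J M)); rewrite mulmxA.
move=> j k; have := congr1 (fun A : 'M[R]_K => A j k) (mulVmx uM).
by rewrite !mxE => <-; apply: eq_bigr => i _; rewrite !mxE.
Qed.

Lemma pivoted_unitmx M : pivoted M -> colsub J M \in unitmx.
Proof.
move=> pM; rewrite unitmxE unitfE det_trig.
  by apply/prodf_neq0 => i _; rewrite mxE; exact: (pM i).1.
apply/is_trig_mxP => i j ij; rewrite mxE; apply: (pM i).2; exact: Jinc.
Qed.

End Pivots.

(** For a normalized matrix the coefficients of a combination of rows are its entries in the columns
    [J]; a combination lying in a step of the flag thus has zero coefficients at all later
    pivots. *)
Lemma chart_cell_le (J J' : 'I_K -> 'I_N) (U : Gr R N K) M :
  (forall i j : 'I_K, (i < j)%N -> (J i < J j)%N) ->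
  val U = <<rows M>>%VS -> normalized J M -> incell J' U ->
  forall j, (J j <= J' j)%N.
Proof.
move=> Jinc UM nM cU j; rewrite leqNgt; apply/negP => lt.
have [d1 _] := cU j; have : (\dim (val U :&: flag R N (J' j).+1) <= j)%N.
  apply: (dim_cap_flag_le UM (ltnW (ltn_ord j))) => u uf k jk.
  apply: (normalized_mul_flag nM uf); apply: leq_trans lt _.
  by move: jk; rewrite leq_eqVlt => /orP[/eqP/val_inj ->//|/Jinc/ltnW].
by rewrite d1 ltnn.
Qed.

(** The plane meets the step of the flag at most in the span of the first [j.+1] rows, and the
    dimensions agree, so row [j] lies in that step. It is applied with [J' = J] and with one pivot
    moved by one column. *)
Lemma chart_cell_eq0 (J J' : 'I_K -> 'I_N) (U : Gr R N K) M :
  val U = <<rows M>>%VS -> normalized J M -> incell J' U ->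
  (forall j k : 'I_K, (j < k)%N -> (J' j < J k)%N) ->
  forall (j : 'I_K) (c : 'I_N), (J' j < c)%N -> M j c = 0.
Proof.
move=> UM nM cU JJ' j c jc.
have sub : (val U :&: flag R N (J' j).+1 <= <<take j.+1 (rows M)>>)%VS.
  apply: (cap_flag_le UM) => u uf k jk.
  by apply: (normalized_mul_flag nM uf); exact: JJ'.
have e : (val U :&: flag R N (J' j).+1)%VS = <<take j.+1 (rows M)>>%VS.
  apply/eqP; rewrite eqEdim sub (cU j).1 dim_take_rows ?ltnSn //.
  exact: frames_of_span UM.
have : row j M \in (val U :&: flag R N (J' j).+1)%VS.
  rewrite e rowE; apply: mem_take_rows => k jk; rewrite mxE eqxx /=.
  by case: eqP jk => // ->; rewrite ltnn.
by rewrite memv_cap => /andP[_ /mem_flag/(_ c jc)]; rewrite mxE.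
Qed.

Lemma incell_inj (J J' : 'I_K -> 'I_N) (U : Gr R N K) :
  incell J U -> incell J' U -> J =1 J'.
Proof.
have le (J1 J2 : 'I_K -> 'I_N) j : incell J1 U -> incell J2 U -> (J2 j <= J1 j)%N.
  move=> c1 c2; rewrite leqNgt; apply/negP => lt.
  have [d1 _] := c1 j; have [_ d2] := c2 j.
  have : (val U :&: flag R N (J1 j).+1 <= val U :&: flag R N (J2 j))%VS.
    by apply: capvS => //; exact: flagS.
  by move/dimvS; rewrite d1 d2 ltnn.
by move=> c c' j; apply/val_inj/eqP; rewrite eqn_leq !le.
Qed.

(** Along the flag the dimension of the intersection grows from 0 to [K] by steps of at most one;
    the pivots are the places where it jumps. *)
Lemma exists_incell (U : Gr R N K) : exists J : 'I_K -> 'I_N,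
  (forall i j : 'I_K, (i < j)%N -> (J i < J j)%N) /\ incell J U.
Proof.
pose d i := \dim (val U :&: flag R N i).
have d0 : d 0%N = 0%N.
  apply/eqP; rewrite dimv_eq0 -subv0; apply/subvP => v.
  rewrite memv_cap memv0 => /andP[_ /mem_flag v0].
  by apply/eqP/rowP => c; rewrite v0 // mxE.
have dN : d N = K.
  rewrite /d (_ : (_ :&: _)%VS = val U) ?(eqP (valP U)) //.
  apply/capv_idPl/subvP => v _; apply/mem_flag => c.
  by rewrite leqNgt ltn_ord.
have dS i : (d i.+1 <= (d i).+1)%N.
  case: (ltnP i N) => iN; last first.
    apply: leq_trans (leqnSn _); apply/dimvS/capvS => //.
    by apply/subvP => v _; apply/mem_flag => c; rewrite leqNgt (leq_trans (ltn_ord c) iN).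
  have flag_le : (flag R N i.+1 <= flag R N i + <[delta_mx 0%R (Ordinal iN)]>)%VS.
    apply/subvP => v /mem_flag v0.
    rewrite -(subrK (v 0 (Ordinal iN) *: delta_mx 0 (Ordinal iN)) v).
    apply: memv_add; last exact/memvZ/memv_line.
    apply/mem_flag => c; rewrite !mxE eqxx /= leq_eqVlt => /orP[/eqP ic|ic].
      by have -> : c = Ordinal iN; [exact/val_inj|rewrite eqxx mulr1 subrr].
    rewrite v0 // (_ : (c == _) = false) ?mulr0 ?subrr //.
    by apply/eqP => /(congr1 val) /= e; rewrite e ltnn in ic.
  have dflag : (\dim (flag R N i.+1) <= (\dim (flag R N i)).+1)%N.
    apply: leq_trans (dimvS flag_le) _; apply: leq_trans (dimv_add_leqif _ _) _.
    by rewrite dim_vline; case: (_ != _); rewrite ?addn1 ?addn0.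
  have := dimv_sum_cap (val U :&: flag R N i.+1) (flag R N i).
  have -> : (val U :&: flag R N i.+1 :&: flag R N i)%VS = (val U :&: flag R N i)%VS.
    rewrite -capvA (_ : (flag R N i.+1 :&: _)%VS = flag R N i) //.
    by apply/capv_idPr; exact: flagS.
  have : (\dim (val U :&: flag R N i.+1 + flag R N i) <= (\dim (flag R N i)).+1)%N.
    apply: leq_trans dflag; apply: dimvS; rewrite subv_add capvSr flagS //.
  by rewrite -/(d i.+1) -/(d i); lia.
have exJ (j : 'I_K) : exists i : 'I_N, d i = j /\ d i.+1 = j.+1.
  have Pub i : (i <= N)%N && (d i <= j)%N -> (i <= N)%N by case/andP.
  have P0 : exists i, (i <= N)%N && (d i <= j)%N by exists 0%N; rewrite d0.
  case: (ex_maxnP P0 Pub) => i /andP[iN dij] imax.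
  have {}iN : (i < N)%N.
    rewrite ltn_neqAle iN andbT; apply/eqP => e; move: dij.
    by rewrite e dN leqNgt ltn_ord.
  have : (j < d i.+1)%N.
    by rewrite ltnNge; apply/negP => h; have := imax i.+1; rewrite iN h ltnn => /(_ isT).
  by exists (Ordinal iN) => /=; have := dS i; lia.
pose J j := sval (cid (exJ j)); have JP j : d (J j) = j /\ d (J j).+1 = j.+1.
  exact: svalP (cid (exJ j)).
exists J; split=> [i j ij|j]; last by have [? ?] := JP j; split.
rewrite ltnNge; apply/negP => le.
have : (d (J j).+1 <= d (J i).+1)%N by apply/dimvS/capvS => //; exact: flagS.
by rewrite (JP i).2 (JP j).2 ltnS leqNgt ij.
Qed.

End Frames.

(** * Charts of the Grassmannian *)

Section Transport.
Variables (R : realType) (X Y : topologicalType) (psi : X -> Y) (cpsi : continuous psi).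
Variables (C : set X) (V : set Y).
Hypothesis lift_psi : forall n (s : singular R n Y), carried V s ->
  exists2 s' : singular R n X, carried C s' & smap cpsi s' = s.
Hypothesis inj_psi : forall x y, C x -> C y -> psi x = psi y -> x = y.
Variable A : pzRingType.

(** Inverse of [pull] along a chart: a simplex in the image is evaluated at its lift, which
    injectivity makes unique, and all others get 0. Lifting simplices takes the place of a
    homeomorphism onto the image. *)
Definition push (f : cochain R X A) : cochain R Y A := fun n s =>
  if pselect (exists2 s', carried C s' & smap cpsi s' = s) is left ex
  then f n (s2val (cid2 ex)) else 0.

Lemma push_smap (f : cochain R X A) n (s : singular R n X) :
  carried C s -> push f (smap cpsi s) = f n s.
Proof.
move=> Cs; rewrite /push; case: pselect => [ex|[]]; last by exists s.
case: cid2 => s' Cs' /= e; congr (f n _); apply: singular_eq => x.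
apply: inj_psi => //.
by have := congr1 (fun t : singular R n Y => t x) e.
Qed.

End Transport.

Section TransportGenerates.
Variables (R : realType) (X Y : topologicalType) (psi : X -> Y) (cpsi : continuous psi).
Variables (C : set X) (V : set Y).
Hypothesis lift_psi : forall n (s : singular R n Y), carried V s ->
  exists2 s' : singular R n X, carried C s' & smap cpsi s' = s.
Hypothesis inj_psi : forall x y, C x -> C y -> psi x = psi y -> x = y.
Variables (A : comPzRingType) (P Q : set Y).
Hypotheses (PV : P `<=` V) (QP : Q `<=` P).
Let P' := C `&` psi @^-1` P.
Let Q' := C `&` psi @^-1` Q.

Let lift_in (S : set Y) n (s : singular R n Y) : S `<=` V -> carried S s ->
  exists2 s' : singular R n X, carried (C `&` psi @^-1` S) s' & smap cpsi s' = s.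
Proof.
move=> SV Ss; have [|s' Cs' e] := @lift_psi n s; first by move=> x; exact/SV/Ss.
exists s' => // x; split=> //.
by have := Ss x; rewrite -e.
Qed.

Let cobound_push (g : cochain R X A) n (s : singular R n X) : carried C s ->
  cobound (push cpsi C g) (smap cpsi s) = cobound g s.
Proof.
case: n s => [//|n] s Cs; apply: eq_bigr => j _.
by rewrite face_smap (push_smap cpsi inj_psi) //; exact: carried_face.
Qed.

Let QV : Q `<=` V. Proof. by move=> x /QP/PV. Qed.
Let C' S n (s : singular R n X) : carried (C `&` psi @^-1` S) s -> carried C s.
Proof. by move=> h x; have [] := h x. Qed.

Lemma rel_cocycle_push (g : cochain R X A) : rel_cocycle P' Q' g ->
  rel_cocycle P Q (push cpsi C g).
Proof.
move=> [gQ gP]; split=> n s sP.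
  have [s' Cs' <-] := lift_in QV sP.
  by rewrite (push_smap cpsi inj_psi) ?gQ //; exact: C' Cs'.
have [s' Cs' <-] := lift_in PV sP.
by rewrite cobound_push ?gP //; exact: C' Cs'.
Qed.

Lemma rel_coboundary_of_pull (f : cochain R Y A) : rel_coboundary P' Q' (pull cpsi f) ->
  rel_coboundary P Q f.
Proof.
move=> [g [gQ gP]]; exists (push cpsi C g); split=> n s sP.
  have [s' Cs' <-] := lift_in QV sP.
  by rewrite (push_smap cpsi inj_psi) ?gQ //; exact: C' Cs'.
have [s' Cs' <-] := lift_in PV sP.
by rewrite cobound_push -?gP //; exact: C' Cs'.
Qed.

Lemma generates_of_pull (w : cochain R Y A) :
  generates P' Q' (pull cpsi w) -> generates P Q w.
Proof.
move=> [[wQ wP] ex inj]; split.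
- split=> n s sP.
    by have [s' Cs' <-] := lift_in QV sP; exact: wQ.
  by have [s' Cs' <-] := lift_in PV sP; rewrite -cobound_pull wP.
- move=> v vc; have [|a va] := ex (pull cpsi v).
    by apply: rel_cocycle_pull vc => x [].
  by exists a; exact: rel_coboundary_of_pull va.
- move=> a aw; apply: inj.
  have aw' : rel_coboundary P' Q' (pull cpsi (fun n s => a * w n s)).
    by apply: rel_coboundary_pull aw => x [].
  exact: aw'.
Qed.

Lemma generates_pull (w : cochain R Y A) :
  generates P Q w -> generates P' Q' (pull cpsi w).
Proof.
move=> [wc ex inj]; split.
- by apply: rel_cocycle_pull wc => x [].
- move=> v vc; have [a va] := ex _ (rel_cocycle_push vc); exists a.
  have va' : rel_coboundary P' Q' (pull cpsi (fun n s => push cpsi C v s - a * w n s)).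
    by apply: rel_coboundary_pull va => x [].
  apply: eq_rel_coboundary va' => n s Ps.
  by rewrite /pull (push_smap cpsi inj_psi) //; exact: C' Ps.
- by move=> a aw; apply: inj; exact: (@rel_coboundary_of_pull (fun n s => a * w n s)).
Qed.

End TransportGenerates.

Section MatrixContinuity.
Variables (R : realType) (T : topologicalType).

Lemma det_continuous_at n (F : T -> 'M[R]_n) x :
  (forall i j, {for x, continuous (fun y => F y i j)}) ->
  {for x, continuous (fun y => \det (F y))}.
Proof.
move=> Fc; apply: sum_continuous_at => s _; apply: continuousM.
  exact: cst_continuous.
by apply: prod_continuous_at => i _; exact: Fc.
Qed.

Lemma adj_continuous_at n (F : T -> 'M[R]_n) x i j :
  (forall i j, {for x, continuous (fun y => F y i j)}) ->
  {for x, continuous (fun y => (\adj (F y)) i j)}.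
Proof.
move=> Fc; apply: (@eq_continuous_at _ _ (fun y => cofactor (F y) j i)).
  by move=> y; rewrite mxE.
apply: continuousM; first exact: cst_continuous.
apply: det_continuous_at => k l.
by apply: (@eq_continuous_at _ _ (fun y => F y (lift j k) (lift i l))) => // y; rewrite !mxE.
Qed.

End MatrixContinuity.

(** * Affine charts by normalized matrices *)

Section Charts.
Variables (R : realType) (N K : nat) (J : 'I_K -> 'I_N).
Hypothesis Jinc : forall i j : 'I_K, (i < j)%N -> (J i < J j)%N.
Local Notation M := 'M[R]_(K, N).
Local Notation I := ('I_K * 'I_N)%type.
Implicit Types (B : M) (U : Gr R N K).

(** The affine chart is a box in the space of all matrices: the columns [J] form the identity and
    the other entries are free. All charts thus share one ambient space, to which [thom_class]
    applies. *)
Definition chartkind (jc : I) : kind R :=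
  if [exists i, J i == jc.2] then Fix (jc.2 == J jc.1)%:R else Full R.

Lemma J_inj : injective J.
Proof.
move=> i j e; apply/val_inj; case: (ltngtP i j) => // /Jinc; rewrite e ltnn //.
Qed.

Lemma normalized_boxret B : normalized J (boxret chartkind B).
Proof.
move=> j k; rewrite mxE /chartkind /=.
have -> : [exists i, J i == J k] by apply/existsP; exists k.
by rewrite (inj_eq J_inj) eq_sym.
Qed.

Lemma normalizedP B : normalized J B <-> box chartkind B.
Proof.
split=> [nB [j c]|bB j k]; last first.
  have := bB (j, J k); rewrite /chartkind /=.
  have -> : [exists i, J i == J k] by apply/existsP; exists k.
  by move=> ->; rewrite (inj_eq J_inj) eq_sym.
rewrite /chartkind /=; case: existsP => //= -[i /eqP <-].
by rewrite nB (inj_eq J_inj) eq_sym.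
Qed.

Lemma boxret_id B : normalized J B -> boxret chartkind B = B.
Proof.
move=> /normalizedP nB; apply/matrixP => j c; rewrite mxE.
by have := nB (j, c); rewrite /chartkind /=; case: ifP => //= _ ->.
Qed.

(** Total on matrices, the columns [J] being overwritten first. *)
Definition chart B : Gr R N K :=
  span_frame (exist (fun y => y \in @frames R N K) (boxret chartkind B)
    (mem_set (normalized_frames (normalized_boxret B)))).

Lemma val_chart B : val (chart B) = <<rows (boxret chartkind B)>>%VS.
Proof. by []. Qed.

Lemma chart_continuous : continuous chart.
Proof.
have cspan : continuous (@span_frame R N K) by apply/continuousP => A.
move=> B; apply: (@continuous_comp _ _ _ _ (@span_frame R N K)); last exact: cspan.
apply: continuous_comp_initial.
exact: boxret_continuous.
Qed.

Definition chartset : set (Gr R N K) := range chart.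

Lemma chart_inj B B' : box chartkind B -> box chartkind B' -> chart B = chart B' -> B = B'.
Proof.
move=> /normalizedP nB /normalizedP nB' e.
rewrite -(boxret_id nB) -(boxret_id nB').
apply: (@normalized_inj R N K J (chart B)).
- exact: val_chart.
- by rewrite e val_chart.
- exact: normalized_boxret.
- exact: normalized_boxret.
Qed.

Lemma chartsetP U (B : M) : val U = <<rows B>>%VS ->
  chartset U <-> colsub J B \in unitmx.
Proof.
move=> UB; split=> [[B' _ e]|uB].
  have nB' := normalized_boxret B'; set B1 := boxret _ _ in nB'.
  have rB1 j : exists u, row j B1 = u *m B.
    apply/mem_span_rows; rewrite -UB -e val_chart -/B1; apply/mem_span_rows.
    by exists (delta_mx 0 j); rewrite -rowE.
  pose T := \matrix_(j < K) sval (cid (rB1 j)).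
  have B1T : B1 = T *m B.
    by apply/row_matrixP => j; rewrite row_mul rowK; exact: svalP (cid (rB1 j)).
  have /mulmx1_unit[] // : T *m colsub J B = 1%:M.
  apply/matrixP => j k; rewrite [RHS]mxE -(nB' j k) B1T !mxE.
  by apply: eq_bigr => i _; rewrite !mxE.
have [UB' nB'] := pivoted_normalize UB uB.
exists (invmx (colsub J B) *m B) => //; apply/val_inj.
by rewrite val_chart boxret_id // -UB'.
Qed.

Definition coord U : M := xget 0 [set B | box chartkind B /\ chart B = U].

Lemma coordP U : chartset U -> box chartkind (coord U) /\ chart (coord U) = U.
Proof.
move=> [B _ e]; apply: (@xgetPex _ 0 [set B | box chartkind B /\ chart B = U]).
exists (boxret chartkind B); split.
  exact/normalizedP/normalized_boxret.
by apply/val_inj; rewrite val_chart boxret_id -?e //; exact: normalized_boxret.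
Qed.

(** The inverse is written with the adjugate and the determinant, so that continuity can be checked
    entry by entry. *)
Lemma coordE U (B : M) : val U = <<rows B>>%VS -> colsub J B \in unitmx ->
  coord U = (\det (colsub J B))^-1 *: (\adj (colsub J B) *m B).
Proof.
move=> UB uB; have cU : chartset U by apply/chartsetP; eassumption.
have [/normalizedP nC eC] := coordP cU.
have [UB' nB'] := pivoted_normalize UB uB.
rewrite scalemxAl -[X in X *m _](_ : invmx (colsub J B) = _); last by rewrite /invmx uB.
apply: (@normalized_inj R N K J U) => //.
by rewrite -{1}eC val_chart boxret_id.
Qed.

Let coord_formula (B : M) : M := (\det (colsub J B))^-1 *: (\adj (colsub J B) *m B).

Let open_coord_preimage (O : set M) : open O ->
  open [set U | chartset U /\ O (coord U)].
Proof.
move=> Oo.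
(* By the quotient topology, openness is tested on frames, where the condition becomes [D]. *)
pose D : set M := [set B | \det (colsub J B) != 0 /\ O (coord_formula B)].
have entry (x : M) i j : {for x, continuous (fun y : M => colsub J y i j)}.
  apply: (@eq_continuous_at _ _ (fun y : M => y i (J j))).
    by move=> y; rewrite !mxE.
  exact: coord_continuous.
have dc (x : M) : {for x, continuous (fun y : M => \det (colsub J y))}.
  exact: det_continuous_at (entry x).
have Do : open D.
  rewrite openE => B [dB OB]; rewrite /interior /D /=.
  have n1 : \forall y \near B, \det (colsub J y) != 0.
    have o1 : nbhs (\det (colsub J B)) [set z : R | z != 0].
      by apply: open_nbhs_nbhs; split=> //; exact: open_neq.
    exact: (dc B _ o1).
  have n2 : \forall y \near B, O (coord_formula y).
    have o2 : nbhs (coord_formula B) O by exact: open_nbhs_nbhs.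
    suff cc : {for B, continuous coord_formula} by exact: (cc _ o2).
    apply: matrix_continuous_at => i j.
    apply: (@eq_continuous_at _ _ (fun y : M => (\det (colsub J y))^-1 *
      \sum_k (\adj (colsub J y)) i k * y k j)).
      by move=> y; rewrite !mxE.
    apply: continuousM; first by apply: continuousV => //; exact: dc.
    apply: sum_continuous_at => k _; apply: continuousM.
      exact: adj_continuous_at (entry B).
    exact: coord_continuous.
  by apply: filterS2 n1 n2 => y.
have : open ((@set_val _ (@frames R N K)) @^-1` D) by exists D.
rewrite -[X in _ -> X]/(open (@span_frame R N K @^-1` _)).
congr (open _); apply/seteqP; split=> F /=.
  move=> [dF OF]; have uF : colsub J (val F) \in unitmx by rewrite unitmxE unitfE.
  have e : val (span_frame F) = <<rows (val F)>>%VS by [].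
  by split; [apply/(chartsetP e)|rewrite (coordE e)].
have e : val (span_frame F) = <<rows (val F)>>%VS by [].
move=> [/(chartsetP e) uF]; rewrite (coordE e uF) => OF.
by split=> //; rewrite -unitfE -unitmxE.
Qed.

Lemma open_chartset : open chartset.
Proof.
rewrite (_ : chartset = [set U | chartset U /\ setT (coord U)]).
  exact/open_coord_preimage/openT.
by apply/seteqP; split=> [x ?|x []].
Qed.

Lemma coord_continuous_at U : chartset U -> {for U, continuous coord}.
Proof.
move=> cU W; rewrite nbhsE => [[D [Do DU] sD]].
apply: (filterS (P := [set U | chartset U /\ D (coord U)])).
  by move=> V [_ /sD].
by apply: open_nbhs_nbhs; split=> //; exact: open_coord_preimage.
Qed.

Lemma chart_lift n (s : singular R n (Gr R N K)) : carried chartset s ->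
  exists2 s' : singular R n M, carried (box chartkind) s' &
    smap chart_continuous s' = s.
Proof.
move=> cs.
have cc : continuous (coord \o s).
  move=> x; apply: continuous_comp; first exact: singular_continuous.
  exact: coord_continuous_at.
exists (Singular cc) => [x|].
  exact: (coordP (cs x)).1.
by apply: singular_eq => x /=; exact: (coordP (cs x)).2.
Qed.

(** The coordinates whose vanishing cuts out the cell of [J] in its own chart: entries beyond the
    pivot of their row, outside the pivot columns. *)
Definition normals : {set I} :=
  [set jc : I | (J jc.1 < jc.2)%N && ~~ [exists i, J i == jc.2]].

Lemma chartkind_normals i : i \in normals -> chartkind i = Full R.
Proof. by rewrite inE /chartkind => /andP[_ /negPf ->]. Qed.

Lemma chart_incell B : incell J (chart B) <-> ~ offzero normals B.
Proof.
have Jlt j k : (J k < J j)%N -> (J j == J k) = false.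
  by move=> lt; apply/eqP => e; rewrite e ltnn in lt.
split=> [cB [[j c] jc /=]|nB].
  have := chart_cell_eq0 (val_chart B) (normalized_boxret B) cB Jinc (j := j) (c := c).
  have := jc; rewrite inE /= => /andP[lt _] /(_ lt).
  by rewrite mxE (chartkind_normals jc) /= => ->; rewrite eqxx.
apply: (pivoted_cell Jinc (val_chart B)) => j; split=> [|c Jc].
  by rewrite normalized_boxret eqxx oner_neq0.
rewrite mxE /chartkind /=; case: existsP => [[i /eqP e]|nex] /=.
  by case: eqP => // e'; rewrite e' ltnn in Jc.
apply/eqP; apply: contrapT => /negP BN; apply: nB; exists (j, c) => //.
by rewrite inE Jc; apply/existsP.
Qed.

(** If the entry at [(j0, c0)] is nonzero it becomes the pivot of row [j0], and the other normal
    coordinates still have to vanish. The neighbouring cell thus appears as two halves, one for each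
    sign of this entry. *)
Lemma chart_incell_up (J' : 'I_K -> 'I_N) (j0 : 'I_K) (c0 : 'I_N) B :
  (forall i j : 'I_K, (i < j)%N -> (J' i < J' j)%N) ->
  c0 = (J j0).+1 :> nat -> (forall j, J' j = if j == j0 then c0 else J j) ->
  incell J' (chart B) <-> ~ offzero (normals :\ (j0, c0)) B /\ B j0 c0 != 0.
Proof.
move=> J'inc c0E J'E.
have c0J i : J i != c0.
  apply/eqP => e.
  have ij : i != j0.
    by apply/eqP => h; have := congr1 val e; rewrite /= h c0E; lia.
  case: (ltngtP i j0) => [/Jinc|/J'inc|/val_inj/eqP]; last by rewrite (negPf ij).
    by rewrite e c0E; lia.
  by rewrite !J'E eqxx (negPf ij) e ltnn.
have c0ex : [exists i, J i == c0] = false.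
  by apply/existsP => -[i]; rewrite (negPf (c0J i)).
have n0 : (j0, c0) \in normals by rewrite inE /= c0ex c0E ltnSn.
have leJ j : (J j <= J' j)%N by rewrite J'E; case: eqP => // ->; rewrite c0E.
split=> [cB|[nB B0]].
  have eq0 : ~ offzero (normals :\ (j0, c0)) B.
    move=> [[j c]]; rewrite in_setD1 => /andP[ne jc] /=.
    have := jc; rewrite inE /= => /andP[lt cJ].
    suff : boxret chartkind B j c = 0.
      by rewrite mxE (chartkind_normals jc) /= => ->; rewrite eqxx.
    apply: (chart_cell_eq0 (val_chart B) (normalized_boxret B) cB) => [i k ik|].
      rewrite J'E; case: (i =P j0) => [e|_]; last exact: Jinc.
      have := Jinc ik; rewrite e => h; rewrite c0E ltn_neqAle h andbT.
      by have := c0J k; apply: contra => /eqP e'; apply/eqP/val_inj; rewrite /= -e' -c0E.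
    rewrite J'E; case: (j =P j0) => [e|//]; move: ne lt; rewrite e => ne lt.
    rewrite c0E ltn_neqAle lt andbT; apply: contra ne => /eqP h.
    by rewrite (_ : c = c0) //; apply/val_inj; rewrite /= -h c0E.
  split=> //; apply/eqP => B0.
  have : incell J (chart B).
    apply/chart_incell => -[i iN Bi]; apply: eq0; exists i => //.
    by rewrite in_setD1 iN andbT; apply: contra Bi => /eqP ->; rewrite /= B0.
  by move=> /(incell_inj cB) /(_ j0); rewrite J'E eqxx => e; have := c0J j0; rewrite e eqxx.
apply: (pivoted_cell J'inc (val_chart B)) => j; split=> [|c Jc].
  rewrite J'E; case: (j =P j0) => [->|_]; last by rewrite normalized_boxret eqxx oner_neq0.
  by rewrite mxE (chartkind_normals n0).
have Jc' := leq_ltn_trans (leJ j) Jc.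
rewrite mxE /chartkind /=; case: existsP => [[i /eqP e]|nex] /=.
  by case: eqP => // e'; rewrite e' ltnn in Jc'.
apply/eqP; apply: contrapT => /negP BN; apply: nB; exists (j, c) => //.
rewrite in_setD1 inE /= Jc' /=; apply/andP; split; last exact/existsP.
by apply/eqP => -[e1 e2]; move: Jc; rewrite J'E e1 eqxx e2 ltnn.
Qed.

End Charts.

(** * Pivots of a Young diagram *)

Section YoungPivots.
Variables (N K : nat) (hK : (K <= N)%N).
Local Notation Y := (young K (N - K)).
Implicit Types (l m : Y) (j : 'I_K).

Definition part l (j : nat) := nth 0%N (parts l) j.

Lemma size_parts l : size (parts l) = K.
Proof. by rewrite size_map size_tuple. Qed.

Lemma part_le l j : (part l j <= N - K)%N.
Proof.
have jK : (j < size (val l))%N by rewrite size_tuple.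
rewrite /part /parts (nth_map ord0) // -ltnS.
exact: ltn_ord.
Qed.

Lemma part_anti l i j : (i <= j)%N -> (j < K)%N -> (part l j <= part l i)%N.
Proof.
have := valP l; rewrite -/(parts l) => srt ij jK.
have tr : transitive geq by move=> a b c /= ba ac; exact: leq_trans ac ba.
have rf : reflexive geq by move=> a /=.
by apply: (sorted_leq_nth tr rf 0%N srt) => //; rewrite inE size_parts; lia.
Qed.

Fact pv_subproof l j : (N - K + j - part l j < N)%N.
Proof. by have := ltn_ord j; lia. Qed.

Definition pv l j : 'I_N := Ordinal (pv_subproof l j).

Lemma pvE l j : (pv l j + part l j)%N = (N - K + j)%N.
Proof. by rewrite /=; have := part_le l j; lia. Qed.

Lemma pv_inc l (i j : 'I_K) : (i < j)%N -> (pv l i < pv l j)%N.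
Proof.
move=> ij; have := part_anti l (ltnW ij) (ltn_ord j).
by have := pvE l i; have := pvE l j; lia.
Qed.

Lemma jumpE l j : jump l j = (pv l j).+1.
Proof. by rewrite /jump /= -/(part l j) addnS subSn //; have := part_le l j; lia. Qed.

Lemma pv_eq l m : pv l =1 pv m -> l = m.
Proof.
move=> e; apply/val_inj/val_inj; apply: (inj_map val_inj).
apply: (@eq_from_nth _ 0%N); first by rewrite !size_map !size_tuple.
move=> j; rewrite size_map size_tuple => jK.
have e' := congr1 (@nat_of_ord N) (e (Ordinal jK)).
rewrite -[LHS]/(part l (Ordinal jK)) -[RHS]/(part m (Ordinal jK)).
by have := pvE l (Ordinal jK); have := pvE m (Ordinal jK); lia.
Qed.

Lemma inc_ge (J : 'I_K -> 'I_N) : (forall i j : 'I_K, (i < j)%N -> (J i < J j)%N) ->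
  forall j, (j <= J j)%N /\ (J j <= N - K + j)%N.
Proof.
move=> Jinc j; split.
  have [n] := ubnP (val j); elim: n j => // n IH [[|j] jK] //= jn.
  have j'K : (j < K)%N by apply: ltnW.
  apply: leq_ltn_trans (IH (Ordinal j'K) _) (Jinc (Ordinal j'K) _ _) => //=.
have [n] := ubnP (K - j); elim: n j => // n IH j jn.
case: (ltnP j.+1 K) => [j'K|Kj].
  have h1 : (K - j.+1 < n)%N by lia.
  have /= := IH (Ordinal j'K) h1.
  by have /= := Jinc j (Ordinal j'K) (ltnSn j); lia.
by have := ltn_ord (J j); have := ltn_ord j; lia.
Qed.

Lemma pv_exists (J : 'I_K -> 'I_N) : (forall i j : 'I_K, (i < j)%N -> (J i < J j)%N) ->
  exists l, pv l =1 J.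
Proof.
move=> Jinc; have Jb := inc_ge Jinc.
have lt j : (N - K + j - J j < (N - K).+1)%N by have [] := Jb j; lia.
pose t := [tuple Ordinal (lt j) | j < K].
have nthE (j : nat) (jK : (j < K)%N) :
    nth 0%N [seq val x | x <- t] j = (N - K + j - J (Ordinal jK))%N.
  rewrite (nth_map ord0) ?size_tuple ?card_ord //.
  by have := tnth_mktuple (fun j => Ordinal (lt j)) (Ordinal jK);
    rewrite (tnth_nth ord0) /= => ->.
have srt : sorted geq [seq val x | x <- t].
  apply/(sortedP 0%N) => i; rewrite size_map size_tuple ?card_ord => iK.
  have i'K : (i < K)%N by exact: ltnW.
  rewrite (nthE _ iK) (nthE _ i'K) /=.
  have := Jinc (Ordinal i'K) (Ordinal iK) (ltnSn i).
  have [] := Jb (Ordinal i'K); have [] := Jb (Ordinal iK) => /=; lia.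
exists (exist _ t srt) => j; apply/val_inj => /=.
rewrite /part /parts /= (nthE _ (ltn_ord j)).
rewrite (_ : Ordinal _ = j); last exact/val_inj.
by have [] := Jb j; lia.
Qed.

Lemma codimE l : codim l = \sum_(j < K) part l j.
Proof.
rewrite /codim sumnE (big_nth 0%N) size_parts big_mkord.
by apply: eq_bigr.
Qed.

(** There are N - 1 - J j columns to the right of the pivot, and the K - 1 - j later pivots are
    taken away. *)
Lemma card_normals_row (J : 'I_K -> 'I_N) : (forall i j : 'I_K, (i < j)%N -> (J i < J j)%N) ->
  forall j, #|[set c : 'I_N | (J j < c)%N && ~~ [exists i, J i == c]]%SET| = (N - K + j - J j)%N.
Proof.
move=> Jinc j; have Jinj := J_inj Jinc.
pose A := [set c : 'I_N | (J j < c)%N]%SET.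
pose B := [set J k | k in [set k : 'I_K | (j < k)%N]%SET]%SET.
have Jlt i k : (J i < J k)%N = (i < k)%N.
  case: (ltnP i k) => [/Jinc //|]; rewrite leq_eqVlt => /orP[/eqP/val_inj ->|/Jinc ki].
    by rewrite ltnn.
  by apply/negbTE; rewrite -leqNgt ltnW.
have -> : [set c : 'I_N | (J j < c)%N && ~~ [exists i, J i == c]]%SET = A :\: B.
  apply/setP => c; rewrite !inE andbC; case: (ltnP (J j) c) => // jc; rewrite ?andbF // !andbT.
  congr (~~ _); apply/existsP/imsetP => [[i /eqP e]|[k _ ->]]; last by exists k.
  by exists i => //; rewrite inE -Jlt e.
have card_gt n (a : 'I_n) : #|[set c : 'I_n | (a < c)%N]%SET| = (n - a.+1)%N.
  rewrite -sum1_card; under eq_bigl do rewrite inE.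
  rewrite -(big_mkord (fun c => (a < c)%N) (fun=> 1%N)).
  rewrite (big_cat_nat (n := a.+1)) //= ?ltn_ord // big_nat_cond big1 ?add0n.
    rewrite big_nat_cond (eq_bigl (fun c => (a < c < n)%N)); last by move=> c; lia.
    by rewrite -big_nat sum_nat_const_nat muln1.
  by move=> c; lia.
rewrite cardsD (finset.setIidPr _).
  rewrite card_imset // !card_gt; have := ltn_ord j; have [] := inc_ge Jinc j; lia.
by apply/fintype.subsetP => c /imsetP[k]; rewrite !inE => jk ->; rewrite Jlt.
Qed.

Lemma card_normals l : #|normals (pv l)| = codim l.
Proof.
rewrite codimE -sum1_card.
rewrite (eq_bigl (fun jc : 'I_K * 'I_N => true && ((pv l jc.1 < jc.2)%N && ~~ [exists i, pv l i == jc.2]))); last first.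
  by move=> jc; rewrite inE.
rewrite -(pair_big_dep xpredT (fun (j : 'I_K) (c : 'I_N) => (pv l j < c)%N && ~~ [exists i, pv l i == c])
  (fun _ _ => 1%N)) /=; apply: eq_bigr => j _.
have := card_normals_row (@pv_inc l) j; rewrite -sum1_card.
under eq_bigl do rewrite inE.
by move=> ->; have := pvE l j; lia.
Qed.

Lemma codim_pv_le l m : (forall j, pv l j <= pv m j)%N -> (codim m <= codim l)%N.
Proof.
move=> le; rewrite !codimE; apply: leq_sum => j _.
by have := le j; have := pvE l j; have := pvE m j; lia.
Qed.

Lemma codim_pv_lt l m : (forall j, pv l j <= pv m j)%N -> m != l -> (codim m < codim l)%N.
Proof.
move=> le ml; rewrite ltn_neqAle codim_pv_le // andbT; apply: contra ml => /eqP e.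
apply/eqP/pv_eq => j; apply/ord_inj; move: e; rewrite !codimE => e.
have le' (i : 'I_K) : (part m i <= part l i)%N.
  by have := le i; have := pvE l i; have := pvE m i; lia.
have : part m j = part l j.
  apply/eqP; rewrite eqn_leq le' /= leqNgt; apply/negP => lt.
  have : (\sum_(i < K) part m i < \sum_(i < K) part l i)%N.
    rewrite (bigD1 j) //= [X in (_ < X)%N](bigD1 j) //= -addSn.
    by apply: leq_add => //; apply: leq_sum => i _; exact: le'.
  by rewrite e ltnn.
by have := pvE l j; have := pvE m j; lia.
Qed.

End YoungPivots.

(** * Schubert cells *)

Section GrassmannFlip.
Variables (R : realType) (N K : nat) (c : 'I_N).
Local Notation M := 'M[R]_(K, N).

Definition colflip (B : M) : M := \matrix_(i, j) (if j == c then - B i j else B i j).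

Lemma colflipE n (u : 'M[R]_(n, K)) (B : M) i j :
  (u *m colflip B) i j = if j == c then - (u *m B) i j else (u *m B) i j.
Proof.
rewrite !mxE; case: (j =P c) => [->|/eqP jc].
  by rewrite -sumrN; apply: eq_bigr => k _; rewrite mxE eqxx mulrN.
by apply: eq_bigr => k _; rewrite mxE (negPf jc).
Qed.

Lemma colflip_frames (B : M) : frames B -> frames (colflip B).
Proof.
move=> /frames_inj fB; apply/frames_inj => u uB; apply: fB; apply/rowP => j.
have h := colflipE u B 0 j; rewrite uB [LHS]mxE in h; rewrite [RHS]mxE.
by move: h; case: (j == c) => // /eqP; rewrite eq_sym oppr_eq0 => /eqP.
Qed.

Definition colflip_frame (B : set_type (@frames R N K)) : set_type (@frames R N K) :=
  exist (fun y => y \in @frames R N K) (colflip (val B))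
    (mem_set (colflip_frames (set_valP B))).

Lemma colflip_continuous : continuous colflip.
Proof.
move=> x; apply: matrix_continuous_at => i j.
apply: (@eq_continuous_at _ _ (fun y : M => if j == c then - y i j else y i j)).
  by move=> y; rewrite mxE.
case: (j == c); last exact: coord_continuous.
apply: (@continuous_comp _ _ _ (fun y : M => y i j) -%R); first exact: coord_continuous.
exact: opp_continuous.
Qed.

Lemma span_frame_surj (U : Gr R N K) : exists F, @span_frame R N K F = U.
Proof.
have [J [Jinc cU]] := exists_incell U.
have [B [UB pB]] := cell_pivoted Jinc cU.
exists (exist (fun y => y \in @frames R N K) B (mem_set (frames_of_span UB))).
by apply/val_inj; rewrite /= -UB.
Qed.

Lemma colflip_span (B B' : M) : <<rows B>>%VS = <<rows B'>>%VS ->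
  <<rows (colflip B)>>%VS = <<rows (colflip B')>>%VS.
Proof.
move=> e; have sub (B1 B2 : M) : <<rows B1>>%VS = <<rows B2>>%VS ->
    (<<rows (colflip B1)>> <= <<rows (colflip B2)>>)%VS.
  move=> e12; apply/subvP => v /mem_span_rows [u ->]; apply/mem_span_rows.
  have /mem_span_rows [u' e'] : u *m B1 \in <<rows B2>>%VS.
    by rewrite -e12; apply/mem_span_rows; exists u.
  by exists u'; apply/rowP => j; rewrite !colflipE e'.
by apply/eqP; rewrite eqEsubv !sub.
Qed.

(** Reflection of the ambient space in the coordinate [c]. The frame is an arbitrary choice;
    [grflipE] shows that any other gives the same plane. *)
Definition grflip (U : Gr R N K) : Gr R N K :=
  span_frame (colflip_frame (sval (cid (span_frame_surj U)))).

Lemma grflipE (U : Gr R N K) (B : M) : val U = <<rows B>>%VS ->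
  val (grflip U) = <<rows (colflip B)>>%VS.
Proof.
move=> UB; apply: colflip_span; rewrite -UB.
by have := svalP (cid (span_frame_surj U)); set F := sval _ => {1}<-.
Qed.

Lemma grflip_continuous : continuous grflip.
Proof.
apply/continuousP => A Ao.
have cspan : continuous (@span_frame R N K) by apply/continuousP => D.
have cflip : continuous colflip_frame.
  apply: continuous_comp_initial => F.
  apply: (@continuous_comp _ _ _ set_val colflip); first exact: initial_continuous.
  exact: colflip_continuous.
suff : open (@span_frame R N K @^-1` (grflip @^-1` A)) by [].
have -> : @span_frame R N K @^-1` (grflip @^-1` A) =
    colflip_frame @^-1` (@span_frame R N K @^-1` A).
  have e F : grflip (span_frame F) = span_frame (colflip_frame F).
    by apply/val_inj; rewrite (grflipE (B := val F)).
  by apply/seteqP; split=> F /=; rewrite e.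
apply: open_comp; first by move=> F _; exact: cflip.
by apply: open_comp => // F _; exact: cspan.
Qed.

Section FlipChart.
Variable J : 'I_K -> 'I_N.
Hypothesis Jinc : forall i j : 'I_K, (i < j)%N -> (J i < J j)%N.

(** Reflecting column [c] spoils the normalization of the row with pivot [c], which is then
    multiplied by -1. So a sign changes when exactly one of the column of the entry and the pivot of
    its row is [c]. *)
Definition flipset : {set 'I_K * 'I_N} := [set jc | (J jc.1 == c) (+) (jc.2 == c)]%SET.

Lemma boxret_flip (B : M) :
  boxret (chartkind R J) (flip flipset B) =
  \matrix_(i, j) ((-1) ^+ (J i == c) * colflip (boxret (chartkind R J) B) i j).
Proof.
apply/matrixP => i j; rewrite !mxE inE /=.
rewrite {1 2 3}/chartkind /=; case: existsP => [[k /eqP <-]|nex] /=.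
  rewrite (inj_eq (J_inj Jinc)); case: (k =P i) => [->|_]; last first.
    by case: ifP; rewrite ?oppr0 ?mulr0.
  by case: (J i == c); rewrite ?expr1 ?mulrN1 ?opprK ?mul1r.
by case: (J i == c); case: (j == c); rewrite /= ?expr1 ?expr0 ?mulN1r ?mul1r ?opprK.
Qed.

Lemma grflip_chart (B : M) : grflip (chart Jinc B) = chart Jinc (flip flipset B).
Proof.
apply/val_inj; rewrite (grflipE (val_chart Jinc B)) val_chart boxret_flip.
set B1 := colflip _; pose sg i : R := (-1) ^+ (J i == c).
have sgK i : sg i * sg i = 1 by rewrite /sg -expr2 sqrr_sign.
apply/eqP; rewrite eqEsubv; apply/andP; split; apply/subvP => v /mem_span_rows [u ->];
  apply/mem_span_rows; exists (\row_i (u 0 i * sg i)); apply/rowP => j;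
  rewrite !mxE; apply: eq_bigr => i _; rewrite !mxE.
  by rewrite -/(sg i) mulrA -[u 0 i * _ * _]mulrA sgK mulr1.
by rewrite -/(sg i) mulrA.
Qed.

Lemma flip_box : box (chartkind R J) `<=` flip flipset @^-1` box (chartkind R J).
Proof.
move=> B kB i; rewrite flipE; have := kB i; rewrite /chartkind.
case: ifP => [/existsP[k /eqP e]|_] //=; rewrite inE -e (inj_eq (J_inj Jinc)) => ->.
case: (k =P i.1) => [->|_]; first by rewrite addbb.
by rewrite oppr0; case: ifP.
Qed.

End FlipChart.
End GrassmannFlip.

(** * Cells, the charts around them and their Thom classes *)

Section Cells.
Variables (R : realType) (N K : nat) (hK : (K <= N)%N).
Local Notation Y := (young K (N - K)).
Local Notation G := (Gr R N K).
Implicit Types (l m : Y).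
Local Notation cell := (@schubert_cell R N K).
Local Notation pv := (pv hK).
Local Notation pv_inc l := (@pv_inc N K hK l).

Lemma cellP l (U : G) : cell l U <-> incell (pv l) U.
Proof. by split=> cU j; have := cU j; rewrite (jumpE hK). Qed.

Lemma cell_inj l m (U : G) : cell l U -> cell m U -> l = m.
Proof. by move=> /cellP cl /cellP /(incell_inj cl) /pv_eq. Qed.

Lemma cell_cover (U : G) : exists l, cell l U.
Proof.
have [J [Jinc cU]] := exists_incell U; have [l lJ] := pv_exists hK Jinc.
by exists l; apply/cellP => j; rewrite !lJ.
Qed.

Definition cellchart l : 'M[R]_(K, N) -> G := chart (pv_inc l).
Definition cellopen l : set G := chartset (pv_inc l).

Lemma cellchart_continuous l : continuous (@cellchart l).
Proof. exact: chart_continuous. Qed.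

Lemma open_cellopen l : open (@cellopen l).
Proof. exact: open_chartset. Qed.

Lemma cell_cellopen l : cell l `<=` cellopen l.
Proof.
move=> U /cellP cU; have [B [UB pB]] := cell_pivoted (pv_inc l) cU.
by apply/(chartsetP _ UB); exact: pivoted_unitmx (pv_inc l) _ pB.
Qed.

Lemma cellopen_cell l m (U : G) : cellopen l U -> cell m U ->
  forall j, (pv l j <= pv m j)%N.
Proof.
move=> [B _ <-] /cellP cU; apply: (chart_cell_le (pv_inc l) (val_chart (pv_inc l) B)) cU.
exact: (normalized_boxret (pv_inc l)) .
Qed.

Lemma cellopen_codim l m (U : G) : cellopen l U -> cell m U -> m != l ->
  (codim m < codim l)%N.
Proof. by move=> lU mU; apply: (codim_pv_lt (hK := hK)); exact: cellopen_cell lU mU. Qed.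

Lemma cellchart_cell l B : cell l (cellchart l B) <-> ~ offzero (normals (pv l)) B.
Proof. by rewrite cellP; exact: chart_incell. Qed.

Definition union (S : pred Y) : set G := [set U | exists2 l, S l & cell l U].

Lemma stratum_ltE i : @stratum_lt R N K i = union (fun l => (codim l < i)%N).
Proof. by []. Qed.

(** Within the largest codimension any set of cells is allowed, so that cells can be added one at a
    time while the union stays open. *)
Definition lower (S : pred Y) := forall l m, S l -> (codim m < codim l)%N -> S m.

Lemma open_union (S : pred Y) : lower S -> open (union S).
Proof.
move=> Sl; have -> : union S = \bigcup_(l in [set l | S l]) cellopen l.
  apply/seteqP; split=> [U [l Sl' lU]|U [l Sl' lU]]; first by exists l => //; exact: cell_cellopen.
  have [m mU] := cell_cover U; exists m => //.
  by case: (eqVneq m l) => [->//|ml]; apply: (Sl l) => //; exact: cellopen_codim lU mU ml.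
by apply: bigcup_open => l _; exact: open_cellopen.
Qed.

Definition punctured l : set G := cellopen l `&` ~` cell l.

Lemma lower_add (S : pred Y) l : (forall m, (codim m < codim l)%N -> S m) -> ~~ S l ->
  union (fun m => (m == l) || S m) = cellopen l `|` union S /\
  cellopen l `&` union S = punctured l.
Proof.
move=> Sl nSl; split; apply/seteqP; split=> U.
- move=> [m /orP[/eqP ->|Sm] mU]; first by left; exact: cell_cellopen.
  by right; exists m.
- move=> [lU|[m Sm mU]]; last by exists m => //; rewrite Sm orbT.
  have [m mU] := cell_cover U; exists m => //; case: (eqVneq m l) => //= ml.
  by apply: Sl; exact: cellopen_codim lU mU ml.
- move=> [lU [m Sm mU]]; split=> // /(cell_inj mU) e; by rewrite -e Sm in nSl.
- move=> [lU nl]; split=> //; have [m mU] := cell_cover U; exists m => //.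
  apply: Sl; apply: (cellopen_codim lU mU).
  by apply/eqP => e; move: nl; rewrite -e => /(_ mU).
Qed.

Local Notation cellbox l := (box (chartkind R (pv l))).

Lemma cellchart_inj l x y : cellbox l x -> cellbox l y ->
  cellchart l x = cellchart l y -> x = y.
Proof. exact: chart_inj. Qed.

Lemma cellchart_lift l n (s : singular R n G) : carried (cellopen l) s ->
  exists2 s', carried (cellbox l) s' & smap (@cellchart_continuous l) s' = s.
Proof.
move=> /(@chart_lift R N K _ (pv_inc l)) [s' Cs' e]; exists s' => //.
by rewrite -e; exact: singular_eq.
Qed.

Lemma punctured_sub l : punctured l `<=` cellopen l.
Proof. by move=> U []. Qed.

Lemma cellbox_cellopen l : cellbox l `&` cellchart l @^-1` cellopen l = cellbox l.
Proof. by apply/seteqP; split=> [B []//|B CB]; split=> //; exists B. Qed.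

Lemma cellbox_punctured l : cellbox l `&` cellchart l @^-1` punctured l =
  cellbox l `&` offzero (normals (pv l)).
Proof.
apply/seteqP; split=> B [CB]; [move=> [_ nB]|move=> oB]; split=> //.
  by apply: contrapT => no; apply: nB; apply/cellchart_cell.
by split; [exists B|move=> /cellchart_cell].
Qed.

(** Transport of the Thom class of matrices through the chart. There [grflip] acts as [flip], whence
    the sign. *)
Lemma thom_cell l : exists theta : cochain R G int,
  [/\ homogeneous (codim l) theta, zgenerates (cellopen l) (punctured l) theta
    & forall c, rel_coboundary (cellopen l) (punctured l) (fun n s =>
        pull (@grflip_continuous R N K c) theta s -
        (-1) ^+ #|flipset c (pv l) :&: normals (pv l)| * theta n s)].
Proof.
have [w [wh wg wflip]] := thom_class R (normals (pv l)).
have inj := @cellchart_inj l; have lift := @cellchart_lift l.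
have QP := @punctured_sub l.
pose theta := push (@cellchart_continuous l) (cellbox l) w.
have pulltheta n (s : singular R n _) : carried (cellbox l) s ->
    pull (@cellchart_continuous l) theta s = w n s.
  by move=> Cs; rewrite /pull /theta (push_smap _ inj).
exists theta; split.
- move=> n s ni; rewrite /theta /push; case: pselect => // ex.
  by rewrite wh // card_normals.
- move=> A; apply: (generates_of_pull lift inj (fun x => id) QP).
  rewrite cellbox_cellopen cellbox_punctured.
  apply: eq_generates (generates_box (@chartkind_normals R N K (pv l)) (wg A)) => n s sP.
    have Cs : carried (cellbox l) s by move=> x; have [] := sP x.
    rewrite /pull /castc -/(pull (@cellchart_continuous l) theta s) pulltheta //.
    have [[wQ _] _ _] := zgenerates_int wg; rewrite wQ // => x.
    by have [] := sP x.
  by rewrite /pull /castc -/(pull (@cellchart_continuous l) theta s) pulltheta.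
- move=> c; apply: (rel_coboundary_of_pull lift inj (fun x => id) QP).
  rewrite cellbox_cellopen cellbox_punctured; have := wflip (flipset c (pv l)).
  have sT : cellbox l `<=` setT by [].
  have sQ : cellbox l `&` offzero (normals (pv l)) `<=` offzero (normals (pv l)) by move=> x [].
  move=> /(rel_coboundaryS sT sQ); apply: eq_rel_coboundary => n s Cs.
  rewrite [in RHS]/pull -/(pull (@cellchart_continuous l) theta s) pulltheta //; congr (_ - _).
  have Cs' : carried (cellbox l) (smap (@flip_continuous R K N (flipset c (pv l))) s).
    by move=> x; exact: (@flip_box R N K c _ (pv_inc l) (s x) (Cs x)).
  rewrite /pull -(pulltheta _ _ Cs') /pull; congr (theta n _).
  by apply: singular_eq => x /=; rewrite /cellchart grflip_chart.
Qed.

End Cells.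

(** * Cohomology of unions of cells *)

Section CellComplex.
Variables (R : realType) (N K : nat) (hK : (K <= N)%N).
Local Notation Y := (young K (N - K)).
Local Notation G := (Gr R N K).
Implicit Types (l m k : Y) (S T : pred Y).
Local Notation cell := (@schubert_cell R N K).
Local Notation union := (@union R N K).
Local Notation cellopen := (@cellopen R N K hK).
Local Notation punctured := (@punctured R N K hK).

Definition others l : pred Y := [pred m | (codim m <= codim l)%N && (m != l)].

Lemma lower_others l : lower (others l).
Proof.
move=> m k /= /andP[ml _] km; apply/andP; split; first exact: leq_trans (ltnW km) ml.
by apply: contraTneq km => ->; rewrite -leqNgt.
Qed.

Lemma unionS S T : (forall l, S l -> T l) -> union S `<=` union T.
Proof. by move=> ST U [l Sl lU]; exists l => //; exact: ST. Qed.

Variables (theta W : Y -> cochain R G int) (c : Y -> Y -> int).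

Definition thom_family := forall l,
  homogeneous (codim l) (theta l) /\
  zgenerates (cellopen l) (punctured l) (theta l).

(** Vanishing on [others l] makes [W l] a cochain relative to every [lower] family of cells that
    omits [l]. The coboundary equation holds on all simplices, without restriction to a stratum. *)
Definition good l :=
  [/\ homogeneous (codim l) (W l),
      forall n (s : singular R n G), carried (union (others l)) s -> W l s = 0,
      forall n (s : singular R n G), carried (cellopen l) s -> W l s = theta l s,
      forall n (s : singular R n G), cobound (W l) s = \sum_m c l m * W m s
    & forall m, c l m != 0 -> codim m = (codim l).+1].

Section Comparison.
Variable A : comPzRingType.
Hypothesis thetaP : thom_family.
Let WA l : cochain R G A := castc A (W l).
Let cA l m : A := (c l m)%:~R.

Lemma good_cobound l : good l -> forall n (s : singular R n G),
  cobound (WA l) s = \sum_m cA l m * WA m s.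
Proof.
move=> [_ _ _ dW _] n s; rewrite cobound_castc dW rmorph_sum /=.
by apply: eq_bigr => m _; rewrite rmorphM.
Qed.

Lemma good_eq0 l S : good l -> lower S -> ~~ S l ->
  forall n (s : singular R n G), carried (union S) s -> WA l s = 0.
Proof.
move=> [_ W0 _ _ _] Sl nSl n s sS; rewrite /WA /castc W0 // => x.
apply: (unionS _ (sS x)) => m Sm /=; apply/andP; split; last first.
  by apply: contraTneq Sm => ->.
by rewrite leqNgt; apply/negP => lm; case/negP: nSl; exact: Sl Sm lm.
Qed.

Lemma good_lower_coef l m S : good l -> lower S -> ~~ S l -> S m -> c l m = 0.
Proof.
move=> [_ _ _ _ cd] Sl nSl Sm; apply/eqP; apply: contraNT nSl => /cd e.
by apply: Sl Sm _; rewrite e.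
Qed.

Lemma good_coef_diag l m : good l -> (codim m <= codim l)%N -> c l m = 0.
Proof.
move=> [_ _ _ _ cd] ml; apply/eqP; apply: contraLR ml => /cd ->.
by rewrite -ltnNge.
Qed.

Lemma good_cobound_restrict l S T : good l -> (forall k, ~~ S k -> good k) ->
  lower S -> lower T -> ~~ S l ->
  forall n (s : singular R n G), carried (union T) s ->
  cobound (WA l) s = \sum_(m | T m && ~~ S m) cA l m * WA m s.
Proof.
move=> gl gS Sl Tl nSl n s Ts; rewrite good_cobound // [RHS]big_mkcond.
apply: eq_bigr => m _; case: ifPn => //; rewrite negb_and negbK => /orP[nT|Sm].
  have [Sm|nSm] := boolP (S m); first by rewrite /cA (good_lower_coef gl Sl nSl Sm) mul0r.
  by rewrite (good_eq0 (gS _ nSm) Tl nT Ts) mulr0.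
by rewrite /cA (good_lower_coef gl Sl nSl Sm) mul0r.
Qed.

(** Excision to the chart of [l], where [W l] is the Thom class. *)
Lemma good_generates l S : (forall k, ~~ S k -> good k) -> lower S -> ~~ S l ->
  (forall m, (codim m < codim l)%N -> S m) ->
  generates (union (fun m => (m == l) || S m)) (union S) (WA l).
Proof.
move=> gS Sl nSl Sm; have gl := gS l nSl.
have Sl' : lower (fun m => (m == l) || S m).
  move=> m k /orP[/eqP ->|Sm'] km; apply/orP; right; first exact: Sm.
  exact: Sl Sm' km.
have dW := good_cobound_restrict gl gS Sl Sl' nSl.
have [E1 E2] := lower_add R hK Sm nSl; rewrite E1 in dW *.
have W0 := good_eq0 gl Sl nSl.
have [Wh _ Wt _ _] := gl; have [_ /(_ A) gt] := thetaP l.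
apply: generates_excision; [exact: open_cellopen|exact: open_union| |].
  split=> // n s sP; rewrite dW // big1 // => m /andP[/orP[/eqP ->|->//] _].
  by rewrite /cA (good_coef_diag gl) // mul0r.
rewrite E2; apply: eq_generates gt => n s sP; last by rewrite /WA /castc Wt.
by apply: W0 => x; have := sP x; rewrite -E2 => -[].
Qed.

(** The complex spanned by the cells of [T] outside [S], with right multiplication of row vectors by
    [cA] as differential, maps to the cochains of the pair. The two clauses are surjectivity and
    injectivity on cohomology. *)
Definition quasi_iso S T :=
  (forall v, rel_cocycle (union T) (union S) v -> exists a : Y -> A,
    (forall m, T m -> ~~ S m -> \sum_(k | T k && ~~ S k) a k * cA k m = 0) /\
    rel_coboundary (union T) (union S)
      (fun n s => v n s - \sum_(k | T k && ~~ S k) a k * WA k s)) /\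
  (forall a : Y -> A, rel_coboundary (union T) (union S)
      (fun n s => \sum_(k | T k && ~~ S k) a k * WA k s) ->
    exists b : Y -> A, forall m, T m -> ~~ S m ->
      a m = \sum_(k | T k && ~~ S k) b k * cA k m).

(** The five lemma by hand. A cell [l] of least codimension outside [S] is moved into [S]; the pair
    split off in this way is governed by [good_generates], and the remaining one by induction. *)
Lemma good_quasi_iso S T : (forall k, ~~ S k -> good k) -> lower S -> lower T ->
  (forall k, S k -> T k) -> quasi_iso S T.
Proof.
move=> + + Tl; have [n] := ubnP #|[pred k | T k && ~~ S k]|; elim: n S => // n IH S Sn gS Sl ST.
case: (pickP [pred k | T k && ~~ S k]) => [l0 l0P|none]; last first.
  have TS : union T `<=` union S.
    apply: unionS => k Tk; have := none k; rewrite /= Tk /=.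
    by move/negbT; rewrite negbK.
  split=> [v [vS _]|a _]; last first.
    by exists (fun=> 0) => m Tm nSm; have := none m; rewrite /= Tm nSm.
  exists (fun=> 0); split=> [m Tm nSm|]; first by have := none m; rewrite /= Tm nSm.
  apply: rel_coboundary0 => k s Ts; rewrite (big_pred0 _ _ _ _ none) subr0 vS //.
  by move=> x; exact/TS/Ts.
case: (arg_minnP (@codim K (N - K)) l0P) => l /= /andP[Tlm nSl] lmin.
have Slt m : (codim m < codim l)%N -> S m.
  move=> ml; apply/negPn/negP => nSm; have := lmin m.
  by rewrite (Tl _ _ Tlm ml) nSm leqNgt ml => /(_ isT).
pose S' m := (m == l) || S m.
have Sl' : lower S'.
  move=> m k /orP[/eqP ->|Sm'] km; apply/orP; right; first exact: Slt.
  exact: Sl Sm' km.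
have SS' k : S k -> S' k by move=> Sk; rewrite /S' Sk orbT.
have gS' k : ~~ S' k -> good k.
  by move=> nS'k; apply: gS; apply: contra nS'k; exact: SS'.
have split_sum (V : nmodType) (F : Y -> V) :
    \sum_(k | T k && ~~ S k) F k = F l + \sum_(k | T k && ~~ S' k) F k.
  rewrite (bigD1 l) ?Tlm ?nSl //=; congr (_ + _); apply: eq_bigl => k.
  by rewrite /S' negb_or andbAC -andbA.
have [||||IHs IHi] := IH S'.
- rewrite -ltnS; apply: leq_trans Sn; rewrite ltnS.
  rewrite (cardD1 l [pred k | T k && ~~ S k]) inE Tlm nSl /= add1n ltnS.
  apply: subset_leq_card; apply/fintype.subsetP => k.
  by rewrite !inE /S' negb_or andbCA.
- exact: gS'.
- exact: Sl'.
- by move=> k /orP[/eqP -> //|/ST].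
have gl := gS l nSl.
have gen := good_generates gS Sl nSl Slt; rewrite -/S' in gen.
have uSS' : union S `<=` union S' by exact: unionS.
have uS'T : union S' `<=` union T by apply: unionS => k /orP[/eqP -> //|/ST].
have cll : cA l l = 0 by rewrite /cA (good_coef_diag gl).
have ckl k : ~~ S' k -> cA k l = 0.
  by move=> nSk; rewrite /cA (good_lower_coef (gS' k nSk) Sl' nSk) // /S' eqxx.
have dWl d (s : singular R d G) : carried (union T) s ->
    cobound (WA l) s = \sum_(m | T m && ~~ S' m) cA l m * WA m s.
  move=> Ts; rewrite (good_cobound_restrict gl gS Sl Tl nSl Ts) split_sum.
  by rewrite cll mul0r add0r.
have dW m d (s : singular R d G) : ~~ S' m -> carried (union T) s ->
    cobound (WA m) s = \sum_(m' | T m' && ~~ S' m') cA m m' * WA m' s.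
  by move=> nSm; apply: good_cobound_restrict => //; exact: gS'.
have W0 m d (s : singular R d G) : ~~ S' m -> carried (union S') s -> WA m s = 0.
  by move=> nSm; apply: good_eq0 => //; exact: gS'.
have sumW0 (a : Y -> A) d (s : singular R d G) : carried (union S') s ->
    \sum_(m | T m && ~~ S' m) a m * WA m s = 0.
  by move=> Ss; apply: big1 => m /andP[_ nSm]; rewrite W0 // mulr0.
have sum_dW (b : Y -> A) d (s : singular R d G) : carried (union T) s ->
    cobound (fun d (s : singular R d G) => \sum_(m | T m && ~~ S' m) b m * WA m s) s =
    \sum_(m' | T m' && ~~ S' m') (\sum_(m | T m && ~~ S' m) b m * cA m m') * WA m' s.
  move=> Ts; rewrite cobound_sum.
  under [RHS]eq_bigr do rewrite mulr_suml.
  rewrite exchange_big; apply: eq_bigr => m /andP[_ nSm].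
  rewrite coboundZ dW // mulr_sumr; apply: eq_bigr => m' _.
  by rewrite mulrA.
have WlS d (s : singular R d G) : carried (union S) s -> WA l s = 0.
  exact: good_eq0.
have [[_ _] exl injl] := gen.
split=> [v vc|a [g [gS0 gE]]].
  have [al [g [gS0 gE]]] := exl v (rel_cocycleS uS'T (fun x => id) vc).
  pose g' := zext (union S') g.
  have g'S d (s : singular R d G) : carried (union S) s -> g' d s = 0.
    by move=> Ss; apply: zext_eq0 => _; exact: gS0.
  (* [v] with its part at [l] removed, so that it vanishes on the enlarged union. Its coboundary is
     a combination of the [WA m]; injectivity for the smaller pair writes the coefficients as the
     differential of some [b], which corrects [v'] to a cocycle. *)
  pose v' : cochain R G A := fun d s => v d s - al * WA l s - cobound g' s.
  have v'S d (s : singular R d G) : carried (union S') s -> v' d s = 0.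
    by move=> Ss; rewrite /v' cobound_zext // -gE // subrr.
  have dv' d (s : singular R d G) : carried (union T) s ->
      cobound v' s = - \sum_(m | T m && ~~ S' m) (al * cA l m) * WA m s.
    move=> Ts; have [_ vT] := vc.
    rewrite /v' coboundB coboundB coboundZ cobound_cobound subr0 vT // sub0r dWl //.
    by rewrite mulr_sumr; congr (- _); apply: eq_bigr => m _; rewrite mulrA.
  have [|b bE] := IHi (fun m => al * cA l m).
    exists (fun d s => 0 - v' d s); split=> k s sP.
      by rewrite v'S // subr0.
    by rewrite coboundB cobound0 dv' // sub0r opprK.
  have v''c : rel_cocycle (union T) (union S')
      (fun d s => v' d s + \sum_(m | T m && ~~ S' m) b m * WA m s).
    split=> k s sP; first by rewrite v'S // sumW0 // addr0.
    rewrite coboundD dv' // sum_dW // addrC -sumrB big1 // => m /andP[Tm nSm].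
    by rewrite -bE // subrr.
  have [a' [a'c a'E]] := IHs _ v''c.
  exists (fun m => if m == l then al else a' m - b m); split=> [m Tm nSm|].
    rewrite split_sum eqxx.
    have -> : \sum_(k | T k && ~~ S' k) (if k == l then al else a' k - b k) * cA k m =
        \sum_(k | T k && ~~ S' k) a' k * cA k m - \sum_(k | T k && ~~ S' k) b k * cA k m.
      rewrite -sumrB; apply: eq_bigr => k /andP[_]; rewrite /S' negb_or => /andP[/negPf -> _].
      by rewrite mulrBl.
    case: (eqVneq m l) => [->|ml].
      rewrite cll mulr0 add0r !big1 ?subrr // => k /andP[_ nSk]; rewrite ckl // mulr0 //.
    have nSm' : ~~ S' m by rewrite /S' negb_or ml.
    by rewrite a'c // -bE // sub0r subrr.
  have cg : rel_coboundary (union T) (union S) (cobound g').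
    exact: rel_coboundary_cobound.
  have := rel_coboundaryD (rel_coboundaryS (fun x => id) uSS' a'E) cg.
  apply: eq_rel_coboundary => k s Ts; rewrite split_sum eqxx.
  have -> : \sum_(k | T k && ~~ S' k) (if k == l then al else a' k - b k) * WA k s =
      \sum_(k | T k && ~~ S' k) a' k * WA k s - \sum_(k | T k && ~~ S' k) b k * WA k s.
    rewrite -sumrB; apply: eq_bigr => m /andP[_]; rewrite /S' negb_or => /andP[/negPf -> _].
    by rewrite mulrBl.
  by rewrite /v'; ring.
have sumE d (s : singular R d G) : \sum_(m | T m && ~~ S m) a m * WA m s =
    a l * WA l s + \sum_(m | T m && ~~ S' m) a m * WA m s by exact: split_sum.
(* On simplices of [union S'] only the term of [l] is left, and [WA l] generates there. *)
have al0 : a l = 0.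
  apply: injl; exists g; split=> // k s Ss.
  rewrite -gE ?sumE ?sumW0 ?addr0 // => x; exact/uS'T/Ss.
have gE' d (s : singular R d G) : carried (union T) s ->
    cobound g s = \sum_(m | T m && ~~ S' m) a m * WA m s.
  by move=> Ts; rewrite -gE // sumE al0 mul0r add0r.
have gc : rel_cocycle (union S') (union S) g.
  split=> // k s Ss; rewrite gE' ?sumW0 // => x; exact/uS'T/Ss.
(* The primitive [g] is itself a relative cocycle on the first pair, hence [be] times [WA l] up to a
   coboundary; [be] is the coefficient of [l] in the answer. *)
have [be [h [hS hE]]] := exl g gc.
pose h' := zext (union S') h.
have [|b bE] := IHi (fun m => a m - be * cA l m).
  exists (fun d s => g d s - be * WA l s - cobound h' s); split=> k s sP.
    by rewrite cobound_zext // -hE // subrr.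
  rewrite !coboundB coboundZ cobound_cobound subr0 gE' // dWl // mulr_sumr -sumrB.
  by apply: eq_bigr => m _; ring.
exists (fun m => if m == l then be else b m) => m Tm nSm; rewrite split_sum eqxx.
have -> : \sum_(k | T k && ~~ S' k) (if k == l then be else b k) * cA k m =
    \sum_(k | T k && ~~ S' k) b k * cA k m.
  by apply: eq_bigr => k /andP[_]; rewrite /S' negb_or => /andP[/negPf -> _].
case: (eqVneq m l) => [->|ml].
  by rewrite al0 cll mulr0 add0r big1 // => k /andP[_ nSk]; rewrite ckl // mulr0.
have nSm' : ~~ S' m by rewrite /S' negb_or ml.
by rewrite -bE // addrC subrK.
Qed.

End Comparison.
End CellComplex.

(** * Extension of the Thom classes *)

Section GoodExists.
Variables (R : realType) (N K : nat) (hK : (K <= N)%N).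
Local Notation Y := (young K (N - K)).
Local Notation G := (Gr R N K).
Implicit Types (l m k : Y).
Local Notation union := (@union R N K).
Local Notation cellopen := (@cellopen R N K hK).
Local Notation punctured := (@punctured R N K hK).
Variable theta : Y -> cochain R G int.
Hypothesis thetaP : thom_family hK theta.

Lemma unionT (S : pred Y) : (forall l, S l) -> union S = setT.
Proof.
move=> ST; apply/seteqP; split=> // U _; have [l lU] := cell_cover hK U.
by exists l.
Qed.

Lemma others_cover l :
  union (fun m => (codim m < (codim l).+1)%N) = cellopen l `|` union (others l) /\
  cellopen l `&` union (others l) = punctured l.
Proof.
have [||<- ->] := @lower_add R N K hK (others l) l.
- move=> m ml; apply/andP; split; first exact: ltnW.
  by apply: contraTneq ml => ->; rewrite ltnn.
- by rewrite /others /= eqxx andbF.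
split=> //; congr union; apply/funext => m; rewrite /others /= ltnS.
by case: eqVneq => [->|_]; rewrite ?leqnn ?andbT.
Qed.

(** The class is extended by excision over the cells of at most the same codimension, and by zero
    beyond them; its coboundary is under control only on the former. *)
Lemma thom_extension l : exists w : cochain R G int,
  [/\ homogeneous (codim l) w,
      forall n (s : singular R n G), carried (union (others l)) s -> w n s = 0,
      forall n (s : singular R n G), carried (cellopen l) s -> w n s = theta l s
    & forall n (s : singular R n G),
        carried (union (fun m => (codim m < (codim l).+1)%N)) s -> cobound w s = 0].
Proof.
have [th tg] := thetaP l; have [E1 E2] := others_cover l.
have [tc _ _] := zgenerates_int tg; rewrite -E2 in tc.
have [f [[f0 fc] fE]] := excision_extend (@open_cellopen R N K hK l)
  (@open_union R N K hK _ (@lower_others N K l)) tc.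
exists (zext (cellopen l `|` union (others l)) (hcomp (codim l) f)); split.
- by move=> n s ns; apply: zext_eq0 => _; exact: homogeneous_hcomp.
- by move=> n s sP; apply: zext_eq0 => _; rewrite /hcomp f0 // if_same.
- move=> n s sP; rewrite zextE => [|x]; last by left; exact: sP.
  by rewrite -(hcomp_id s th) /hcomp fE.
- move=> n s; rewrite E1 => sP; rewrite cobound_zext // cobound_hcomp /hcomp.
  by case: (n == _) => //; exact: fc.
Qed.

Lemma lower_codim_lt p : lower (fun m : Y => (codim m < p)%N).
Proof. by move=> m k mp km; exact: ltn_trans km mp. Qed.

(** Descending induction on the codimension [p]. The coboundary of an extended Thom class is a
    cocycle relative to the cells of codimension at most [p]. By the comparison for the cells
    already treated, it is a combination of their [W m] up to some [cobound g], and [g] is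
    subtracted. *)
Lemma good_exists : exists W c, forall l, good hK theta W c l.
Proof.
pose P p := exists W c, forall l, (p <= codim l)%N -> good hK theta W c l.
suff: P 0%N by move=> [W [c Wc]]; exists W, c => l; exact: Wc.
have : P (\max_(l : Y) codim l)%N.+1.
  exists (fun _ n s => 0), (fun _ _ => 0) => l; rewrite leqNgt ltnS.
  by rewrite (leq_bigmax l).
elim: (\max_(l : Y) codim l)%N.+1 => // p IH [W [c Wc]]; apply: IH.
pose S m := (codim m < p.+1)%N.
have Sl : lower S := @lower_codim_lt p.+1.
have WS k : ~~ S k -> good hK theta W c k by rewrite -leqNgt => pk; exact: Wc.
have [qs _] := good_quasi_iso int thetaP WS Sl (T := predT) (fun _ _ _ _ => isT) (fun _ _ => isT).
have ex l : exists wa : cochain R G int * (Y -> int), codim l = p ->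
  [/\ homogeneous (codim l) wa.1,
      forall n (s : singular R n G), carried (union (others l)) s -> wa.1 n s = 0,
      forall n (s : singular R n G), carried (cellopen l) s -> wa.1 n s = theta l s,
      forall n (s : singular R n G), cobound wa.1 s = \sum_m wa.2 m * W m n s
    & forall m, wa.2 m != 0 -> codim m = (codim l).+1].
  case: (eqVneq (codim l) p) => [lp|lp]; last first.
    by exists (fun _ _ => 0, fun=> 0) => e; rewrite e eqxx in lp.
  have [w [wh w0 wt dw]] := thom_extension l.
  have dwc : rel_cocycle (union predT) (union S) (cobound w).
    split=> n s sP; last exact: cobound_cobound.
    by apply: dw; rewrite lp.
  have [a [_ [g [g0 gE]]]] := qs _ dwc.
  have gE' n (s : singular R n G) :
      cobound w s - \sum_(m | ~~ S m) a m * W m n s = cobound g s.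
    rewrite -gE; first by congr (_ - _); apply: eq_bigr => m _; rewrite /castc intz.
    by rewrite unionT.
  (* Subtracting only the component of [g] in degree [p] leaves just the [W m] of degree [p.+1] in
     the coboundary. *)
  exists (fun n s => w n s - hcomp p g s, fun m => if codim m == p.+1 then a m else 0).
  move=> _; split=> /=.
  - by move=> n s ns; rewrite wh // /hcomp -lp (negPf ns) subr0.
  - move=> n s sP; rewrite w0 // /hcomp g0 ?if_same ?subr0 // => x.
    by apply: (unionS _ (sP x)) => m /andP[ml _]; rewrite /S ltnS -lp.
  - move=> n s sP; rewrite wt // /hcomp g0 ?if_same ?subr0 // => x.
    by have [E1 _] := others_cover l; rewrite /S -lp E1; left; exact: sP.
  - move=> n s; rewrite coboundB cobound_hcomp /hcomp; case: (eqVneq n p.+1) => [np|np].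
      rewrite -gE' opprB addrC subrK [LHS]big_mkcond; apply: eq_bigr => m _.
      case: (eqVneq (codim m) p.+1) => [mp|mp]; first by rewrite /S mp ltnn.
      rewrite mul0r; case: ifP => // nSm; have [Wh _ _ _ _] := WS m nSm.
      by rewrite Wh ?mulr0 // np eq_sym.
    rewrite subr0 (homogeneous_cobound wh) ?lp // big1 // => m _.
    case: (eqVneq (codim m) p.+1) => [mp|mp]; last by rewrite mul0r.
    have [|Wh _ _ _ _] := WS m; first by rewrite /S mp ltnn.
    by rewrite Wh ?mulr0 // mp.
  - by move=> m; case: (eqVneq (codim m) p.+1) => [->|_]; rewrite ?lp // eqxx.
pose F l := sval (cid (ex l)); have FP l := svalP (cid (ex l)).
pose W' l := if codim l == p then (F l).1 else W l.
pose c' l := if codim l == p then (F l).2 else c l.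
exists W', c' => l; rewrite leq_eqVlt => /orP[/eqP lp|lp].
  have [Fh F0 Ft dF cF] := FP l (esym lp); rewrite -/(F l) in Fh F0 Ft dF cF.
  have W'l : W' l = (F l).1 by rewrite /W' -lp eqxx.
  have c'l : c' l = (F l).2 by rewrite /c' -lp eqxx.
  split; rewrite ?W'l ?c'l // => n s.
  rewrite dF; apply: eq_bigr => m _; case: (eqVneq ((F l).2 m) 0) => [->|cm].
    by rewrite !mul0r.
  by rewrite /W' (cF _ cm) -lp; case: eqP => //; lia.
have [Wh W0 Wt dW cW] := Wc l lp.
have W'l : W' l = W l by rewrite /W' gtn_eqF.
have c'l : c' l = c l by rewrite /c' gtn_eqF.
split; rewrite ?W'l ?c'l // => n s.
rewrite dW; apply: eq_bigr => m _; case: (eqVneq (c l m) 0) => [->|cm].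
  by rewrite !mul0r.
by rewrite /W' (cW _ cm) gtn_eqF // ltnW.
Qed.

End GoodExists.

(** * Incidence numbers *)

Lemma unit_exchange (R : realType) N K (J J' : 'I_K -> 'I_N) (j0 : 'I_K) (B : 'M[R]_(K, N)) :
  (forall j, j != j0 -> J' j = J j) -> normalized J B -> B j0 (J' j0) != 0 ->
  colsub J' B \in unitmx.
Proof.
move=> JJ' nB B0; rewrite -row_free_unit; apply: inj_row_free => u u0.
have uB k : (u *m B) 0 (J' k) = 0.
  have /matrixP/(_ 0 k) := u0; rewrite [RHS]mxE => h.
  by rewrite -[RHS]h !mxE; apply: eq_bigr => i _; rewrite !mxE.
have uk k : k != j0 -> u 0 k = 0.
  by move=> kj; rewrite -(normalized_mul u k nB) -JJ' // uB.
apply/rowP => k; rewrite [RHS]mxE; case: (eqVneq k j0) => [->|/uk //].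
have := uB j0; rewrite mxE (bigD1 j0) //= big1 => [|i ij]; last by rewrite uk ?mul0r.
by rewrite addr0 => /eqP; rewrite mulf_eq0 (negPf B0) orbF => /eqP.
Qed.

Section Incidence.
Variables (R : realType) (N K : nat) (hK : (K <= N)%N).
Local Notation Y := (young K (N - K)).
Local Notation G := (Gr R N K).
Local Notation M := 'M[R]_(K, N).
Local Notation cell := (@schubert_cell R N K).
Local Notation union := (@union R N K).
Local Notation cellopen := (@cellopen R N K hK).
Local Notation punctured := (@punctured R N K hK).
Local Notation pv := (pv hK).
Local Notation cellchart := (@cellchart R N K hK).
Local Notation cpsi l := (@cellchart_continuous R N K hK l).
Local Notation cellbox l := (box (chartkind R (pv l))).

Lemma cellchart_boxret l B : cellchart l (boxret (chartkind R (pv l)) B) = cellchart l B.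
Proof.
apply/val_inj; rewrite !val_chart (boxret_id (@pv_inc N K hK l)) //.
exact: (normalized_boxret (@pv_inc N K hK l)).
Qed.

Lemma generates_cellchart (A : comPzRingType) l (w : cochain R G A) :
  generates (cellopen l) (punctured l) w ->
  generates setT (offzero (normals (pv l))) (pull (cpsi l) w).
Proof.
move=> /(generates_pull (@cellchart_lift R N K hK l) (@cellchart_inj R N K hK l)
  (fun x => id) (@punctured_sub R N K hK l)).
rewrite cellbox_cellopen cellbox_punctured.
move=> /(generates_pull_box (@chartkind_normals R N K (pv l))) gw.
have e n (s : singular R n M) : pull (@boxret_continuous R K N (chartkind R (pv l)))
    (pull (cpsi l) w) s = pull (cpsi l) w s.
  by congr (w n _); apply: singular_eq => x; exact: cellchart_boxret.
have [[wQ _] _ _] := gw.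
by apply: eq_generates gw => n s sP; rewrite -e //; exact: wQ.
Qed.

Variables (theta W : Y -> cochain R G int) (c : Y -> Y -> int).
Hypothesis thetaP : forall l, [/\ homogeneous (codim l) (theta l),
  zgenerates (cellopen l) (punctured l) (theta l)
  & forall c0, rel_coboundary (cellopen l) (punctured l) (fun n s =>
      pull (@grflip_continuous R N K c0) (theta l) s -
      (-1) ^+ #|flipset c0 (pv l) :&: normals (pv l)| * theta l s)].
Hypothesis WP : forall l, good hK theta W c l.

Lemma generates_W l : generates (cellopen l) (punctured l) (W l).
Proof.
have [_ /zgenerates_int gt _] := thetaP l; have [_ _ Wt _ _] := WP l.
have [[tQ _] _ _] := gt.
apply: eq_generates gt => n s sP; last by rewrite Wt.
by rewrite Wt ?tQ // => x; have [] := sP x.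
Qed.

Lemma chart_others l B : offzero (normals (pv l)) B -> union (others l) (cellchart l B).
Proof.
move=> Bo; have [k kU] := cell_cover hK (cellchart l B).
have kl : k != l.
  by apply/eqP => e; move: kU; rewrite e => /cellchart_cell; exact.
exists k => //; apply/andP; split=> //; apply: ltnW.
by apply: (cellopen_codim (hK := hK) _ kU kl); exists B.
Qed.

Variables (l m : Y).
Hypothesis lm : codim m = (codim l).+1.

Let omega := pull (cpsi m) (W l).

(** The chart of [m] meets only [m] and cells of smaller codimension, so the [W k] of the other [k]
    of the same codimension vanish on it. *)
Lemma cobound_chart n (s : singular R n M) :
  cobound omega s = c l m * pull (cpsi m) (W m) s.
Proof.
rewrite /omega cobound_pull; have [_ _ _ -> cd] := WP l.
rewrite (bigD1 m) //= big1 ?addr0 // => k km.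
case: (eqVneq (c l k) 0) => [->|ck]; first by rewrite mul0r.
have [_ W0 _ _ _] := WP k; rewrite W0 ?mulr0 // => x.
have [k' k'U] := cell_cover hK (cellchart m (s x)); exists k' => //.
have km' : codim k = codim m by rewrite lm cd.
case: (eqVneq k' m) => [->|k'm]; first by rewrite /others /= km' leqnn eq_sym.
have : (codim k' < codim m)%N.
  by apply: (cellopen_codim (hK := hK) _ k'U k'm); exists (s x).
rewrite /others /= -km' => h; rewrite (ltnW h) /=.
by apply: contraTneq h => ->; rewrite ltnn.
Qed.

Lemma coef_eq0_of_coboundary : rel_coboundary setT (offzero (normals (pv m))) (cobound omega) ->
  c l m = 0.
Proof.
have [_ _ inj] := generates_cellchart (generates_W m).
by move=> h; apply: inj; apply: eq_rel_coboundary h => n s _; rewrite cobound_chart.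
Qed.

(** Away from the cell [m], its chart consists of cells other than [l] of codimension at most that
    of [l], where [W l] vanishes. So [c l m] times a generator is a relative coboundary. *)
Lemma coef_eq0_apart : (forall U, cellopen m U -> ~ cell l U) -> c l m = 0.
Proof.
move=> no; apply: coef_eq0_of_coboundary; apply: rel_coboundary_cobound => n s sP.
have [_ W0 _ _ _] := WP l; rewrite /omega /pull W0 // => x.
have [k /andP[km kne] kU] := chart_others (sP x); exists k => //.
have lk : k != l.
  apply/eqP => e; apply: (no (cellchart m (s x))); first by exists (s x).
  by rewrite -e.
rewrite /others /= lk andbT -ltnS -lm.
by apply: (cellopen_codim (hK := hK) _ kU kne); exists (s x).
Qed.

(** * Incidence of two diagrams that differ by one box *)

Section Box.
Variable j0 : 'I_K.
Hypotheses (m0 : part m j0 = (part l j0).+1)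
  (m1 : forall j : 'I_K, j != j0 -> part m j = part l j).

(** The pivot of row [j0] is [c0] for [l] and the column just before for [m]. The sign of the
    coordinate [i0] separates the two halves of the cell [l] in the chart of [m]; [i1] is its
    counterpart in the chart of [l], and [T] indexes the normals of [l] as seen in the chart of
    [m]. *)
Let J := pv m.
Let J' := pv l.
Let c0 : 'I_N := J' j0.
Let i0 : 'I_K * 'I_N := (j0, c0).
Let i1 : 'I_K * 'I_N := (j0, J j0).
Let T := normals J :\ i0.
Let Jinc := @pv_inc N K hK m.
Let J'inc := @pv_inc N K hK l.

Let JJ' j : j != j0 -> J' j = J j.
Proof.
move=> jj; apply/ord_inj; have := pvE hK l j; have := pvE hK m j.
by rewrite /J /J' m1 //; lia.
Qed.

Let c0E : c0 = (J j0).+1 :> nat.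
Proof. by rewrite /c0 /J' /J; have := pvE hK l j0; have := pvE hK m j0; rewrite m0; lia. Qed.

Let J'E j : J' j = if j == j0 then c0 else J j.
Proof. by case: eqP => [->//|/eqP]; exact: JJ'. Qed.

Let cell_l B : cell l (cellchart m B) <-> ~ offzero T B /\ B j0 c0 != 0.
Proof. by rewrite (cellP hK); exact: chart_incell_up. Qed.

Let c0J j : J j != c0.
Proof.
apply/eqP => e; have [ej|ne] := eqVneq j j0.
  by have := congr1 (@nat_of_ord N) e; rewrite ej c0E; lia.
have : (j < j0)%N || (j0 < j)%N by rewrite -neq_ltn.
case/orP => [/Jinc|/J'inc]; first by rewrite -/J e c0E; lia.
by rewrite -/J' (JJ' ne) e -/c0 ltnn.
Qed.

Let i0N : i0 \in normals J.
Proof.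
rewrite inE; apply/andP; split; first by rewrite -[i0.2]/c0 c0E.
by apply/existsP => -[i]; rewrite (negPf (c0J i)).
Qed.

Let normalsE : normals J = i0 |: T. Proof. by rewrite finset.setD1K. Qed.
Let i0T : i0 \notin T. Proof. by rewrite !inE eqxx. Qed.

Let offT_others B : offzero T B -> union (others l) (cellchart m B).
Proof.
move=> BT; have BN : offzero (normals J) B.
  by case: BT => i iT Bi; exists i => //; rewrite normalsE setU1r.
have [k /andP[km kne] kU] := chart_others BN; exists k => //.
have lk : k != l by apply/eqP => e; move: kU; rewrite e => /cell_l [].
rewrite /others /= lk andbT -ltnS -lm.
by apply: (cellopen_codim (hK := hK) _ kU kne); exists B.
Qed.

Let P0 := @pos_part R K N i0.
Let N0 := @neg_part R K N i0.
Let YE : offzero (normals J) = P0 `|` N0 `|` offzero T.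
Proof. by rewrite normalsE offzeroU1. Qed.

Let omegac : rel_cocycle (P0 `|` N0 `|` offzero T) (offzero T) omega.
Proof.
split=> n s sP.
  by have [_ W0 _ _ _] := WP l; rewrite /omega /pull W0 // => x; exact/offT_others/sP.
rewrite cobound_chart; have [_ W0 _ _ _] := WP m.
by rewrite /pull W0 ?mulr0 // => x; apply: chart_others; rewrite YE; exact: sP.
Qed.

Let chart_cellopen_l (B : M) : B j0 c0 != 0 -> cellopen l (cellchart m B).
Proof.
move=> B0; apply/(chartsetP J'inc (val_chart _ B)).
apply: (unit_exchange (J := J) (j0 := j0)) => //.
  exact: (normalized_boxret (@pv_inc N K hK m)).
by rewrite mxE (@chartkind_normals R N K J i0 i0N).
Qed.

Let i1K : chartkind R J' i1 = Full R.
Proof.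
rewrite /chartkind /=; case: existsP => // -[i /eqP e].
have [ej|ne] := eqVneq i j0; first by have := congr1 (@nat_of_ord N) e; rewrite ej -/c0 c0E; lia.
by move: e; rewrite JJ' // => /(J_inj Jinc) e; rewrite e eqxx in ne.
Qed.

Let chart_cellopen_m (B : M) : B j0 (J j0) != 0 -> cellopen m (cellchart l B).
Proof.
move=> B0; apply/(chartsetP Jinc (val_chart _ B)).
apply: (unit_exchange (J := J') (j0 := j0)) => //.
- by move=> j /JJ'.
- exact: (normalized_boxret (@pv_inc N K hK l)).
by rewrite mxE -/i1 i1K.
Qed.

(** Row [j0] normalized at [l] has entry 1 in column [c0]. Written in the rows of [B], it has zero
    coefficients on all rows except [j0], where the coefficient is its entry in column [J j0]. *)
Let coord_inv (B B' : M) : cellbox m B -> cellchart m B = cellchart l B' ->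
  B' j0 (J j0) != 0 -> B j0 c0 = (B' j0 (J j0))^-1.
Proof.
move=> /(normalizedP (@pv_inc _ _ hK m)) nB e B0.
have nB' := normalized_boxret (@pv_inc _ _ hK l) B'.
set B1 := boxret _ _ in nB'.
have B1E : B1 j0 (J j0) = B' j0 (J j0) by rewrite mxE -/i1 i1K.
have : row j0 B1 \in <<rows B>>%VS.
  rewrite -{1}(boxret_id Jinc nB) -(val_chart (@pv_inc _ _ hK m)) -/(cellchart m B) e val_chart.
  by apply/mem_span_rows; exists (delta_mx 0 j0); rewrite -rowE.
move=> /mem_span_rows [u uE].
have uk k : u 0 k = B1 j0 (J k).
  by rewrite -(normalized_mul u k nB) -uE [LHS]mxE.
have : B1 j0 c0 = (u *m B) 0 c0 by rewrite -uE [RHS]mxE.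
rewrite [LHS](nB' j0 j0) eqxx mxE (bigD1 j0) //= big1 => [|k kj].
  rewrite addr0 uk B1E => e1; apply: (mulfI B0); rewrite mulfV //; exact: esym.
by rewrite uk -JJ' // [B1 _ _](nB' j0 k) eq_sym (negPf kj) mul0r.
Qed.

(** [i1] is not a normal coordinate of [l], so [W l] still generates on the half of the chart of [l]
    where it is positive. By [coord_inv] that half corresponds to points of [P0] in the chart of
    [m]. *)
Let not_coboundary_pos : ~ rel_coboundary P0 (P0 `&` offzero T) omega.
Proof.
move=> om0.
pose V := cellchart l @` @pos_part R K N i1.
have i1N : i1 \notin normals J'.
  rewrite inE; apply/negP => /andP[+ _]; rewrite -[J' i1.1]/c0 c0E /=.
  by move/ltnW; rewrite ltnn.
have VU : V `<=` cellopen m.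
  by move=> U [B' B0 <-]; apply: chart_cellopen_m; rewrite gt_eqF.
have QV : V `&` ~` cell l `<=` V by move=> U [].
have boxV B : cellbox m B -> V (cellchart m B) -> 0 < B j0 c0.
  move=> bB [B' B0 e]; rewrite (coord_inv bB (esym e)) ?invr_gt0 // gt_eqF //.
have W1 : rel_coboundary V (V `&` ~` cell l) (W l).
  apply: (rel_coboundary_of_pull (@cellchart_lift R N K hK m) (@cellchart_inj R N K hK m) VU QV).
  apply: rel_coboundaryS om0 => [B [bB VB]|B [bB [VB nB]]]; first exact: boxV.
  split; first exact: boxV.
  apply: contrapT => nT; apply: nB; apply/cell_l; split=> //.
  by rewrite gt_eqF //; exact: boxV.
have [_ _ inj] := generates_pos i1N (generates_cellchart (generates_W l)).
suff : (1 : int) = 0 by [].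
apply: inj.
have W2 : rel_coboundary (@pos_part R K N i1) (@pos_part R K N i1 `&` offzero (normals J'))
    (pull (cpsi l) (W l)).
  apply: rel_coboundary_pull W1 => [B B0|B [B0 BN]]; first by exists B.
  by split; [exists B|move=> /cellchart_cell].
by apply: eq_rel_coboundary W2 => n s _; rewrite mul1r.
Qed.

(** Column [c0] has no pivot of [m]. It is to the right of the pivots of the rows above [j0] and to
    the left of those below, and row [j0] itself is excluded from [T]. *)
Let card_flip_m : #|flipset c0 J :&: T| = j0.
Proof.
have -> : flipset c0 J :&: T = [set (k, c0) | k in [set k : 'I_K | (k < j0)%N]%SET]%SET.
  apply/setP => -[j c']; apply/idP/imsetP => [|[k]].
    rewrite !inE /= (negPf (c0J j)) /= => /and4P[/eqP -> ne jc _].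
    exists j => //; rewrite inE; case: (ltngtP j j0) => // [/J'inc|/val_inj e].
      rewrite -/J' J'E eqxx => h; move: jc; rewrite ltnNge.
      have jne : j != j0 by apply: contraTneq h => ->; rewrite J'E eqxx ltnn.
      by move: h; rewrite J'E (negPf jne) => /ltnW ->.
    by move: ne; rewrite e xpair_eqE !eqxx.
  rewrite inE => kj [-> ->]; rewrite !inE /= (negPf (c0J k)) eqxx /=.
  rewrite xpair_eqE eqxx andbT; apply/and3P; split.
  - by apply: contraTneq kj => ->; rewrite ltnn.
  - have : (J k < c0)%N by rewrite c0E ltnS; exact: ltnW (Jinc kj).
    exact.
  - by apply/existsP => -[i]; rewrite (negPf (c0J i)).
rewrite card_imset => [|x y [] //].
rewrite -sum1_card; under eq_bigl do rewrite inE.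
rewrite -(big_ord_widen _ (fun=> 1%N)) ?sum1_card ?card_ord //; exact: ltnW.
Qed.

(** For [l] the reflected column is the pivot column of row [j0], so exactly the normal entries of
    this row change sign. *)
Let card_flip_l : #|flipset c0 J' :&: normals J'| = part l j0.
Proof.
have -> : flipset c0 J' :&: normals J' =
    [set (j0, c') | c' in [set c' : 'I_N | (J' j0 < c')%N && ~~ [exists i, J' i == c']]%SET]%SET.
  apply/setP => -[j c']; apply/idP/imsetP => [|[d]].
    rewrite !inE /= => /andP[+ /andP[jc nex]].
    have -> : (c' == c0) = false.
      by apply: contraNF nex => /eqP ->; apply/existsP; exists j0.
    rewrite addbF /c0 (inj_eq (J_inj J'inc)) => /eqP e.
    by exists c'; rewrite ?e // inE -e jc.
  rewrite inE => /andP[jd nex] [-> ->]; rewrite !inE /= eqxx jd nex andbT.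
  by rewrite andbT; apply: contraNN nex => /eqP ->; apply/existsP; exists j0.
rewrite card_imset => [|x y [] //].
by rewrite (card_normals_row hK J'inc); have := pvE hK l j0; rewrite /J'; lia.
Qed.

(** [omega] is [a * tau] on one half and [b * tau] on the other, up to coboundaries. Both [W m] and
    the suspension of [tau] generate, so [c l m] vanishes exactly when [a] and [b] agree; the
    reflection in column [c0] exchanges the halves and relates the two. *)
Lemma coef_box : (c l m == 0) = ~~ odd (part l j0 + j0).
Proof.
have [tau [th tg tflip]] := thom_class R T.
have tc := zgenerates_int tg.
have [sigma [sh sc sU sV]] := suspension_cochain (@open_pos R K N i0) (@open_neg R K N i0)
  (@open_offzero R K N T) (pos_neg_part0 R i0) th (let: And3 h _ _ := tc in h).
have gU := generates_pos i0T tc; have gV := generates_neg i0T tc.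
have sg := suspension_generates (@open_pos R K N i0) (@open_neg R K N i0)
  (@open_offzero R K N T) (pos_neg_part0 R i0) sc sU sV tc gU gV.
have [_ exU injU] := gU; have [_ exV injV] := gV.
have subU : P0 `<=` P0 `|` N0 `|` offzero T by move=> x; left; left.
have subV : N0 `<=` P0 `|` N0 `|` offzero T by move=> x; left; right.
have subQ (S : set M) : S `&` offzero T `<=` offzero T by move=> x [].
have [a aE] := exU omega (rel_cocycleS subU (@subQ P0) omegac).
have [b bE] := exV omega (rel_cocycleS subV (@subQ N0) omegac).
have D := suspension_decomposition (@open_pos R K N i0) (@open_neg R K N i0)
  (@open_offzero R K N T) (pos_neg_part0 R i0) sc sU sV tc omegac aE bE.
set Z := _ `|` _ in sc sg D.
have D1 : rel_coboundary setT Z (cobound (fun n s => omega s - zext Z omega s)).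
  by apply: rel_coboundary_cobound => n s sP; rewrite zextE // subrr.
have D2 : rel_coboundary setT Z (fun n s => c l m * pull (cpsi m) (W m) s -
    (a - b) * cobound (zext Z sigma) s).
  apply: eq_rel_coboundary (rel_coboundaryD D1 D) => n s _.
  by rewrite coboundB cobound_chart; ring.
have gm := generates_cellchart (generates_W m).
rewrite -/J YE -/Z in gm.
have cab : (c l m == 0) = (a == b).
  have [_ _ injm] := gm; have [_ _ injs] := sg.
  apply/eqP/eqP => [c_0|ab].
    apply/eqP; rewrite -subr_eq0; apply/eqP/injs.
    apply: eq_rel_coboundary (rel_coboundaryZ (-1) D2) => n s _.
    by rewrite c_0; ring.
  by apply: injm; apply: eq_rel_coboundary D2 => n s _; rewrite ab subrr mul0r subr0.
have a0 : a != 0.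
  apply/eqP => a_0; apply: not_coboundary_pos.
  by apply: eq_rel_coboundary aE => n s _; rewrite a_0 mul0r subr0.
pose el : int := (-1) ^+ part l j0; pose em : int := (-1) ^+ j0.
pose rho := @flip R K N (flipset c0 J).
pose crho := @flip_continuous R K N (flipset c0 J).
have i0F : i0 \in flipset c0 J by rewrite inE /= (negPf (c0J j0)) eqxx.
have rhoNP : N0 `<=` rho @^-1` P0.
  move=> B BN; suff : 0 < flip (flipset c0 J) B i0.1 i0.2 by [].
  by rewrite flipE i0F oppr_gt0.
have flip_l : rel_coboundary N0 (N0 `&` offzero T)
    (fun n s => pull crho omega s - el * omega s).
  have [_ _ /(_ c0)] := thetaP l; rewrite card_flip_l -/el => fl.
  have fl' : rel_coboundary (cellopen l) (punctured l)
      (fun n s => pull (@grflip_continuous R N K c0) (W l) s - el * W l s).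
    apply: eq_rel_coboundary fl => n s sP; have [_ _ Wt _ _] := WP l.
    rewrite Wt // /pull Wt // => x /=.
    by have [B _ <-] := sP x; rewrite (grflip_chart _ J'inc); eexists.
  have := @rel_coboundary_pull R _ _ _ _ (cpsi m) _ _ N0 (N0 `&` offzero T) _ _ _ fl'.
  move=> h; apply: eq_rel_coboundary (h _ _) => [n s Ns||].
  - rewrite /pull; congr (_ - _); congr (W l _); apply: singular_eq => x /=.
    exact: (grflip_chart c0 Jinc).
  - by move=> B BN; apply: chart_cellopen_l; rewrite lt_eqF.
  - move=> B [BN BT]; split; first by apply: chart_cellopen_l; rewrite lt_eqF.
    by move=> /cell_l [].
(* On the negative half the reflected [omega] is [el * omega], hence [el * b * tau]; it is also the
   reflection of [a * tau], hence [a * em * tau]. *)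
have rel_b : el * b = a * em.
  have e1 : rel_coboundary N0 (N0 `&` offzero T)
      (fun n s => pull crho omega s - a * pull crho tau s).
    have := @rel_coboundary_pull R _ _ _ _ crho _ _ N0 (N0 `&` offzero T) _ _ _ aE.
    apply=> // B [BN BT]; split; [exact: rhoNP|exact: flip_off].
  have e2 : rel_coboundary N0 (N0 `&` offzero T)
      (fun n s => pull crho tau s - em * tau n s).
    have := tflip (flipset c0 J); rewrite card_flip_m -/em.
    by apply: rel_coboundaryS => // x [].
  apply/eqP; rewrite -subr_eq0; apply/eqP/injV.
  have := rel_coboundaryD (rel_coboundaryB (rel_coboundaryB e1 flip_l) (rel_coboundaryZ el bE))
     (rel_coboundaryZ a e2).
  by apply: eq_rel_coboundary => n s _; ring.
rewrite cab oddD.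
have el2 : el * el = 1 by rewrite /el -expr2 sqrr_sign.
have bE' : b = (-1) ^+ (part l j0 + j0) * a.
  by rewrite exprD -/el -/em -mulrA (mulrC em) -rel_b mulrA el2 mul1r.
rewrite bE' -signr_odd oddD; case: (_ (+) _) => /=; last by rewrite expr0 mul1r eqxx.
(* A nonzero integer differs from its opposite. *)
rewrite expr1 mulN1r -subr_eq0 opprK -mulr2n mulrn_eq0 (negPf a0) //.
Qed.

End Box.
End Incidence.

(** * The acyclic matching *)

Section OddBoxes.
Variables (N K : nat) (hK : (K <= N)%N).
Local Notation Y := (young K (N - K)).
Implicit Types (l m : Y) (j : 'I_K).
Local Notation pv := (pv hK).

Definition box_at l m j := part m j = (part l j).+1 /\
  forall i : 'I_K, i != j -> part m i = part l i.

(** The parity is kept as a separate condition [odd (N - K + i)]: by [pvE] this is the parity of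
    [part l j + j]. *)
Definition odd_box l m i := exists2 j, box_at l m j & pv l j = i :> nat.

Definition bit l (i : nat) := [exists j, pv l j == i :> nat].

(** A position where a box of odd type can be added (bit at [i] only) or removed (bit at [i.-1]
    only). *)
Definition corner l i := [&& (0 < i)%N, (i < N)%N, odd (N - K + i) & bit l i (+) bit l i.-1].

Definition corner_free l := forall i, ~~ corner l i.

Lemma bitP l j : bit l (pv l j).
Proof. by apply/existsP; exists j. Qed.

Lemma part_eq l m : (forall j, part l j = part m j) -> l = m.
Proof.
move=> e; apply: (pv_eq (hK := hK)) => j; apply/ord_inj.
by have := pvE hK l j; have := pvE hK m j; rewrite e; lia.
Qed.

Lemma pv_inj l i j : pv l i = pv l j :> nat -> i = j.
Proof.
move=> e; case: (ltngtP i j) => [/(pv_inc hK l)|/(pv_inc hK l)|/val_inj //];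
  by rewrite e ltnn.
Qed.

Lemma box_at_codim l m j : box_at l m j -> codim m = (codim l).+1.
Proof.
move=> [m0 m1]; rewrite !codimE (bigD1 j) // [X in _ = X.+1](bigD1 j) //= m0.
suff -> : (\sum_(i < K | i != j) part m i = \sum_(i < K | i != j) part l i)%N by [].
by apply: eq_bigr => i; exact: m1.
Qed.

Lemma box_at_pv l m j : box_at l m j -> pv l j = (pv m j).+1 :> nat /\
  forall i, i != j -> pv m i = pv l i :> nat.
Proof.
move=> [m0 m1]; split=> [|i ij].
  by have := pvE hK l j; have := pvE hK m j; rewrite m0; lia.
by have := pvE hK l i; have := pvE hK m i; rewrite m1 //; lia.
Qed.

Lemma odd_box_bit l m i : odd_box l m i ->
  [/\ (0 < i)%N, (i < N)%N, bit l i && ~~ bit l i.-1, bit m i.-1 && ~~ bit m i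
    & forall k, k != i -> k != i.-1 -> bit m k = bit l k].
Proof.
move=> [j lmj <-]; have [e0 e1] := box_at_pv lmj.
have nl : ~~ bit l (pv l j).-1.
  apply/existsP => -[k /eqP]; rewrite e0 succnK => e.
  have [ek|kj] := eqVneq k j; first by move: e; rewrite ek e0; lia.
  have : pv m k = pv m j :> nat by rewrite e1.
  by move/pv_inj => /eqP; rewrite (negPf kj).
have nm : ~~ bit m (pv l j).
  apply/existsP => -[k /eqP e]; have [ek|kj] := eqVneq k j.
    by move: e; rewrite ek; lia.
  by move: e; rewrite e1 // => /pv_inj /eqP; rewrite (negPf kj).
split=> //.
- by rewrite e0.
- by rewrite bitP.
- by rewrite nm andbT; apply/existsP; exists j; rewrite e0.
- move=> k k0 k1; apply/existsP/existsP => -[k' /eqP e]; exists k'; move: e.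
    have [->|kj] := eqVneq k' j; last by rewrite e1 // => ->.
    by move=> e; rewrite -e e0 eqxx in k1.
  have [->|kj] := eqVneq k' j; last by rewrite e1 // => ->.
  by move=> e; rewrite -e eqxx in k0.
Qed.

(** A box at [i] changes only the bits at [i] and [i.-1]. Admissible positions all have the same
    parity, so the pair of bits at another admissible position is disjoint from these. *)
Lemma odd_box_corner l m i k : odd_box l m i -> odd (N - K + i) ->
  corner l k = corner m k /\
  (corner l k -> k != i -> bit l k = bit m k).
Proof.
move=> lm oi; have [i0 iN /andP[l1 l0] /andP[m0 m1] e] := odd_box_bit lm.
have [->|ki] := eqVneq k i.
  by rewrite /corner i0 iN oi l1 (negPf l0) m0 (negPf m1); split.
rewrite /corner; case: (ltnP 0 k) => //= k0; case: (ltnP k N) => //= kN.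
case: (boolP (odd _)) => //= ok.
have n1 : k != i.-1 by apply: contraTneq ok => ->; move: oi i0; case: (i) => // i'; rewrite addnS /=.
have n2 : k.-1 != i by apply: contraTneq oi => <-; move: ok k0; case: (k) => // k'; rewrite addnS /=.
have n3 : k.-1 != i.-1 by apply: contra ki => /eqP; case: (k) (i) k0 i0 => // k' [] //= i' _ _ ->.
by rewrite -!e.
Qed.

Lemma corner_odd_box l m i : odd_box l m i -> odd (N - K + i) -> corner l i /\ corner m i.
Proof.
move=> lm oi; have [i0 iN /andP[l1 l0] /andP[m0 m1] e] := odd_box_bit lm.
by rewrite /corner i0 iN oi l1 (negPf l0) m0 (negPf m1).
Qed.

Lemma odd_box_down_uniq l l' m i : odd_box l m i -> odd_box l' m i -> l = l'.
Proof.
move=> [j lj ej] [j' lj' ej']; have [p _] := box_at_pv lj; have [p' _] := box_at_pv lj'.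
have jj : j = j' by apply: (@pv_inj m); lia.
apply: part_eq => k; move: lj' => []; rewrite -jj => m0' m1'; have [m0 m1] := lj.
have [->|kj] := eqVneq k j; first by apply/eqP; rewrite -eqSS -m0 -m0'.
by rewrite -m1 // -m1'.
Qed.

Lemma odd_box_up_uniq l m m' i : odd_box l m i -> odd_box l m' i -> m = m'.
Proof.
move=> [j [m0 m1] ej] [j' [m0' m1'] ej'].
have jj : j = j' by apply: (@pv_inj l); rewrite ej ej'.
apply: part_eq => k; have [->|kj] := eqVneq k j; first by rewrite m0 jj m0'.
by rewrite m1 // m1' // -jj.
Qed.

Lemma odd_box_up l i : (0 < i)%N -> bit l i -> ~~ bit l i.-1 -> exists m, odd_box l m i.
Proof.
move=> i0 /existsP[j /eqP ej] nl.
have cN : (i.-1 < N)%N by rewrite -ej; have := ltn_ord (pv l j); lia.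
pose J k := if k == j then Ordinal cN else pv l k.
have Jinc (a b : 'I_K) : (a < b)%N -> (J a < J b)%N.
  move=> ab; rewrite /J; have [ea|na] := eqVneq a j; have [eb|nb] := eqVneq b j.
  - by move: ab; rewrite ea eb ltnn.
  - by change (i.-1 < pv l b)%N; have := pv_inc hK l ab; rewrite ea ej; lia.
  - change (pv l a < i.-1)%N; have := pv_inc hK l ab; rewrite eb ej => h.
    rewrite ltn_neqAle; apply/andP; split; last by lia.
    by apply: contra nl => /eqP <-; exact: bitP.
  - exact: pv_inc.
have [m mJ] := pv_exists hK Jinc; exists m, j => //.
have pm k : pv m k = (if k == j then i.-1 else pv l k) :> nat.
  by rewrite mJ /J; case: (k == j).
split=> [|k kj].
  by have := pvE hK l j; have := pvE hK m j; rewrite (pm j) eqxx ej; lia.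
by have := pvE hK l k; have := pvE hK m k; rewrite (pm k) (negPf kj); lia.
Qed.

Lemma odd_box_down m i : (0 < i < N)%N -> bit m i.-1 -> ~~ bit m i -> exists l, odd_box l m i.
Proof.
move=> /andP[i0 iN] /existsP[j /eqP ej] nm.
pose J k := if k == j then Ordinal iN else pv m k.
have Jinc (a b : 'I_K) : (a < b)%N -> (J a < J b)%N.
  move=> ab; rewrite /J; have [ea|na] := eqVneq a j; have [eb|nb] := eqVneq b j.
  - by move: ab; rewrite ea eb ltnn.
  - change (i < pv m b)%N; have := pv_inc hK m ab; rewrite ea ej => h.
    rewrite ltn_neqAle; apply/andP; split; last by lia.
    by apply: contra nm => /eqP ->; exact: bitP.
  - by change (pv m a < i)%N; have := pv_inc hK m ab; rewrite eb ej; lia.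
  - exact: pv_inc.
have [l lJ] := pv_exists hK Jinc.
have pl k : pv l k = (if k == j then i else pv m k) :> nat.
  by rewrite lJ /J; case: (k == j).
exists l, j; last by rewrite pl eqxx.
split=> [|k kj].
  by have := pvE hK l j; have := pvE hK m j; rewrite (pl j) eqxx ej; lia.
by have := pvE hK l k; have := pvE hK m k; rewrite (pl k) (negPf kj); lia.
Qed.

(** * The matching at the first odd corner *)

Section Acyclic.
Variables (A : fieldType) (c : Y -> Y -> A).
Hypothesis cP : forall l m, c l m != 0 <-> exists2 i, odd_box l m i & odd (N - K + i).
Hypothesis cc : forall l m, \sum_k c l k * c k m = 0.

Lemma corner_free_coef l m : corner_free l -> c l m = 0 /\ c m l = 0.
Proof.
move=> iso; split; apply/eqP/negPn/negP => /cP[i b o];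
  have [c1 c2] := corner_odd_box b o; have := iso i.
  by rewrite c1.
by rewrite c2.
Qed.

Let first_corner l : nat := find (corner l) (iota 0 N).

Let first_cornerP l : ~ corner_free l -> corner l (first_corner l).
Proof.
move=> nis; have h : has (corner l) (iota 0 N).
  apply/hasP; apply: contrapT => no; apply: nis => i; apply/negP => ci; apply: no.
  by exists i => //; rewrite mem_iota; case/and4P: ci.
have := nth_find 0%N h; rewrite nth_iota ?add0n //.
by rewrite -[X in (_ < X)%N](size_iota 0) -has_find.
Qed.

Let first_corner_eq l m : corner l =1 corner m -> first_corner l = first_corner m.
Proof. by move=> e; apply: eq_find => i; exact: e. Qed.

(** For a diagram with a corner: it is the lower end of its matching edge. *)
Let low l := bit l (first_corner l).

Let up_ex l : exists m, ~ corner_free l -> low l -> odd_box l m (first_corner l).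
Proof.
case: (pselect (corner_free l)) => [iso|nis]; first by exists l.
have /and4P[i0 iN oi b] := first_cornerP nis.
case: (boolP (low l)) => [lw|]; last by exists l.
have [|m lm] := odd_box_up i0 lw; last by exists m.
by move: b; rewrite -/(low l) lw /=.
Qed.

Let up l := sval (cid (up_ex l)).

Let upP l : ~ corner_free l -> low l -> odd_box l (up l) (first_corner l).
Proof. exact: svalP (cid (up_ex l)). Qed.

Let edge_first l m i : odd_box l m i -> odd (N - K + i) ->
  ~ corner_free l /\ ~ corner_free m /\ first_corner l = first_corner m.
Proof.
move=> b o; have [c1 c2] := corner_odd_box b o.
split; first by move=> /(_ i); rewrite c1.
split; first by move=> /(_ i); rewrite c2.
by apply: first_corner_eq => k; have [] := odd_box_corner k b o.
Qed.

(** By [odd_box_corner], a box placed elsewhere leaves the bit at the first corner unchanged. *)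
Let edge_low l m : c l m != 0 -> low l != low m -> odd_box l m (first_corner m).
Proof.
move=> /cP[i b o] lw; have [nl [nm e]] := edge_first b o.
have [<- //|ne] := eqVneq i (first_corner m).
have [_ h] := odd_box_corner (first_corner m) b o.
case/negP: lw; rewrite /low e h //; last by rewrite eq_sym.
by rewrite -e; exact: first_cornerP.
Qed.

Let low_of l m i : odd_box l m i -> odd (N - K + i) -> i = first_corner l -> low l && ~~ low m.
Proof.
move=> b o e; have [_ [_ e']] := edge_first b o.
have [_ _ /andP[l1 _] /andP[_ m1] _] := odd_box_bit b.
by rewrite /low -e' -e l1 m1.
Qed.

(* Toggling the first odd corner pairs off the diagrams having an odd corner;
   along the other odd boxes the position and the state of that corner do not
   change, so the matching is acyclic in one step. *)
Lemma odd_boxes_acyclic (a : Y -> A) :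
  (forall m, \sum_l a l * c l m = 0) ->
  exists b : Y -> A, forall m, ~ corner_free m -> a m = \sum_l b l * c l m.
Proof.
move=> ac.
(* Chosen so that [a] minus the differential of [b] vanishes at the upper end of every matching
   edge. *)
pose b l := if `[< corner_free l >] then 0 else
  if low l then a (up l) / c l (up l) else 0.
pose a' m := a m - \sum_l b l * c l m.
have c_up l : ~ corner_free l -> low l -> c l (up l) != 0.
  move=> nis lw; apply/cP; exists (first_corner l); first exact: upP.
  by have /and4P[] := first_cornerP nis.
have bE l : ~ corner_free l -> low l -> b l = a (up l) / c l (up l).
  by rewrite /b => nis lw; case: asboolP => // _; rewrite lw.
have b_low l : b l != 0 -> ~ corner_free l /\ low l.
  by rewrite /b; case: asboolP => [|nis]; [rewrite eqxx | case: ifP => // _; rewrite eqxx].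
have a'high m : ~ corner_free m -> ~~ low m -> a' m = 0.
  move=> nis nlow; have /and4P[i0 iN oi bm] := first_cornerP nis.
  rewrite -/(low m) (negPf nlow) /= in bm.
  have [|l lm] := odd_box_down _ bm nlow; first by rewrite i0.
  have [nl [_ e]] := edge_first lm oi.
  have /andP[lw _] := low_of lm oi (esym e).
  have upl : up l = m.
    by apply: odd_box_up_uniq (upP nl lw) _; rewrite e.
  rewrite /a' (bigD1 l) //= big1 => [|l' l'l].
    rewrite addr0 bE // upl divfK ?subrr //.
    by rewrite -upl; exact: c_up.
  (* Another contribution would come from a low [l'] joined to the high [m], hence by a box at the
     first corner, which forces [l' = l]. *)
  apply/eqP; rewrite mulf_eq0; apply/negPn/negP; rewrite negb_or => /andP[bl' cl'].
  have [_ lw'] := b_low _ bl'.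
  have := edge_low cl'; rewrite lw' (negPf nlow) => /(_ isT) b'.
  by rewrite (odd_box_down_uniq b' lm) eqxx in l'l.
have a'c m : \sum_l a' l * c l m = 0.
  rewrite /a'; under eq_bigr do rewrite mulrBl.
  rewrite sumrB ac sub0r; apply/eqP; rewrite oppr_eq0; apply/eqP.
  under eq_bigr do rewrite mulr_suml.
  rewrite exchange_big big1 // => k _.
  under eq_bigr do rewrite -mulrA.
  by rewrite -mulr_sumr cc mulr0.
exists b => m nis; apply/eqP; rewrite -subr_eq0 -/(a' m).
case: (boolP (low m)) => [lw|nlw]; last by rewrite a'high.
have up_m := upP nis lw; have /and4P[i0 iN oi _] := first_cornerP nis.
have [_ [nu e]] := edge_first up_m oi.
have /andP[_ nlu] := low_of up_m oi (erefl _).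
(* In the cocycle equation at the upper end of the edge, the only low diagram incident to [up m] is
   [m], and [a'] vanishes at the high ones. *)
have := a'c (up m); rewrite (bigD1 m) //= big1 => [|l lm].
  by rewrite addr0 => /eqP; rewrite mulf_eq0 (negPf (c_up _ nis lw)) orbF.
apply/eqP; rewrite mulf_eq0; apply/negPn/negP; rewrite negb_or => /andP[al cl].
have [nl _] : ~ corner_free l /\ True.
  by have /cP[i b' o] := cl; have [] := edge_first b' o.
have lwl : low l by apply: contraNT al => nlw; rewrite a'high.
have := edge_low cl; rewrite lwl (negPf nlu) => /(_ isT) b'.
by rewrite (odd_box_down_uniq b' (m := up m) (l' := m)) ?eqxx // -?e in lm.
Qed.

End Acyclic.
End OddBoxes.

(** * Diagrams without odd corners *)

Lemma young_exists (p q : nat) (f : nat -> nat) :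
  (forall i, (f i <= q)%N) -> (forall i, (f i.+1 <= f i)%N) ->
  exists l : young p q, forall i, (i < p)%N -> nth 0%N (parts l) i = f i.
Proof.
move=> fq fm; pose t : p.-tuple 'I_q.+1 := [tuple inord (f (i : 'I_p)) | i < p].
have tE i : (i < p)%N -> nth 0%N [seq val x | x <- t] i = f i.
  move=> ip; rewrite (nth_map ord0) ?size_tuple //.
  have := tnth_mktuple (fun i : 'I_p => inord (f i) : 'I_q.+1) (Ordinal ip).
  by rewrite (tnth_nth ord0) => ->; rewrite /= inordK // ltnS.
have srt : sorted geq [seq val x | x <- t].
  apply/(sortedP 0%N) => i; rewrite size_map size_tuple => ip.
  by rewrite !tE //; [exact: fm | exact: ltnW].
by exists (exist _ t srt).
Qed.

Lemma same_diagramP (s t : seq nat) :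
  reflect (forall j, nth 0%N s j = nth 0%N t j) (same_diagram s t).
Proof.
apply: (iffP forallP) => [st j|st j]; last by rewrite st.
case: (ltnP j (maxn (size s) (size t))) => [jm|]; first exact/eqP/(st (Ordinal jm)).
by rewrite geq_max => /andP[sj tj]; rewrite !nth_default.
Qed.

Lemma nth_doubled s j : nth 0%N (doubled s) j = (nth 0%N s j./2).*2.
Proof.
have [n] := ubnP j; elim: n s j => // n IH [|x s] j jn; first by rewrite !nth_nil.
by case: j jn => [|[|j]] //= jn; apply: IH; lia.
Qed.

Lemma size_doubled s : size (doubled s) = (size s).*2.
Proof. by elim: s => //= x s ->. Qed.

Lemma nth_hooked q s j :
  nth 0%N (hooked q s) j =
  if j is j'.+1 then (if (j' < size s)%N then (nth 0%N s j').+1 else 0%N) else q.+1.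
Proof.
case: j => //= j; case: ltnP => js; first by rewrite (nth_map 0%N).
by rewrite nth_default ?size_map.
Qed.

Section Rows.
Variables (N K : nat) (hK : (K <= N)%N).
Local Notation Y := (young K (N - K)).
Implicit Types (l m : Y).
Local Notation pv := (pv hK).

Lemma part0 l j : (K <= j)%N -> part l j = 0%N.
Proof. by move=> Kj; rewrite /part nth_default // size_parts. Qed.

Lemma part_mono l j : (part l j.+1 <= part l j)%N.
Proof.
case: (ltnP j.+1 K) => [jK|Kj]; last by rewrite part0.
exact: (@part_anti N K hK l j (Ordinal jK)) (leqnSn j) jK.
Qed.

Lemma part_bound l j : (part l j <= N - K)%N.
Proof.
case: (ltnP j K) => [jK|Kj]; last by rewrite part0.
by have := part_le l (Ordinal jK).
Qed.

Definition addable l j := if j is j'.+1 then (part l j < part l j')%N else (part l 0 < N - K)%N.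

(** In the second clause the parity is reversed, because a removable box is one added to a diagram
    whose [j]-th part is smaller by one. *)
Lemma corner_freeP l : corner_free hK l <-> forall j, (j < K)%N ->
  (addable l j -> ~~ odd (part l j + j)) /\
  ((part l j.+1 < part l j)%N -> odd (part l j + j)).
Proof.
have pE j (jK : (j < K)%N) : (pv l (Ordinal jK) + part l j = N - K + j)%N := pvE hK l (Ordinal jK).
split=> [iso j jK|rows i].
  split=> [ad|rm].
    have := iso (pv l (Ordinal jK)); apply: contra => op.
    have h0 : (0 < pv l (Ordinal jK))%N.
      have := pE j jK; case: j {op} jK ad => [|j] jK /= ad; first lia.
      by have := part_bound l j; lia.
    rewrite /corner h0 ltn_ord bitP (_ : odd _); last by have := pE j jK; lia.
    rewrite !andTb addTb; apply/existsP => -[k /eqP e].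
    have kj : (k < j)%N.
      rewrite ltnNge; apply/negP; rewrite leq_eqVlt => /orP[/eqP jk|jk].
        by move: e; rewrite (_ : k = Ordinal jK); [lia | exact/val_inj].
      by have := @pv_inc N K hK l (Ordinal jK) k jk; lia.
    case: j {op} jK ad e kj h0 => [|j] // jK ad e kj h0; rewrite /= in ad.
    have j'K : (j < K)%N by exact: ltnW.
    have := pE j.+1 jK; have := pE j j'K; move: e ad.
    rewrite ltnS leq_eqVlt in kj; case/orP: kj => [/eqP jk|jk].
      by rewrite (_ : k = Ordinal j'K) => *; [lia | exact/val_inj].
    by have := @pv_inc N K hK l k (Ordinal j'K) jk; lia.
  have := iso (pv l (Ordinal jK)).+1; apply: contraR => op.
  rewrite /corner succnK bitP (_ : odd _ = true); last by have := pE j jK; lia.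
  rewrite (_ : (_ < N)%N = true); last by have := pE j jK; lia.
  rewrite ltn0Sn !andTb addbT; apply/existsP => -[k /eqP e].
  have kj : (j < k)%N.
    rewrite ltnNge; apply/negP; rewrite leq_eqVlt => /orP[/eqP jk|jk].
      by move: e; rewrite (_ : k = Ordinal jK); [lia | exact/val_inj].
    by have := @pv_inc N K hK l k (Ordinal jK) jk; lia.
  have j'K : (j.+1 < K)%N by have := ltn_ord k; lia.
  have := pE j jK; have := pE j.+1 j'K; move: e rm.
  rewrite leq_eqVlt in kj; case/orP: kj => [/eqP jk|jk].
    by rewrite (_ : k = Ordinal j'K) => *; [lia | exact/val_inj].
  by have := @pv_inc N K hK l (Ordinal j'K) k jk; lia.
apply/negP => /and4P[i0 iN oi].
case bi : (bit hK l i) => /=.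
  move/existsP: bi => [[j jK] /eqP e] nb.
  have := pE j jK; rewrite e => pj.
  have [+ _] := rows j jK; rewrite (_ : odd _ = true); last lia.
  case: j jK e pj => [|j] jK e pj /=; first by move=> /(_ _)/negP; apply=> //; lia.
  have j'K : (j < K)%N by exact: ltnW.
  move=> /(_ _)/negP; apply=> //; rewrite ltn_neqAle part_mono andbT.
  apply: contra nb => /eqP ee; apply/existsP; exists (Ordinal j'K).
  by have := pE j j'K; lia.
move=> /existsP[[j jK] /eqP e].
have := pE j jK; rewrite e => pj.
have [_] := rows j jK; rewrite (_ : odd _ = false); last lia.
move=> /(_ _)/negP; apply=> //; rewrite ltn_neqAle part_mono andbT.
apply/eqP => ee; case: (ltnP j.+1 K) => [j'K|Kj].
  move/existsP: bi; apply; exists (Ordinal j'K).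
  by have := pE j.+1 j'K; lia.
by have := part0 l Kj; lia.
Qed.

(** In a row of even index and even length a removable box would be of odd type, so the next row is
    equal. If the row after that is shorter, it is addable, which forces its length to be even. *)
Lemma corner_free_even l : corner_free hK l -> ~~ odd (part l 0) ->
  forall i, ~~ odd (part l i.*2) /\ part l i.*2.+1 = part l i.*2.
Proof.
move=> /corner_freeP rows e0; suff ev i : ~~ odd (part l i.*2) ->
    ~~ odd (part l i.*2) /\ part l i.*2.+1 = part l i.*2.
  elim=> [|i [IH1 IH2]]; first exact: ev.
  apply: ev; rewrite doubleS; case: (ltnP i.*2.+2 K) => [iK|Ki]; last by rewrite part0.
  have [+ _] := rows _ iK; rewrite /= IH2.
  have := part_mono l i.*2.+1; rewrite IH2 leq_eqVlt => /orP[/eqP -> //|lt] /(_ lt).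
  by rewrite oddD /= negbK odd_double addbF.
move=> op; split=> //; case: (ltnP i.*2 K) => [iK|Ki]; last by rewrite !part0 //; lia.
have [_] := rows _ iK; have := part_mono l i.*2; rewrite leq_eqVlt => /orP[/eqP //|lt] /(_ lt).
by rewrite oddD odd_double addbF (negPf op).
Qed.

(** A box added to an odd first row would be of odd type, so that row is full. Below it the rows are
    paired as in the even case, with indices shifted by one. *)
Lemma corner_free_odd l : corner_free hK l -> odd (part l 0) ->
  part l 0 = (N - K)%N /\
  forall j, (j < K)%N -> odd (part l j) /\ (odd j -> part l j.+1 = part l j).
Proof.
move=> /corner_freeP rows o0.
have K0 : (0 < K)%N by rewrite lt0n; apply: contraTneq o0 => e; rewrite part0 ?e.
split.
  have [+ _] := rows 0%N K0; rewrite addn0 o0 /=.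
  by have := part_bound l 0; rewrite leq_eqVlt => /orP[/eqP //|lt] /(_ lt).
have eqn j : (j < K)%N -> odd (part l j) -> odd j -> part l j.+1 = part l j.
  move=> jK oj o; have [_] := rows j jK; rewrite oddD oj o /=.
  by have := part_mono l j; rewrite leq_eqVlt => /orP[/eqP //|lt] /(_ lt).
elim=> [|j IH] jK; first by split.
have [oj ej] := IH (ltnW jK); split; last first.
  move=> o; apply: eqn => //; move: o => /= nj.
  have [+ _] := rows j.+1 jK; have := part_mono l j.
  rewrite leq_eqVlt => /orP[/eqP -> //|lt] /(_ lt).
  by rewrite oddD /= nj addbT negbK.
case oo : (odd j); first by rewrite ej.
have [+ _] := rows j.+1 jK; have := part_mono l j.
rewrite leq_eqVlt => /orP[/eqP -> //|lt] /(_ lt).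
by rewrite oddD /= oo addbT negbK.
Qed.

Lemma corner_free_diagram m :
  let k := K./2 in
  let n := N./2 in
  let D : {set Y} := [set m : Y |
    [exists l : young k (n - k), same_diagram (parts m) (doubled (parts l))]]%SET in
  let LD : {set Y} := [set m : Y |
    [exists l : young k (n - k),
      same_diagram (parts m) (hooked (N - K).-1 (doubled (parts l)))]]%SET in
  corner_free hK m <-> m \in (if ~~ odd N && odd K then D :|: LD else D)%SET.
Proof.
move=> k n D LD.
have DP : m \in D <-> exists l : young k (n - k), forall j,
    part m j = (nth 0%N (parts l) j./2).*2.
  rewrite inE; split=> [/existsP[l /same_diagramP e]|[l e]].
    by exists l => j; rewrite /part e nth_doubled.
  by apply/existsP; exists l; apply/same_diagramP => j; rewrite -[LHS]/(part m j) e nth_doubled.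
have LDP : m \in LD <-> exists l : young k (n - k), forall j,
    part m j = if j is j'.+1 then (if (j' < k.*2)%N then (nth 0%N (parts l) j'./2).*2.+1 else 0%N)
               else (N - K).-1.+1.
  rewrite inE; split=> [/existsP[l /same_diagramP e]|[l e]].
    exists l => j; rewrite /part e nth_hooked size_doubled size_map size_tuple.
    by case: j => // j; rewrite nth_doubled.
  apply/existsP; exists l; apply/same_diagramP => j.
  rewrite -[LHS]/(part m j) e nth_hooked size_doubled size_map size_tuple.
  by case: j => // j; rewrite nth_doubled.
split=> [iso|].
  case o0 : (odd (part m 0)); last first.
    have ev := corner_free_even iso (negbT o0).
    suff mD : m \in D by case: ifP => // _; rewrite inE mD.
    apply/DP; have [||l lE] := @young_exists k (n - k) (fun i => (part m i.*2)./2).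
    (* [(N - K)./2] is [n - k], or [n - k - 1] when [N] is even and [K] is odd. *)
    - move=> i; apply: leq_trans (half_leq (part_bound m _)) _.
      by rewrite /n /k; lia.
    - move=> i; apply: half_leq; rewrite doubleS.
      exact: leq_trans (part_mono _ _) (part_mono _ _).
    exists l => j; have -> : part m j = part m j./2.*2.
      rewrite -[in LHS](odd_double_half j); case: (odd j) => //=.
      by rewrite add1n; have [_ ->] := ev j./2.
    have [e1 e2] := ev j./2; case: (ltnP j./2 k) => jk.
      by rewrite lE // -[LHS]odd_double_half (negPf e1).
    rewrite nth_default ?size_map ?size_tuple // -e2 part0 //.
    by rewrite /k in jk; lia.
  have [m0 rows] := corner_free_odd iso o0.
  have K0 : (0 < K)%N by rewrite lt0n; apply: contraTneq o0 => e; rewrite part0 ?e.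
  (* For [K] even, the last row has odd index and would equal the row after it, which is empty and
     so of even length. *)
  have oK : odd K.
    apply/negPn/negP => nK; have K1 : (K.-1 < K)%N by lia.
    have [oK1 /(_ _)] := rows _ K1; rewrite prednK // part0 // => e.
    by move: oK1; rewrite -e //; lia.
  have nN : ~~ odd N by rewrite m0 in o0; lia.
  rewrite nN oK /= inE; apply/orP; right; apply/LDP.
  have [||l lE] := @young_exists k (n - k) (fun i => (part m i.*2.+1)./2).
  - move=> i; apply: leq_trans (half_leq (part_bound m _)) _.
    by rewrite /n /k; lia.
  - move=> i; apply: half_leq; rewrite doubleS.
    exact: leq_trans (part_mono _ _) (part_mono _ _).
  exists l => -[|j]; first by rewrite m0 prednK //; rewrite m0 in o0; lia.
  case: ltnP => jk; last by rewrite part0 //; rewrite /k in jk; lia.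
  have jK : (j./2.*2.+1 < K)%N by rewrite /k in jk; lia.
  rewrite lE; last by lia.
  have [oj e1] := rows _ jK; rewrite /= odd_double in e1.
  have -> : part m j.+1 = part m j./2.*2.+1.
    by rewrite -[in LHS](odd_double_half j); case: (odd j); rewrite ?add1n ?e1.
  by rewrite -[LHS]odd_double_half oj.
have DI : m \in D -> corner_free hK m.
  move=> /DP[l e]; apply/corner_freeP => j jK; split.
    case: j jK => [|j] jK /=; first by rewrite e /= addn0 odd_double.
    rewrite !e oddD odd_double /= negbK.
    by case oj: (odd j) => //; rewrite uphalf_half oj add0n ltnn.
  rewrite !e oddD odd_double /=.
  by case oj: (odd j) => //; rewrite uphalf_half oj add0n ltnn.
case: ifP => [/andP[nN oK]|_]; last exact: DI.
rewrite inE => /orP[/DI //|/LDP[l e]].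
apply/corner_freeP => j jK.
(* The first row and the [k.*2] rows below it fill all [K] rows. *)
have k2 : k.*2 = K.-1 by rewrite /k; lia.
have oQ : odd (N - K) by lia.
split.
  case: j jK => [|[|j]] jK /=; first by rewrite e /=; lia.
    move=> _; rewrite e k2 (_ : (0 < K.-1)%N); last by lia.
    by rewrite addn1 /= odd_double.
  rewrite !e k2 (_ : (j.+1 < K.-1)%N) /=; last lia.
  rewrite (_ : (j < K.-1)%N) /=; last lia.
  case oj: (odd j); first by lia.
  by rewrite uphalf_half oj add0n ltnn.
case: j jK => [|j] jK /=; first by rewrite (e 0%N) addn0 => _; lia.
rewrite (e j.+1) k2 (_ : (j < K.-1)%N); last lia.
case: (ltnP j.+1 K.-1) => jK'; last by move=> _; lia.
rewrite e k2 jK' /=.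
case oj: (odd j); first by lia.
by rewrite uphalf_half oj add0n ltnn.
Qed.

End Rows.

(** * Schubert classes *)

Lemma succ_sum (I : finType) (f g : I -> nat) : (forall i, f i <= g i)%N ->
  (\sum_i g i = (\sum_i f i).+1)%N ->
  exists j, g j = (f j).+1 /\ forall i, i != j -> g i = f i.
Proof.
move=> fg sum; have [j fj] : exists j, (f j < g j)%N.
  apply: contrapT => no; suff : (\sum_i g i <= \sum_i f i)%N by rewrite sum ltnn.
  apply: leq_sum => i _; rewrite leqNgt; apply/negP => fi; apply: no.
  by exists i.
have rest : (\sum_(i | i != j) f i <= \sum_(i | i != j) g i)%N by apply: leq_sum.
move: sum; rewrite (bigD1 j) // [X in _ = X.+1](bigD1 j) //= => sum.
exists j; split=> [|i ij]; first by move: sum rest fj; lia.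
have restij : (\sum_(k | (k != j) && (k != i)) f k <= \sum_(k | (k != j) && (k != i)) g k)%N.
  by apply: leq_sum.
move: sum; rewrite (bigD1 i) // [X in (_ + X).+1](bigD1 i) //= => sum.
by have := fg i; move: sum restij fj; lia.
Qed.

Lemma not_carried0 (R : realType) (X : topologicalType) n (s : singular R n X) :
  ~ carried set0 s.
Proof. by move=> /(_ (vertex R (@ord0 n))). Qed.

Lemma rel_coboundary_sum (R : realType) (X : topologicalType) (A : comPzRingType)
  (P Q : set X) (I : finType) (p : pred I) (f : I -> cochain R X A) :
  (forall i, p i -> rel_coboundary P Q (f i)) ->
  rel_coboundary P Q (fun n s => \sum_(i | p i) f i n s).
Proof.
move=> fP.
have : forall i, exists g : cochain R X A, p i ->
    (forall n (s : singular R n X), carried Q s -> g n s = 0) /\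
    (forall n (s : singular R n X), carried P s -> f i n s = cobound g s).
  move=> i; case pi : (p i); last by exists (fun n _ => 0).
  by have [g gP] := fP i pi; exists g.
move=> /choice[g gP]; exists (fun n s => \sum_(i | p i) g i n s); split=> n s sP.
  by apply: big1 => i pi; have [-> //] := gP i pi.
by rewrite cobound_sum; apply: eq_bigr => i pi; have [_ ->] := gP i pi.
Qed.

Lemma rel_coboundary_hcomp (R : realType) (X : topologicalType) (A : comPzRingType)
  (P Q : set X) (i : nat) (f : cochain R X A) :
  rel_coboundary P Q f -> rel_coboundary P Q (hcomp i f).
Proof.
move=> [g [gQ gE]]; case: i => [|i].
  apply: rel_coboundary0 => -[|n] s sP //; rewrite /hcomp eqxx gE //.
exists (hcomp i g); split=> n s sP.
  by rewrite /hcomp; case: ifP => // _; exact: gQ.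
by rewrite cobound_hcomp /hcomp; case: ifP => // _; exact: gE.
Qed.

Section SchubertBasis.
Variables (R : realType) (N K : nat) (hK : (K <= N)%N).
Local Notation Y := (young K (N - K)).
Local Notation G := (Gr R N K).
Implicit Types (l m k : Y) (S T : pred Y).
Local Notation cell := (@schubert_cell R N K).
Local Notation union := (@union R N K).
Local Notation cellopen := (@cellopen R N K hK).
Local Notation punctured := (@punctured R N K hK).
Local Notation pv := (pv hK).
Local Notation F := (@stratum_lt R N K).
Variables (theta W : Y -> cochain R G int) (c : Y -> Y -> int).
Hypothesis thetaP : forall l, [/\ homogeneous (codim l) (theta l),
  zgenerates (cellopen l) (punctured l) (theta l)
  & forall i : 'I_N, rel_coboundary (cellopen l) (punctured l)
      (fun n s => pull (@grflip_continuous R N K i) (theta l) s -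
         (-1) ^+ #|flipset i (pv l) :&: normals (pv l)|%SET * theta l s)].
Hypothesis WP : forall l, good hK theta W c l.

Let thom : thom_family hK theta.
Proof. by move=> l; have [] := thetaP l. Qed.

(** A nonzero coefficient requires the cell [l] to meet the chart of [m], so the parts of [l] are at
    most those of [m]. As the codimensions differ by one, [m] has exactly one more box, and
    [coef_box] decides. *)
Lemma coef_neq0 l m :
  c l m != 0 <-> exists2 i, odd_box hK l m i & odd (N - K + i).
Proof.
split=> [cn|[i [j lmj <-] oi]].
  have [_ _ _ _ /(_ m cn) lm] := WP l.
  have [U [Um Ul]] : exists U, cellopen m U /\ cell l U.
    apply: contrapT => no; case/eqP: cn; apply: (coef_eq0_apart thetaP WP lm) => U Um Ul.
    by apply: no; exists U.
  have le (j : 'I_K) : (part l j <= part m j)%N.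
    by have := cellopen_cell Um Ul j; have := pvE hK l j; have := pvE hK m j; lia.
  have [j [mj mo]] : exists j : 'I_K, part m j = (part l j).+1 /\
      forall i : 'I_K, i != j -> part m i = part l i.
    by apply: (@succ_sum _ (fun j : 'I_K => part l j) (fun j : 'I_K => part m j)); rewrite -?codimE.
  exists (pv l j); first by exists j.
  have := coef_box thetaP WP lm mj mo; rewrite (negPf cn) => /esym/negbFE.
  by have := pvE hK l j; lia.
have lm := box_at_codim lmj; have [mj mo] := lmj.
by rewrite (coef_box thetaP WP lm mj mo) negbK; have := pvE hK l j; lia.
Qed.

Let W_cellopen m k n (s : singular R n G) : codim m = codim k -> m != k ->
  carried (cellopen k) s -> W m s = 0.
Proof.
move=> mk nmk sk; have [_ W0 _ _ _] := WP m; apply: W0 => x.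
have [p pU] := cell_cover hK (s x); exists p => //; apply/andP.
case: (eqVneq p k) => [->|pk]; first by rewrite mk leqnn eq_sym.
have pl := cellopen_codim (sk x) pU pk; split; first by rewrite mk ltnW.
by apply: contraTneq pl => ->; rewrite mk ltnn.
Qed.

(** The double coboundary of [W l] gives a vanishing combination of the [W k]. All [k] involved have
    the same codimension, so in the chart of [m] only [W m] is left, and it generates. *)
Lemma coef_coef l m : \sum_k c l k * c k m = 0.
Proof.
pose e m := \sum_k c l k * c k m.
have e_codim k : e k != 0 -> codim k = (codim l).+2.
  move=> ek; apply: contrapT => nk; case/eqP: ek; apply: big1 => p _.
  apply/eqP; rewrite mulf_eq0; apply/negPn/negP; rewrite negb_or => /andP[lp pk].
  have [_ _ _ _ /(_ p lp) lp'] := WP l; have [_ _ _ _ /(_ k pk) pk'] := WP p.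
  by apply: nk; rewrite pk' lp'.
have eW n (s : singular R n G) : \sum_k e k * W k s = 0.
  rewrite -[RHS](@cobound_cobound R G int (W l) n s).
  have [_ _ _ dW _] := WP l.
  rewrite (@eq_cobound R G int setT _ (fun n s => \sum_k c l k * W k s)) //.
  rewrite cobound_sum; under eq_bigr do rewrite mulr_suml.
  rewrite exchange_big; apply: eq_bigr => p _.
  rewrite coboundZ; have [_ _ _ -> _] := WP p.
  by rewrite mulr_sumr; apply: eq_bigr => k _; rewrite mulrA.
rewrite -/(e m); apply/eqP/negPn/negP => em; case/eqP: (em).
have [_ _] := generates_W thetaP WP m; apply; apply: rel_coboundary0 => n s sm.
rewrite -[RHS](eW n s) (bigD1 m) //= big1 ?addr0 // => k km.
have [->|ek] := eqVneq (e k) 0; first by rewrite mul0r.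
have ekm : codim k = codim m by rewrite (e_codim k ek) (e_codim m em).
by rewrite (W_cellopen ekm km sm) mulr0.
Qed.

Let cP (A : numFieldType) l m : (c l m)%:~R != 0 :> A <->
  exists2 i, odd_box hK l m i & odd (N - K + i).
Proof. by rewrite intr_eq0; exact: coef_neq0. Qed.

Lemma corner_free_coef0 l m : corner_free hK l -> c l m = 0 /\ c m l = 0.
Proof.
move=> iso; have [/eqP + /eqP] := corner_free_coef (@cP rat) m iso.
by rewrite !intr_eq0 => /eqP -> /eqP ->.
Qed.

Section CornerFree.
Variable l : Y.
Hypothesis iso : corner_free hK l.

Lemma corner_free_cobound n (s : singular R n G) : cobound (W l) s = 0.
Proof.
have [_ _ _ -> _] := WP l; apply: big1 => m _.
by have [-> _] := corner_free_coef0 m iso; rewrite mul0r.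
Qed.

Let i := codim l.

Let W_stratum m n (s : singular R n G) : codim m = i -> carried (F i) s -> W m s = 0.
Proof.
move=> mi sF; have [_ W0 _ _ _] := WP m; apply: W0 => x.
have [p pi pU] := sF x; exists p => //; apply/andP; split; first by rewrite mi ltnW.
by apply: contraTneq pi => ->; rewrite mi ltnn.
Qed.

Let W_cell m k n (s : singular R n G) : codim m = i -> codim k = i -> m != k ->
  carried (F i `|` cell k) s -> W m s = 0.
Proof.
move=> mi ki mk sF; have [_ W0 _ _ _] := WP m; apply: W0 => x.
case: (sF x) => [[p pi pU]|kU].
  exists p => //; apply/andP; split; first by rewrite mi ltnW.
  by apply: contraTneq pi => ->; rewrite mi ltnn.
by exists k => //; apply/andP; rewrite mi ki leqnn eq_sym.
Qed.

Let W_generates m : codim m = i -> generates (F i `|` cell m) (F i) (W m).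
Proof.
move=> mi; have := @good_generates R N K hK theta W c int thom m (fun k => (codim k < i)%N)
  (fun k _ => WP k) (@lower_codim_lt N K i).
rewrite mi ltnn => /(_ isT) /(_ (fun k h => h)).
rewrite -stratum_ltE (_ : union _ = F i `|` cell m); last first.
  rewrite eqEsubset; split=> U.
    by move=> [k /orP[/eqP ->|ki] kU]; [right | left; exists k].
  by move=> [[k ki kU]|mU]; [exists k; rewrite ?ki ?orbT | exists m; rewrite ?eqxx].
apply: eq_generates => n s sP; first exact: W_stratum.
by rewrite /castc intz.
Qed.

Lemma cooriented_W : cooriented_cell l (W l).
Proof.
have [Wh _ _ _ _] := WP l; split=> //.
- by split=> n s sF; [exact: W_stratum | exact: corner_free_cobound].
- by move=> m mi ml; apply: rel_coboundary0 => n s; apply: W_cell => //; rewrite eq_sym.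
- by move=> v _ vc; have [_ + _] := W_generates (erefl : codim l = i); apply.
Qed.

(** With no incident diagram, [W l] is a cocycle on the whole Grassmannian and serves both as the
    cooriented cell and as the class. *)
Lemma schubert_class_W : schubert_class l (W l).
Proof.
have [Wh _ _ _ _] := WP l; split=> //.
  by split=> n s; [move=> /not_carried0 | move=> _; exact: corner_free_cobound].
exists (W l); split; first exact: cooriented_W.
  by apply: rel_coboundary0 => n s _; exact: corner_free_cobound.
by apply: rel_coboundary0 => n s _; rewrite subrr.
Qed.

Let quasi_int S T : lower S -> lower T -> (forall k, S k -> T k) -> quasi_iso W c int S T.
Proof. by move=> Sl Tl ST; exact: (good_quasi_iso int thom (fun k _ => WP k) Sl Tl ST). Qed.

(* A coorientation is unique up to sign; and a class vanishing on F i.+1 is a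
   combination of cochains W k of degree > i. *)
Lemma schubert_class_unique f : schubert_class l f ->
  exists e : int, e * e = 1 /\ rel_coboundary setT set0 (fun n s => f n s - e * W l s).
Proof.
move=> [fh fc [w [[wh wc w3 w4] _ fw]]].
have [qs _] := @quasi_int (fun k => (codim k < i)%N) (fun k => (codim k < i.+1)%N)
  (@lower_codim_lt N K i) (@lower_codim_lt N K i.+1) (fun k ki => leqW ki).
have := qs w; rewrite -!stratum_ltE => /(_ wc)[a [_ aE]].
have Fi_sub m : codim m = i -> F i `|` cell m `<=` F i.+1.
  move=> mi U [[p pi pU]|mU]; first by exists p => //; exact: leqW.
  by exists m => //; rewrite mi.
have pE k : (codim k < i.+1)%N && ~~ (codim k < i)%N = (codim k == i).
  by rewrite ltnS -leqNgt eqn_leq.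
(* On the cell [m] the cochain [w] is a coboundary, by definition of a cooriented cell, whereas
   [W m] generates. *)
have a0 m : codim m = i -> m != l -> a m = 0.
  move=> mi ml; have [_ _] := W_generates mi; apply.
  have := rel_coboundaryB (w3 m mi ml) (rel_coboundaryS (@Fi_sub m mi) (fun x => id) aE).
  apply: eq_rel_coboundary => n s sP; rewrite opprB addrC subrK.
  rewrite (bigD1 m) ?pE ?mi ?eqxx //= /castc intz big1 ?addr0 // => k /andP[].
  by rewrite pE => /eqP ki km; rewrite (W_cell ki mi km sP) mulr0.
have wl : rel_coboundary (F i.+1) (F i) (fun n s => w n s - a l * W l s).
  apply: eq_rel_coboundary aE => n s _; congr (_ - _).
  rewrite (bigD1 l) ?pE ?eqxx //= /castc intz big1 ?addr0 // => k /andP[].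
  by rewrite pE => /eqP ki km; rewrite a0 ?mul0r.
have [Wh _ _ _ _] := WP l; have [Wc _ Winj] := W_generates (erefl : codim l = i).
have [b bE] := w4 _ Wh Wc.
(* [W l] and [w] are integer multiples of each other up to coboundaries, so the two factors are
   inverse. *)
have ba : b * a l = 1.
  apply/eqP; rewrite eq_sym -subr_eq0; apply/eqP/Winj.
  have := rel_coboundaryD bE
    (rel_coboundaryZ b (rel_coboundaryS (@Fi_sub l (erefl _)) (fun x => id) wl)).
  by apply: eq_rel_coboundary => n s _; ring.
exists (a l); split.
  have : (`|b| * `|a l|)%N = 1%N by rewrite -abszM ba.
  by move/eqP; rewrite muln_eq1 => /andP[_ /eqP]; lia.
have [g [_ gE]] := rel_coboundaryD fw (rel_coboundaryS (fun x => id) (@sub0set _ _) wl).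
set fW : cochain R G int := fun n s => f n s - a l * W l s.
have gE' n (s : singular R n G) : carried (F i.+1) s -> fW n s = cobound g s.
  by move=> sF; rewrite -gE // /fW; ring.
pose g' := zext (F i.+1) g.
have [qs' _] := @quasi_int (fun k => (codim k < i.+1)%N) predT
  (@lower_codim_lt N K i.+1) (fun _ _ _ _ => isT) (fun k ki => isT).
have := qs' (fun n s => fW n s - cobound g' s).
rewrite -stratum_ltE unionT //; case=> [|a' [_ a'E]].
  split=> n s sP; first by rewrite cobound_zext // gE' // subrr.
  rewrite coboundB cobound_cobound subr0 coboundB coboundZ corner_free_cobound mulr0 subr0.
  by have [_ ->] := fc.
have := rel_coboundaryD (rel_coboundaryS (fun x => id) (@sub0set _ _) a'E)
  (@rel_coboundary_cobound R G int setT set0 g' (fun n s s0 => False_ind _ (not_carried0 s0))).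
(* The remaining combination of the [W k] has no component in degree [i]. *)
move/(rel_coboundary_hcomp i); apply: eq_rel_coboundary => n s _.
rewrite /hcomp; case: eqVneq => [ni|ni].
  rewrite (_ : \sum_(k | _) _ = 0) ?subr0 ?subrK //.
  apply: big1 => k; rewrite /= -leqNgt => ik; have [Wk _ _ _ _] := WP k.
  by rewrite /castc Wk ?mulr0 // ni; apply: contraTneq ik => <-; rewrite ltnn.
by rewrite /fW fh // Wh // mulr0 subrr.
Qed.

End CornerFree.

(** Up to signs and coboundaries [f l] is [W l]. By the acyclic matching, a cocycle of the finite
    rational complex agrees outside [L] with a differential; and no differential has a component in
    [L], whose diagrams are incident to nothing. *)
Lemma corner_free_basis (L : {set Y}) : (forall l, corner_free hK l <-> l \in L) ->
  schubert_basis R L.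
Proof.
move=> LP; split=> [l /LP iso|f fL]; first by exists (W l); exact: schubert_class_W.
have : forall l, exists e : int, l \in L -> e * e = 1 /\
    rel_coboundary setT set0 (fun n s => f l n s - e * W l s).
  move=> l; case: (boolP (l \in L)) => lL; last by exists 0.
  by have [e eP] := schubert_class_unique (proj2 (LP l) lL) (fL l lL); exists e.
move=> /choice[e eP].
pose eq : Y -> rat := fun l => (e l)%:~R.
have ee l : l \in L -> eq l * eq l = 1 by move=> /eP[e1 _]; rewrite -intrM e1.
pose WQ l : cochain R G rat := castc rat (W l).
have fW l : l \in L -> rel_coboundary setT set0
    (fun n s => rationalize (f l) s - eq l * WQ l n s).
  move=> /eP[_ /(rel_coboundary_castc rat)]; apply: eq_rel_coboundary => n s _.
  by rewrite /castc rmorphB rmorphM.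
have [qs qi] := @good_quasi_iso R N K hK theta W c rat thom pred0 predT (fun k _ => WP k)
  (fun _ _ h => False_ind _ (notF h)) (fun _ _ _ _ => isT) (fun k ki => isT).
have u0 : union pred0 = set0 by rewrite eqEsubset; split=> U [].
rewrite unionT // u0 in qs qi.
have cc l m : \sum_k (c l k)%:~R * (c k m)%:~R = 0 :> rat.
  have := congr1 (intr : int -> rat) (coef_coef l m); rewrite rmorph_sum (mulr0z 1); apply: etrans.
  by apply: eq_bigr => k _; rewrite rmorphM.
have dWQ l n (s : singular R n G) : cobound (WQ l) s = \sum_m (c l m)%:~R * WQ m n s.
  have [_ _ _ dW _] := WP l; rewrite cobound_castc dW rmorph_sum.
  by apply: eq_bigr => m _; rewrite rmorphM.
split=> [l lL|g gc _|a aE l lL].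
- by have [_ fc _] := fL l lL; exact: (rel_cocycle_castc rat fc).
- have [a [ac aE]] := qs g gc.
  have [|b bE] := odd_boxes_acyclic (@cP rat) cc (a := a).
    by move=> m; apply: ac.
  (* The sign [eq l] is its own inverse. *)
  exists (fun l => a l * eq l).
  have sumE n (s : singular R n G) : \sum_k a k * WQ k n s =
      \sum_(k in L) a k * WQ k n s + cobound (fun n s => \sum_k b k * WQ k n s) s.
    rewrite cobound_sum.
    under [X in _ + X]eq_bigr do rewrite coboundZ dWQ mulr_sumr.
    rewrite [X in _ + X]exchange_big [X in X + _]big_mkcond -big_split /=.
    apply: eq_bigr => m _; under eq_bigr do rewrite mulrA; rewrite -mulr_suml.
    case: ifPn => mL.
      rewrite big1 ?mul0r ?addr0 // => k _.
      have [_ ->] := corner_free_coef0 k (proj2 (LP m) mL).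
      by rewrite mulr0.
    by rewrite add0r bE // => /LP; apply/negP.
  have fs : rel_coboundary setT set0 (fun n s => \sum_(k in L)
      (a k * eq k) * (rationalize (f k) s - eq k * WQ k n s)).
    by apply: rel_coboundary_sum => k kL; apply: rel_coboundaryZ; exact: fW.
  have := rel_coboundaryB (rel_coboundaryD aE (@rel_coboundary_cobound R G rat setT set0
    (fun n s => \sum_k b k * WQ k n s) (fun n s s0 => False_ind _ (not_carried0 s0)))) fs.
  apply: eq_rel_coboundary => n s _.
  rewrite [X in _ - X + _ - _](_ : _ = \sum_k a k * WQ k n s); last exact: eq_bigl.
  rewrite sumE (_ : \sum_(k in L) a k * eq k * (_ - _) =
    \sum_(k in L) a k * eq k * rationalize (f k) s - \sum_(k in L) a k * WQ k n s); first by ring.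
  rewrite -sumrB; apply: eq_bigr => k kL.
  rewrite mulrBr; congr (_ - _).
  by rewrite mulrA -(mulrA (a k)) ee // mulr1.
(* The coefficients of the same combination in terms of the [WQ l]. *)
pose a' l := if l \in L then a l * eq l else 0.
have [|b bE] := qi a'.
  have fs : rel_coboundary setT set0 (fun n s => \sum_(k in L)
      a k * (rationalize (f k) s - eq k * WQ k n s)).
    by apply: rel_coboundary_sum => k kL; apply: rel_coboundaryZ; exact: fW.
  apply: eq_rel_coboundary (rel_coboundaryB aE fs) => n s _.
  rewrite -sumrB [LHS]big_mkcond; apply: eq_bigr => k _; rewrite /a'.
  by case: ifP => _; [rewrite /WQ; ring | rewrite mul0r].
have := bE l isT isT; rewrite /a' lL big1 => [|k _].
  move/(congr1 ( *%R^~ (eq l))); rewrite mul0r -mulrA ee // mulr1 //.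
by have [_ ->] := corner_free_coef0 k (proj2 (LP l) lL); rewrite mulr0.
Qed.

End SchubertBasis.

Local Close Scope ring_scope.
Local Close Scope classical_set_scope.

(* [D] and [LD] are the diagrams contained in K x (N - K) of the form D(lambda),
   resp. L(D(lambda)), with lambda contained in k x (n - k). *)
Theorem theorem5p1 (R : realType) (N K : nat) (hK : (K <= N)%N) :
  let k := K./2 in
  let n := N./2 in
  let D : {set young K (N - K)} := [set m : young K (N - K) |
    [exists l : young k (n - k), same_diagram (parts m) (doubled (parts l))]] in
  let LD : {set young K (N - K)} := [set m : young K (N - K) |
    [exists l : young k (n - k),
      same_diagram (parts m) (hooked (N - K).-1 (doubled (parts l)))]] in
  schubert_basis R (if ~~ odd N && odd K then D :|: LD else D).
Proof.
move=> k n D LD.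
have [theta thetaP] := choice (thom_cell R hK).
have thom : thom_family hK theta by move=> l; have [] := thetaP l.
have [W [c WP]] := good_exists thom.
apply: (corner_free_basis thetaP WP) => l; exact: corner_free_diagram.
Qed.
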